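(* Let $f$ satisfy hypothesis (f1) and let $\lambda>0$. For any $w\in D$, $J^\varepsilon_\lambda w$ converges in $L^1(\mathbb{R},\mathbb{R})$ to a unique limit $J_\lambda w\in D$ as $\varepsilon\to0$, and the map $J_\lambda:D\to D$ is a contraction, i.e. $\|J_\lambda w_1-J_\lambda w_2\|_{L^1(\mathbb{R},\mathbb{R})}\le\|w_1-w_2\|_{L^1(\mathbb{R},\mathbb{R})}$ for all $w_1,w_2\in D$.
   Context: Hypothesis (f0) on $f:\mathbb{R}\times\mathbb{R}\to\mathbb{R}$: (i) $x\mapsto f(x,\omega)$ is in $L^\infty(\mathbb{R},\mathbb{R})$ for any $\omega\in\mathbb{R}$, and $\omega\mapsto f(x,\omega)$ is smooth for any $x\in\mathbb{R}$; (ii) there is a constant $L\ge0$ such that for any fixed $x\in\mathbb{R}$, $|f(x,\omega_1)-f(x,\omega_2)|\le L|\omega_1-\omega_2|$ for all $\omega_1,\omega_2\in\mathbb{R}$; (iii) there is a constant $L_1\ge0$ such that $\int_{\mathbb{R}}|f(x,0)|\,dx\le L_1$. Hypothesis (f1): $f$ satisfies (f0) and has the form $f(x,\omega)=f_l(\omega)$ if $x\le0$, $f(x,\omega)=f_r(\omega)$ if $x>0$, where $f_l,f_r$ are smooth functions with $f_l(0)=f_r(0)=0$ and $f_l(1)=f_r(1)$. $D=\{w\in L^1(\mathbb{R},\mathbb{R}):\ 0\le w\le1\}$. For $\varepsilon,\lambda>0$ and $w\in L^1(\mathbb{R},\mathbb{R})$, $J^\varepsilon_\lambda w$ denotes the unique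 function $u\in L^1(\mathbb{R},\mathbb{R})$ that solves $u+\lambda[f(x,u)-\varepsilon u_x]_x=w$ in the sense of distributions on $\mathbb{R}$ (it exists and is unique); $J^\varepsilon_\lambda$ maps $D$ into $D$. *)

(* Defs.v *)
(* MathComp-Analysis *)
From HB Require Import structures.
From mathcomp Require Import all_boot all_order all_algebra.
From mathcomp Require Import all_classical all_reals all_analysis.
Set Implicit Arguments.
Unset Strict Implicit.
Unset Printing Implicit Defensive.
Import Order.TTheory GRing.Theory Num.Theory.
Import numFieldNormedType.Exports.
Local Open Scope classical_set_scope.
Local Open Scope ring_scope.

(* Elements of L^1(R, R) are handled through Borel representatives, i.e.
   functions in Lfun lebesgue_measure 1; equality in L^1 is equality almost
   everywhere. *)

Definition smooth (R : realType) (g : R -> R) : Prop :=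
  forall n x, derivable (derive1n n g) x 1.

Definition test_function (R : realType) (phi : R -> R) : Prop :=
  smooth phi /\ compact (closure [set x | phi x != 0]).

(* A distribution is represented by its action on functions; only its values
   on test functions are meaningful. *)
Definition distribution_of (R : realType) (g : R -> R) : (R -> R) -> R :=
  fun phi => \int[@lebesgue_measure R]_x (g x * phi x).

Definition distribution_deriv (R : realType) (T : (R -> R) -> R) :
    (R -> R) -> R :=
  fun phi => - T (derive1 phi).

Definition hyp_f0 (R : realType) (f : R -> R -> R) : Prop :=
  [/\ (forall omega, (fun x => f x omega) \in Lfun (@lebesgue_measure R) +oo%E),
      (forall x, smooth (f x)),
      (exists2 L : R, 0 <= L & forall x omega1 omega2,
        `|f x omega1 - f x omega2| <= L * `|omega1 - omega2|) &
      (exists2 L1 : R, 0 <= L1 &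
        (\int[@lebesgue_measure R]_x `|f x 0|%:E <= L1%:E)%E)].

Definition hyp_f1 (R : realType) (f : R -> R -> R) : Prop :=
  hyp_f0 f /\
  exists fl fr : R -> R,
    [/\ (forall x omega, f x omega = if x <= 0 then fl omega else fr omega),
        smooth fl /\ smooth fr,
        fl 0 = 0 /\ fr 0 = 0 &
        fl 1 = fr 1].

Definition D (R : realType) : set (R -> R) :=
  [set w | w \in Lfun (@lebesgue_measure R) 1 /\
           {ae @lebesgue_measure R, forall x, 0 <= w x <= 1}].

(* u + lambda [f(x, u) - epsilon u_x]_x = w in the sense of distributions *)
Definition solves_resolvent (R : realType) (f : R -> R -> R)
    (epsilon lambda : R) (w u : R -> R) : Prop :=
  forall phi, test_function phi ->
    distribution_of u phi +
    lambda * distribution_deriv (fun psi =>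
        distribution_of (fun x => f x (u x)) psi -
        epsilon * distribution_deriv (distribution_of u) psi) phi =
    distribution_of w phi.

(* J^epsilon_lambda w: a representative of the unique L^1 solution; the
   default value 0 only serves to make the definition total. *)
Definition Jeps (R : realType) (f : R -> R -> R) (epsilon lambda : R)
    (w : R -> R) : R -> R :=
  xget (fun=> 0) [set u | u \in Lfun (@lebesgue_measure R) 1 /\
                          solves_resolvent f epsilon lambda w u].

Definition L1_norm (R : realType) (g : R -> R) : \bar R :=
  ('N[@lebesgue_measure R]_1[EFin \o g])%E.

Definition L1_limit0 (R : realType) (u : R -> R -> R) (v : R -> R) : Prop :=
  L1_norm (u epsilon \- v) @[epsilon --> 0^'+] --> 0%E.

(* Main.v *)
(* Let V and W be the primitives of u and w that vanish at -oo.  The viscous equation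
   integrates to lam * eps * V'' = V - W + lam * f(x, V'), where f is Lipschitz in its second
   argument and jumps only at x = 0.  For fixed eps, Kato's inequality (the equation for a
   difference of solutions tested with its sign) gives 0 <= u <= 1 and the L1 contraction,
   which passes to the limit; existence follows from the Green function of
   1 - (kap d/dx)^2 for small lam and from the resolvent identity for all lam.

   The limit exists because u is Cauchy in L1 as eps -> 0.  First, V is uniformly Cauchy:
   doubling the variables on each half-line compares the primitives of two viscosities, given
   an ordering of either their values or their slopes at 0, and the comparison from both sides
   of 0 forces the values there to be close.  Second, on a half-line the equation commutes with
   translations up to a boundary term, so that int |u(x - s) - u(x)| dx is at most
   int |w(x - s) - w(x)| dx + 2 s for every eps; hence u is L1-close, uniformly in eps, to a
   difference quotient of V, and uniform closeness of V becomes L1-closeness of u. *)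
Require Import Defs.
From HB Require Import structures.
From mathcomp Require Import all_boot all_order all_algebra.
From mathcomp Require Import all_classical all_reals all_analysis.
From mathcomp Require Import measurable_realfun.
From mathcomp Require Import ring lra.
Set Implicit Arguments.
Unset Strict Implicit.
Unset Printing Implicit Defensive.
Import Order.TTheory GRing.Theory Num.Theory.
Import numFieldNormedType.Exports.
Local Open Scope classical_set_scope.
Local Open Scope ring_scope.

(** * Oriented integrals of locally integrable functions *)


Section OrientedIntegral.
Context {R : realType}.
Implicit Types (k l u V : R -> R) (a b c x y : R).
Notation mu := (@lebesgue_measure R).

(** The obstacle is the interface. The jump of the flux at x = 0 rules out doubling the variables
    across 0, and no boundary value at 0 is known beforehand on either half-line. Passing to
    primitives gives an equation of Hamilton-Jacobi type whose solutions V are C1, so that both V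
    and its slope u have a value at 0. For two viscosities, [u1 0 <= u2 0] or [u2 0 <= u1 0].
    Reflecting the right half-line replaces V by m - V(-x), with m the total mass: the slopes are
    kept, but the comparison of the primitives is reversed. One ordering of the slopes therefore
    bounds V1 - V2 from above on the left and from below on the right, and the two bounds meet at 0.
    The function [Jeps] is an unspecified choice among distributional L1 solutions, so the estimates
    must hold for every such solution; this is why each is first shown to agree almost everywhere
    with a continuous function that satisfies the integrated equation. That equation is stated
    through increments ([isprim]), since its right-hand side jumps at 0 and V'' need not exist
    there. *)

Definition locint k := measurable_fun [set: R] k /\ forall a b, mu.-integrable `[a, b] (EFin \o k).

Lemma locint_meas k : locint k -> measurable_fun [set: R] k.
Proof. by case. Qed.

Lemma locint_itv k a b : locint k -> mu.-integrable `[a, b] (EFin \o k).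
Proof. by case. Qed.

Definition prim k x : R :=
  if 0 <= x then \int[mu]_(t in `[0, x]) k t else - \int[mu]_(t in `[x, 0]) k t.

Definition oint k a b : R := prim k b - prim k a.

(** An absolutely continuous antiderivative, stated through increments: it makes sense for a merely
    locally integrable u, in particular for an integrand that jumps with the flux at 0, and it
    leaves the additive constant of V free. *)
Definition isprim V u := forall a b, V b - V a = oint u a b.

Lemma oint_chasles k a b c : oint k a b + oint k b c = oint k a c.
Proof. by rewrite /oint; ring. Qed.

Lemma ointNN k a b : oint k a b = - oint k b a.
Proof. by rewrite /oint; ring. Qed.

Lemma ointxx k a : oint k a a = 0.
Proof. by rewrite /oint subrr. Qed.

Lemma isprim_prim k : isprim (prim k) k.
Proof. by []. Qed.

Lemma itv_chasles k a b c : locint k -> a <= b -> b <= c ->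
  \int[mu]_(t in `[a, c]) k t = \int[mu]_(t in `[a, b]) k t + \int[mu]_(t in `[b, c]) k t.
Proof.
move=> ki ab bc; apply/eqP; rewrite addrC -subr_eq; apply/eqP.
rewrite (@Rintegral_itvB _ k (BLeft a) (BRight c) b) ?bnd_simp //; last exact: locint_itv.
rewrite Rintegral_itv_obnd_cbnd //.
by apply: integrableS (locint_itv b c ki) => //; apply: subset_itvr; rewrite bnd_simp.
Qed.

Lemma itv_int1 k a : \int[mu]_(t in `[a, a]) k t = 0.
Proof. by rewrite set_itv1 Rintegral_set1. Qed.

Lemma ointE k a b : locint k -> a <= b -> oint k a b = \int[mu]_(t in `[a, b]) k t.
Proof.
move=> ki ab; rewrite /oint /prim; case: leP => [b0|b0]; case: leP => [a0|a0].
- by rewrite (itv_chasles ki a0 ab); ring.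
- by rewrite (itv_chasles ki (ltW a0) b0); ring.
- lra.
- by rewrite (itv_chasles ki ab (ltW b0)); ring.
Qed.

Lemma continuous_locint k : continuous k -> locint k.
Proof.
move=> ck; split; first exact: continuous_measurable_fun.
move=> a b; apply: continuous_compact_integrable; first exact: segment_compact.
exact: continuous_subspaceT.
Qed.

Lemma integrable_locint k : mu.-integrable setT (EFin \o k) -> locint k.
Proof.
move=> ik; split; first by apply/measurable_EFinP; exact: measurable_int ik.
by move=> a b; exact: integrableS ik.
Qed.

Lemma locint_cst c : locint (fun=> c).
Proof. by apply: continuous_locint => x; exact: cvg_cst. Qed.

Lemma locintD k l : locint k -> locint l -> locint (fun x => k x + l x).
Proof.
move=> [mk ik] [ml il]; split; first exact: measurable_funD.
by move=> a b; apply: integrableD (ik a b) (il a b).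
Qed.

Lemma locintZ c k : locint k -> locint (fun x => c * k x).
Proof.
move=> [mk ik]; split; first exact: measurable_funM.
by move=> a b; apply: (integrableZl _ c (ik a b)).
Qed.

Lemma locintN k : locint k -> locint (fun x => - k x).
Proof.
move=> ik; rewrite (_ : (fun x => - k x) = fun x => -1 * k x); first exact: locintZ.
by apply/funext => x; rewrite mulN1r.
Qed.

Lemma locintB k l : locint k -> locint l -> locint (fun x => k x - l x).
Proof. by move=> ik il; apply: locintD => //; exact: locintN. Qed.

Lemma locint_abs k : locint k -> locint (fun x => `|k x|).
Proof.
move=> [mk ik]; split; first exact: measurableT_comp.
by move=> a b; have := integrable_norm (ik a b).
Qed.

Lemma oint_le k l a b : locint k -> locint l -> a <= b ->
  (forall x, a <= x <= b -> k x <= l x) -> oint k a b <= oint l a b.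
Proof.
by move=> ik il ab h; rewrite !ointE //; apply: le_Rintegral => //; exact: locint_itv.
Qed.

Lemma oint_ge0 k a b : locint k -> a <= b ->
  (forall x, a <= x <= b -> 0 <= k x) -> 0 <= oint k a b.
Proof.
move=> ik ab h; rewrite ointE //; apply: Rintegral_ge0 => x /=.
by rewrite in_itv /=; exact: h.
Qed.

Lemma ointD k l a b : locint k -> locint l ->
  oint (fun x => k x + l x) a b = oint k a b + oint l a b.
Proof.
move=> ik il; wlog ab : a b / a <= b => [hw|].
  have [/hw//|/ltW/hw h] := leP a b.
  by rewrite ointNN h (ointNN k) (ointNN l); ring.
rewrite !ointE //; first by apply: RintegralD => //; exact: locint_itv.
exact: locintD.
Qed.

Lemma ointZ c k a b : locint k ->
  oint (fun x => c * k x) a b = c * oint k a b.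
Proof.
move=> ik; wlog ab : a b / a <= b => [hw|].
  have [/hw//|/ltW/hw h] := leP a b.
  by rewrite ointNN h (ointNN k) ; ring.
rewrite !ointE //; first by apply: RintegralZl => //; exact: locint_itv.
exact: locintZ.
Qed.

Lemma eq_oint k l a b : locint k -> locint l -> (forall x, a <= x <= b -> k x = l x) -> a <= b ->
  oint k a b = oint l a b.
Proof.
move=> ik il h ab; rewrite !ointE //; apply: eq_Rintegral => x.
by rewrite inE /= in_itv /=; exact: h.
Qed.

Lemma ointN k a b : locint k -> oint (fun x => - k x) a b = - oint k a b.
Proof.
move=> ik; rewrite -mulN1r -ointZ //; congr (oint _ a b).
by apply/funext => x; rewrite mulN1r.
Qed.

Lemma ointB k l a b : locint k -> locint l ->
  oint (fun x => k x - l x) a b = oint k a b - oint l a b.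
Proof. by move=> ik il; rewrite ointD ?ointN //; exact: locintN. Qed.

Lemma oint_cst c a b : oint (fun=> c) a b = c * (b - a).
Proof.
wlog ab : a b / a <= b => [hw|].
  have [/hw//|/ltW/hw h] := leP a b.
  by rewrite ointNN h; ring.
rewrite ointE //; last exact: locint_cst.
rewrite Rintegral_cst //= lebesgue_measure_itv /= lte_fin.
case: ltP => //= ba; have -> : a = b by apply/eqP; rewrite eq_le ab ba.
by rewrite subrr.
Qed.

Lemma oint_abs k a b : locint k -> a <= b -> `|oint k a b| <= oint (fun x => `|k x|) a b.
Proof.
move=> ik ab; rewrite !ointE //; last exact: locint_abs.
by apply: le_normr_Rintegral => //; exact: locint_itv.
Qed.

Lemma oint_bound k M a b : locint k -> a <= b ->
  (forall x, a <= x <= b -> `|k x| <= M) -> `|oint k a b| <= M * (b - a).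
Proof.
move=> ik ab h; apply: le_trans (oint_abs ik ab) _.
rewrite -oint_cst; apply: oint_le => //; first exact: locint_abs.
exact: locint_cst.
Qed.

Lemma isprimB V1 u1 V2 u2 : locint u1 -> locint u2 -> isprim V1 u1 -> isprim V2 u2 ->
  isprim (fun x => V1 x - V2 x) (fun x => u1 x - u2 x).
Proof.
by move=> i1 i2 h1 h2 a b; rewrite ointB // -h1 -h2; ring.
Qed.

Lemma prim_derive k x : locint k -> {for x, continuous k} -> is_derive x (1 : R) (prim k) (k x).
Proof.
move=> ik ck.
pose F y := \int[mu]_(t in `[x - 1, y]) k t.
have [dF F'] : derivable F x 1 /\ derive1 F x = k x.
  apply: (@continuous_FTC1 _ k (BLeft (x - 1)) x (x + 1)) => //; last 2 first.
  - exact: locint_itv.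
  - by rewrite lte_fin; lra.
  by rewrite ltrDl.
have isF : is_derive x (1 : R) F (k x) by apply: (DeriveDef dF); rewrite -derive1E.
have E : \forall y \near x, F y + prim k (x - 1) = prim k y.
  near=> y; rewrite /F -ointE //; first by rewrite /oint; ring.
  near: y.
  by apply: lt_le_nbhsr; rewrite gtrBl.
apply: (near_eq_is_derive E).
by apply: is_derive_eq; rewrite addr0.
Unshelve. all: by end_near. Qed.

End OrientedIntegral.


(** * Fundamental theorem, integration by parts, translation and reflection *)

Section OrientedIntegralCalculus.
Context {R : realType}.
Implicit Types (k l u V : R -> R) (a b c x y : R).
Notation mu := (@lebesgue_measure R).

Lemma isprim_is_derive V u x : locint u -> isprim V u -> {for x, continuous u} ->
  is_derive x (1 : R) V (u x).
Proof.
move=> iu hV cu; have du := prim_derive iu cu.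
rewrite (_ : V = fun y => prim u y + V 0 - prim u 0).
  by apply: is_derive_eq; rewrite /= ?addr0 ?subr0.
by apply/funext => y; have := hV 0 y; rewrite /oint; lra.
Qed.

Lemma derive_continuous (V u : R -> R) : (forall x, is_derive x (1 : R) V (u x)) -> continuous V.
Proof.
move=> dV x; apply/differentiable_continuous/derivable1_diffP.
by case: (dV x).
Qed.

Lemma derive_isprim V u : continuous u -> (forall x, is_derive x (1 : R) V (u x)) -> isprim V u.
Proof.
move=> cu dV a b; rewrite /oint.
suff : V b - prim u b = V a - prim u a by lra.
apply: (@is_derive_0_is_cst R (fun x => V x - prim u x)) => x.
have := dV x; have := prim_derive (continuous_locint cu) (cu x) => h1 h2.
by apply: is_derive_eq; rewrite subrr.
Qed.

Lemma prim_continuous k : locint k -> continuous (prim k).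
Proof.
move=> ik x.
have cw : {within `[x - 1, x + 1], continuous (fun y => \int[mu]_(t in `[x - 1, y]) k t)}.
  by apply: parameterized_integral_continuous; [lra|exact: locint_itv].
have : {in `]x - 1, x + 1[, continuous (fun y => \int[mu]_(t in `[x - 1, y]) k t)}.
  have lt : x - 1 < x + 1 by lra.
  by have /(continuous_within_itvP _ lt)[] := cw.
move=> /(_ x).
rewrite in_itv /= => /(_ _)/wrap[]; first by apply/andP; split; lra.
move=> cx.
have E : \forall y \near x, \int[mu]_(t in `[x - 1, y]) k t + prim k (x - 1) = prim k y.
  near=> y; rewrite -ointE //; first by rewrite /oint; ring.
  near: y.
  by apply: lt_le_nbhsr; rewrite gtrBl.
rewrite /continuous_at -(nbhs_singleton E).
apply: cvg_trans; first by apply: near_eq_cvg; exact: E.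
by apply: cvgD; [exact: cx|exact: cvg_cst].
Unshelve. all: by end_near. Qed.

Lemma isprim_continuous V k : locint k -> isprim V k -> continuous V.
Proof.
move=> ik hV; rewrite (_ : V = fun y => prim k y + (V 0 - prim k 0)).
  by move=> x; apply: cvgD; [exact: prim_continuous|exact: cvg_cst].
by apply/funext => y; have := hV 0 y; rewrite /oint; lra.
Qed.

Lemma continuous_itv_bound (g : R -> R) a b : continuous g ->
  exists2 M, 0 <= M & forall x, a <= x <= b -> `|g x| <= M.
Proof.
move=> cg; have [ab|ba] := leP a b; last first.
  by exists 0 => // x /andP[ax xb]; have := lt_le_trans ba (le_trans ax xb); rewrite ltxx.
have cw : {within `[a, b], continuous (fun x => `|g x|)}.
  apply: continuous_subspaceT => x; apply: cvg_norm; exact: cg.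
have [c _ hc] := EVT_max ab cw.
by exists `|g c| => // x xab; apply: hc; rewrite in_itv.
Qed.

Lemma locint_bounded_mul k (g : R -> R) : locint k -> measurable_fun setT g ->
  (forall a b, exists M, forall x, a <= x <= b -> `|g x| <= M) -> locint (fun x => k x * g x).
Proof.
move=> [mk ik] mg bg; split; first exact: measurable_funM.
move=> a b; have := @integrableMl _ _ _ mu `[a, b]%classic _ (EFin \o k) g.
apply => //; first exact: measurable_funTS.
have [M hM] := bg a b; exists M; split; first exact: num_real.
move=> x Mx y /=; rewrite in_itv /= => /hM h; exact: le_trans h (ltW Mx).
Qed.

Lemma locintM k (g : R -> R) : locint k -> continuous g -> locint (fun x => k x * g x).
Proof.
move=> ik cg; apply: locint_bounded_mul => //; first exact: continuous_measurable_fun.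
by move=> a b; have [M _ hM] := continuous_itv_bound a b cg; exists M.
Qed.

Lemma bounded_locint (k : R -> R) M : measurable_fun setT k -> (forall x, `|k x| <= M) -> locint k.
Proof.
move=> mk hk; have := @locint_bounded_mul (fun=> 1) k (locint_cst 1) mk.
rewrite (_ : (fun _ => _) = k); last by apply/funext => x; rewrite mul1r.
by apply => a b; exists M.
Qed.

Lemma locint_approx k a b e : locint k -> a <= b -> 0 < e ->
  exists2 k', continuous k' & oint (fun x => `|k x - k' x|) a b < e.
Proof.
move=> ik ab e0.
have fin : (mu `[a, b]%classic < +oo)%E.
  by rewrite lebesgue_measure_itv /=; case: ifP => // _; rewrite -EFinD ltry.
have [g [cg ig hg]] := approximation_continuous_integrable (measurable_itv _) fin (locint_itv a b ik).
have /fine_cvgP[_ /cvgrPdist_lt/(_ _ e0)[N _ /(_ N)]] := hg.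
rewrite /= leqnn sub0r normrN => /(_ isT) h.
exists (g N) => //.
rewrite ointE //; last by apply: locint_abs; apply: locintB => //; exact: continuous_locint.
exact: le_lt_trans (ler_norm _) h.
Qed.

(* Reduced to continuous k by density. *)
Lemma oint_by_parts k K g G a b : locint k -> isprim K k -> continuous g -> isprim G g ->
  oint (fun x => k x * G x + K x * g x) a b = K b * G b - K a * G a.
Proof.
move=> ik hK cg hG.
have dG x : is_derive x (1 : R) G (g x) by apply: isprim_is_derive => //; [exact: continuous_locint|exact: cg].
have cG : continuous G := derive_continuous dG.
have cK := isprim_continuous ik hK.
wlog ab : a b / a <= b => [hw|].
  have [/hw//|/ltW/hw h] := leP a b.
  by rewrite ointNN h; ring.
have cntcase (k' K' : R -> R) : continuous k' -> isprim K' k' ->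
    oint (fun x => k' x * G x + K' x * g x) a b = K' b * G b - K' a * G a.
  move=> ck' hK'.
  have dK x : is_derive x (1 : R) K' (k' x).
    by apply: isprim_is_derive => //; [exact: continuous_locint|exact: ck'].
  have cK' : continuous K' := derive_continuous dK.
  apply/esym/(@derive_isprim (fun x => K' x * G x)).
    by move=> x; apply: cvgD; apply: cvgM; [exact: ck'|exact: cG|exact: cK'|exact: cg].
  by move=> x; apply: is_derive_eq; rewrite /GRing.scale /=; ring.
have [M M0 hM] := continuous_itv_bound a b cG.
have [N N0 hN] := continuous_itv_bound a b cg.
set lhs := oint _ a b; set rhs := K b * G b - K a * G a.
suff h e : 0 < e -> `|lhs - rhs| <= e * (M + N * (b - a) + M).
  apply/eqP; rewrite -subr_eq0 -normr_le0; apply/ler_addgt0Pl => e e0.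
  rewrite addr0; set C := M + N * (b - a) + M in h.
  have C0 : 0 <= C by rewrite /C !addr_ge0 // mulr_ge0 // subr_ge0.
  apply: le_trans (h (e / (C + 1)) _) _; first by rewrite divr_gt0 //; lra.
  by rewrite mulrAC ler_pdivrMr ?ler_wpM2l //; lra.
move=> e0; have [k' ck' hk'] := locint_approx ik ab e0.
have ik' := continuous_locint ck'.
(* Starting [K'] at [K a] lets the L1 distance of k and k' bound [K - K'] uniformly on the
   interval. *)
pose K' x := K a + oint k' a x.
have hK' : isprim K' k' by move=> x y; rewrite /K' /oint; ring.
have cK' := isprim_continuous ik' hK'.
have E := cntcase _ _ ck' hK'.
have iabs : locint (fun x => `|k x - k' x|) by apply: locint_abs; exact: locintB.
have KK' x : a <= x <= b -> `|K x - K' x| <= e.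
  move=> /andP[ax xb].
  have -> : K x - K' x = oint (fun x => k x - k' x) a x.
    by rewrite ointB // -hK /K'; ring.
  apply: le_trans (oint_abs (locintB ik ik') ax) _.
  apply: le_trans (ltW hk').
  rewrite -(oint_chasles _ a x b) lerDl; exact: oint_ge0.
have -> : lhs - rhs = oint (fun x => (k x - k' x) * G x) a b + oint (fun x => (K x - K' x) * g x) a b
   - (K b - K' b) * G b.
  have Ka : K a = K' a by rewrite /K' ointxx addr0.
  have -> : rhs = (K' b * G b - K' a * G a) + (K b - K' b) * G b by rewrite /rhs Ka; ring.
  rewrite -E /lhs.
  have i1 := locintM ik cG.
  have i2 := locintM ik' cG.
  have i3 : locint (fun x => K x * g x) by apply: locintM => //; exact: continuous_locint.
  have i4 : locint (fun x => K' x * g x) by apply: locintM => //; exact: continuous_locint.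
  rewrite !ointD //.
  have -> : (fun x => (k x - k' x) * G x) = (fun x => k x * G x - k' x * G x).
    by apply/funext => x; rewrite mulrBl.
  have -> : (fun x => (K x - K' x) * g x) = (fun x => K x * g x - K' x * g x).
    by apply/funext => x; rewrite mulrBl.
  by rewrite !ointB //; ring.
have h1 : `|oint (fun x => (k x - k' x) * G x) a b| <= e * M.
  have i1 : locint (fun x => (k x - k' x) * G x) by apply: locintM => //; exact: locintB.
  apply: le_trans (oint_abs i1 ab) _.
  apply: le_trans (_ : oint (fun x => M * `|k x - k' x|) a b <= _).
    apply: oint_le => //; [exact: locint_abs|exact: locintZ|].
    by move=> x xab; rewrite normrM mulrC ler_wpM2r // hM.
  by rewrite ointZ // mulrC ler_wpM2r // ltW.
have h2 : `|oint (fun x => (K x - K' x) * g x) a b| <= e * N * (b - a).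
  apply: oint_bound => //.
    apply: locintM => //; apply: locintB; exact: continuous_locint.
  by move=> x xab; rewrite normrM ler_pM // ?KK' ?hN.
have h3 : `|(K b - K' b) * G b| <= e * M.
  by rewrite normrM ler_pM // ?KK' ?hM // ab lexx.
apply: le_trans (ler_normB _ _) _; apply: le_trans (lerD (ler_normD _ _) (lexx _)) _.
nra.
Qed.

Let shift (h : R) (x : measurableTypeR R) : measurableTypeR R := (x : R) + h.

Let measurable_shift h : measurable_fun [set: measurableTypeR R] (shift h).
Proof. exact: measurable_funD. Qed.

HB.instance Definition _ h := isMeasurableFun.Build _ _ _ _ _ (measurable_shift h).

Let lebesgue_measure_shift h (A : set R) : measurable A ->
  pushforward mu (shift h) A = mu A.
Proof.
move=> mA; apply/esym/lebesgue_measure_unique => //= _ [[a b]] _ <-.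
rewrite /pushforward (_ : _ @^-1` _ = `](a - h), (b - h)]%classic); last first.
  by apply/seteqP; split => x /=; rewrite /shift !in_itv /= => /andP[? ?]; apply/andP; split; lra.
by rewrite !lebesgue_measure_itv/= !lte_fin ltrD2r -!EFinD; congr (if _ then _ else _); congr EFin; ring.
Qed.

(** Translations and x -> -x both preserve Lebesgue measure; this one change of variables serves the
    two. *)
Let pushforward_itv (phi : {mfun measurableTypeR R >-> measurableTypeR R}) k a b c d :
  (forall A, measurable A -> pushforward mu phi A = mu A) -> locint k ->
  phi @^-1` `[a, b]%classic = `[c, d]%classic ->
  mu.-integrable `[c, d] (EFin \o (k \o phi)) /\
  \int[mu]_(t in `[c, d]) (k \o phi) t = \int[mu]_(t in `[a, b]) k t.
Proof.
move=> hphi [mk ik] hcd.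
have mphi : measurable_fun [set: measurableTypeR R] phi by exact: measurable_funP.
have mEk : measurable_fun [set: R] (EFin \o k) by exact/measurable_EFinP.
have ikphi : mu.-integrable `[c, d] (EFin \o (k \o phi)).
  apply/integrableP; split.
    by apply/measurable_EFinP; apply: measurable_funTS; exact: measurableT_comp.
  have := ik a b => /integrableP[_].
  rewrite -(@eq_measure_integral _ _ _ _ mu (pushforward mu phi)); last by move=> A mA _; exact: hphi.
  rewrite ge0_integral_pushforward; [by rewrite hcd|exact: mphi|exact: measurable_itv| |].
    by apply: measurable_funTS; apply: measurableT_comp => //; exact: mEk.
  by move=> y _; exact: abse_ge0.
split=> //; rewrite /Rintegral; congr fine.
transitivity (\int[pushforward mu phi]_(x in `[a, b]%classic) (EFin \o k) x)%E; last first.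
  by apply: eq_measure_integral => A mA _; exact: hphi.
rewrite (integral_pushforward mphi mEk) ?hcd //.
Qed.

Let shift_preimage h a b : shift h @^-1` `[a + h, b + h]%classic = `[a, b]%classic.
Proof.
by apply/seteqP; split => x /=; rewrite /shift !in_itv /= => /andP[? ?]; apply/andP; split; lra.
Qed.

Lemma locint_shift h k : locint k -> locint (fun x => k (x + h)).
Proof.
move=> ik; split; first by apply: (measurableT_comp (locint_meas ik)); exact: measurable_funD.
by move=> a b; have [] := @pushforward_itv [the {mfun measurableTypeR R >-> measurableTypeR R} of shift h] k _ _ _ _ (@lebesgue_measure_shift h) ik (shift_preimage h a b).
Qed.

Lemma oint_shift h k a b : locint k ->
  oint (fun x => k (x + h)) a b = oint k (a + h) (b + h).
Proof.
move=> ik; wlog ab : a b / a <= b => [hw|].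
  have [/hw//|/ltW/hw e] := leP a b.
  by rewrite ointNN e -ointNN.
rewrite !ointE //; [|by rewrite lerD2r|exact: locint_shift].
by have [_] := @pushforward_itv [the {mfun measurableTypeR R >-> measurableTypeR R} of shift h] k _ _ _ _ (@lebesgue_measure_shift h) ik (shift_preimage h a b).
Qed.

Let flip (x : measurableTypeR R) : measurableTypeR R := - (x : R).

Let measurable_flip : measurable_fun [set: measurableTypeR R] flip.
Proof. exact: oppr_measurable. Qed.

HB.instance Definition _ := isMeasurableFun.Build _ _ _ _ _ measurable_flip.

Let oppr_preimage a b : flip @^-1` `[- b, - a]%classic = `[a, b]%classic.
Proof.
by apply/seteqP; split => x /=; rewrite /flip !in_itv /= => /andP[? ?]; apply/andP; split; lra.
Qed.

Lemma locint_reflect k : locint k -> locint (fun x => k (- x)).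
Proof.
move=> ik; split; first by apply: (measurableT_comp (locint_meas ik)).
by move=> a b; have [] := @pushforward_itv [the {mfun measurableTypeR R >-> measurableTypeR R} of flip] k _ _ _ _ (@lebesgue_measureN R) ik (oppr_preimage a b).
Qed.

Lemma oint_reflect k a b : locint k ->
  oint (fun x => k (- x)) a b = oint k (- b) (- a).
Proof.
move=> ik; wlog ab : a b / a <= b => [hw|].
  have [/hw//|/ltW/hw e] := leP a b.
  by rewrite ointNN e -ointNN.
rewrite !ointE //; [|by rewrite lerN2|exact: locint_reflect].
by have [_] := @pushforward_itv [the {mfun measurableTypeR R >-> measurableTypeR R} of flip] k _ _ _ _ (@lebesgue_measureN R) ik (oppr_preimage a b).
Qed.

End OrientedIntegralCalculus.

(** * Kato's inequality on an interval *)


Section Kato.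
Context {R : realType}.
Implicit Types (t e a b : R).

Lemma le_of_le_addZ (A B C : R) : (forall e, 0 < e -> A <= B + C * e) -> A <= B.
Proof.
move=> h; apply/ler_addgt0Pl => e e0.
have C1 : 0 < `|C| + 1 by have := normr_ge0 C; lra.
apply: le_trans (h (e / (`|C| + 1)) _) _; first by rewrite divr_gt0.
rewrite addrC lerD2r mulrA ler_pdivrMr // mulrC ler_wpM2l ?(ltW e0) //.
by have := ler_norm C; lra.
Qed.

Definition smooth_sgn (e t : R) : R := t * (Num.sqrt (t ^+ 2 + e ^+ 2))^-1.

Definition smooth_sgn' (e t : R) : R := e ^+ 2 * ((Num.sqrt (t ^+ 2 + e ^+ 2))^-1) ^+ 3.

Lemma sqrt_pos e t : 0 < e -> 0 < Num.sqrt (t ^+ 2 + e ^+ 2).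
Proof. by move=> e0; rewrite sqrtr_gt0; have := sqr_ge0 t; nra. Qed.

Lemma smooth_sgn_derive e t : 0 < e -> is_derive t (1 : R) (smooth_sgn e) (smooth_sgn' e t).
Proof.
move=> e0; have s0 := sqrt_pos t e0; have q0 : 0 < t ^+ 2 + e ^+ 2 by have := sqr_ge0 t; nra.
pose q (x : R) := x ^+ 2 + e ^+ 2.
have dq : is_derive t (1 : R) q (2 * t).
  by apply: is_derive_eq; rewrite /GRing.scale /= ; ring.
have ds : is_derive t (1 : R) (Num.sqrt \o q) ((2 * Num.sqrt (q t))^-1 * (2 * t)).
  by apply: is_derive1_comp; apply: is_derive1_sqrt.
pose s := Num.sqrt \o q.
have sn0 : s t != 0 by rewrite gt_eqF.
have dsV : is_derive t (1 : R) (fun x => (s x)^-1) (- (s t) ^- 2 * ((2 * Num.sqrt (q t))^-1 * (2 * t))).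
  by have := is_deriveV sn0 ds.
apply: (is_derive_eq (is_deriveM (is_derive_id t 1) dsV)).
rewrite /GRing.scale /= /smooth_sgn' -/(q t) -/(s t).
have st : s t ^+ 2 = t ^+ 2 + e ^+ 2 by rewrite sqr_sqrtr // ltW.
have -> : e ^+ 2 = s t ^+ 2 - t ^+ 2 by rewrite st; ring.
have -> : Num.sqrt (q t) = s t by [].
by field.
Qed.

Lemma smooth_sgn'_continuous e : 0 < e -> continuous (smooth_sgn' e).
Proof.
move=> e0 t; have s0 := sqrt_pos t e0.
apply: cvgM; first exact: cvg_cst.
have c : (fun x => (Num.sqrt (x ^+ 2 + e ^+ 2))^-1) x @[x --> t] --> (Num.sqrt (t ^+ 2 + e ^+ 2))^-1.
  apply: cvgV; first by rewrite gt_eqF.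
  apply: continuous_comp; last exact: sqrt_continuous.
  by apply: cvgD; [exact: exprn_continuous|exact: cvg_cst].
by apply: cvgM => //; apply: cvgM.
Qed.

Lemma smooth_sgn'_ge0 e t : 0 < e -> 0 <= smooth_sgn' e t.
Proof.
move=> e0; rewrite /smooth_sgn' mulr_ge0 ?sqr_ge0 // exprn_ge0 // invr_ge0; exact: sqrtr_ge0.
Qed.

Lemma sqrt_bounds e t : 0 < e ->
  `|t| <= Num.sqrt (t ^+ 2 + e ^+ 2) /\ e <= Num.sqrt (t ^+ 2 + e ^+ 2) /\
  Num.sqrt (t ^+ 2 + e ^+ 2) <= `|t| + e.
Proof.
move=> e0; split; [|split].
- by rewrite -sqrtr_sqr ler_sqrt; [rewrite lerDl sqr_ge0|rewrite addr_ge0 ?sqr_ge0].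
- by rewrite -[leLHS]gtr0_norm // -sqrtr_sqr ler_sqrt; [rewrite lerDr sqr_ge0|rewrite addr_ge0 ?sqr_ge0].
- have t0 := normr_ge0 t.
  have p0 : 0 <= `|t| + e by lra.
  rewrite -[leRHS]ger0_norm // -sqrtr_sqr ler_sqrt ?sqr_ge0 //.
  rewrite sqrrD real_normK ?num_real //; nra.
Qed.

Lemma smooth_sgn_abs e t : 0 < e -> `|smooth_sgn e t| <= 1.
Proof.
move=> e0; have [h _] := sqrt_bounds t e0; have s0 := sqrt_pos t e0.
by rewrite /smooth_sgn normrM normfV (gtr0_norm s0) ler_pdivrMr // mul1r.
Qed.

Lemma smooth_sgn_mul e t : 0 < e -> `|t| - e <= t * smooth_sgn e t.
Proof.
move=> e0; have [h [h1 h2]] := sqrt_bounds t e0; have s0 := sqrt_pos t e0.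
rewrite /smooth_sgn mulrA ler_pdivlMr //.
have -> : t * t = `|t| ^+ 2 by rewrite real_normK ?num_real // expr2.
set s := Num.sqrt _ in h h1 h2 *; have := normr_ge0 t; nra.
Qed.

(** With s the square root, |t| <= s and e <= s give t^2 e^2 <= e s^3. The squared Lipschitz error
    in [kato] thus vanishes with e, although [smooth_sgn'] is of size 1/e at 0. *)
Lemma smooth_sgn'_sqr e t : 0 < e -> t ^+ 2 * smooth_sgn' e t <= e.
Proof.
move=> e0; have [h [h1 h2]] := sqrt_bounds t e0; have s0 := sqrt_pos t e0.
rewrite /smooth_sgn'; set s := Num.sqrt _ in h h1 h2 s0 *.
rewrite exprVn mulrA ler_pdivrMr ?exprn_gt0 //.
have -> : t ^+ 2 = `|t| ^+ 2 by rewrite real_normK ?num_real.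
have t0 := normr_ge0 t.
have a1 : `|t| ^+ 2 <= s ^+ 2 by rewrite ler_sqr // nnegrE // ltW.
have a2 : `|t| ^+ 2 * e <= s ^+ 2 * s by apply: ler_pM => //; rewrite ?sqr_ge0 // ltW.
have -> : `|t| ^+ 2 * e ^+ 2 = e * (`|t| ^+ 2 * e) by ring.
by rewrite (exprSr s 2) (ler_wpM2l (ltW e0)).
Qed.

(** The constant 1/|t| degenerates as t -> 0. This is harmless because the estimate is used only at
    the two endpoint values of d, which stay fixed while e -> 0. *)
Lemma smooth_sgn_sgr t : exists C, forall e, 0 < e -> `|smooth_sgn e t - Num.sg t| <= C * e.
Proof.
have [->|t0] := eqVneq t 0.
  by exists 0 => e e0; rewrite /smooth_sgn sgr0 mul0r subrr normr0 mul0r.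
exists `|t|^-1 => e e0; have [h [h1 h2]] := sqrt_bounds t e0; have s0 := sqrt_pos t e0.
have nt : 0 < `|t| by rewrite normr_gt0.
rewrite /smooth_sgn; set s := Num.sqrt _ in h h1 h2 s0 *.
have -> : t * s^-1 - Num.sg t = Num.sg t * ((`|t| - s) / s).
  by rewrite {1}[t]numEsg; field; rewrite gt_eqF.
rewrite normrM normr_sg t0 mul1r normrM normfV (gtr0_norm s0) ler0_norm ?subr_le0 //.
rewrite opprB ler_pdivrMr //.
have -> : `|t|^-1 * e * s = e * s / `|t| by ring.
rewrite ler_pdivlMr //; nra.
Qed.

(* Test the equation with a smoothed sign of d: completing the square bounds the
   viscous and transport terms together by g^2 * smooth_sgn' / (4 * eps), which is O(e). *)
Lemma kato (L eps lam al be : R) (d g zeta omega : R -> R) :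
  al <= be -> 0 < eps -> 0 < lam -> continuous d -> continuous g -> continuous zeta ->
  locint omega ->
  (forall a b, al <= a -> a <= b -> b <= be -> eps * (d b - d a) = oint (fun x => g x + zeta x) a b) ->
  (forall a b, al <= a -> a <= b -> b <= be -> lam * (zeta b - zeta a) = oint (fun x => d x - omega x) a b) ->
  (forall x, al <= x <= be -> `|g x| <= L * `|d x|) ->
  oint (fun x => `|d x|) al be <= oint (fun x => `|omega x|) al be +
    lam * (zeta be * Num.sg (d be) - zeta al * Num.sg (d al)).
Proof.
move=> ab eps0 lam0 cd cg cz io hd hz hg.
pose del x := eps^-1 * (g x + zeta x).
have cdel : continuous del.
  by move=> x; apply: cvgM; [exact: cvg_cst|apply: cvgD; [exact: cg|exact: cz]].
(* The equations for d and zeta are known only between al and be. [D] and, below, [Z] are primitives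
   on the whole line that coincide with d and zeta on that interval, so that global calculus
   applies. *)
pose D x := d al + oint del al x.
have hD : isprim D del by move=> x y; rewrite /D /oint; ring.
have igz : locint (fun x => g x + zeta x).
  by apply: locintD; exact: continuous_locint.
have Dd x : al <= x <= be -> D x = d x.
  move=> /andP[ax xb]; rewrite /D ointZ // -hd //; field; exact: lt0r_neq0.
have id_ := continuous_locint cd.
have ido : locint (fun x => d x - omega x) by exact: locintB.
pose Z x := zeta al + oint (fun x => lam^-1 * (d x - omega x)) al x.
have hZ : isprim Z (fun x => lam^-1 * (d x - omega x)) by move=> x y; rewrite /Z /oint; ring.
have Zz x : al <= x <= be -> Z x = zeta x.
  move=> /andP[ax xb]; rewrite /Z ointZ // -hz //; field; exact: lt0r_neq0.
have idel := continuous_locint cdel.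
have dD x : is_derive x (1 : R) D (del x) by apply: isprim_is_derive => //; exact: cdel.
have cD : continuous D := derive_continuous dD.
have al_in : al <= al <= be by rewrite lexx.
have be_in : al <= be <= be by rewrite lexx ab.
have [Ca hCa] := smooth_sgn_sgr (d al).
have [Cb hCb] := smooth_sgn_sgr (d be).
(* The three errors linear in e: smoothing |d|, the viscous term after completing the square, and
   the smoothed signs at the two endpoints. *)
pose M := (be - al) + lam * L ^+ 2 / (4 * eps) * (be - al) + lam * (`|zeta be| * Cb + `|zeta al| * Ca).
apply: (@le_of_le_addZ _ _ M) => e e0.
pose E x := smooth_sgn e (D x).
pose E' x := smooth_sgn' e (D x) * del x.
have dE x : is_derive x (1 : R) E (E' x).
  exact: (is_derive1_comp (smooth_sgn_derive (D x) e0) (dD x)).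
have cE : continuous E := derive_continuous dE.
have cE' : continuous E'.
  move=> x; apply: cvgM; last exact: cdel.
  by apply: continuous_comp; [exact: cD|exact: smooth_sgn'_continuous].
have hE := derive_isprim cE' dE.
have iZ' : locint (fun x => lam^-1 * (d x - omega x)) by exact: locintZ.
have cZ := isprim_continuous iZ' hZ.
have := oint_by_parts al be iZ' hZ cE' hE.
rewrite Zz // Zz // /E Dd // Dd //.
have i1 : locint (fun x => lam^-1 * (d x - omega x) * E x) by exact: locintM.
have i2 : locint (fun x => Z x * E' x) by apply: locintM => //; exact: continuous_locint.
have i3 : locint (fun x => (d x - omega x) * E x) by exact: locintM.
rewrite ointD //.
have -> : (fun x => lam^-1 * (d x - omega x) * smooth_sgn e (D x)) = (fun x => lam^-1 * ((d x - omega x) * E x)).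
  by apply/funext => x; rewrite -[in LHS]mulrA.
rewrite ointZ // => ibp.
have main : oint (fun x => (d x - omega x) * E x) al be =
   lam * (zeta be * smooth_sgn e (d be) - zeta al * smooth_sgn e (d al)) - lam * oint (fun x => Z x * E' x) al be.
  by rewrite -ibp; field; exact: lt0r_neq0.
have b1 : - lam * oint (fun x => Z x * E' x) al be <= lam * L ^+ 2 / (4 * eps) * e * (be - al).
  rewrite -ointZ // -oint_cst; apply: oint_le => //; [exact: locintZ|exact: locint_cst|].
  move=> x xab; rewrite /E' /del Zz // Dd //.
  have n0 := smooth_sgn'_ge0 (d x) e0; have n1 := smooth_sgn'_sqr (d x) e0.
  have gd : g x ^+ 2 <= L ^+ 2 * d x ^+ 2.
    rewrite -[g x ^+ 2]real_normK ?num_real // -[d x ^+ 2]real_normK ?num_real // -exprMn.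
    have h := hg _ xab.
    by rewrite ler_sqr // nnegrE //; apply: le_trans h.
  set n := smooth_sgn' e (d x) in n0 n1 *.
  have -> : - lam * (zeta x * (n * (eps^-1 * (g x + zeta x)))) = lam / eps * (n * (- (zeta x * (g x + zeta x)))) by ring.
  have -> : lam * L ^+ 2 / (4 * eps) * e = lam / eps * (L ^+ 2 * e / 4) by field; exact: lt0r_neq0.
  rewrite ler_wpM2l //; first by rewrite divr_ge0 // ltW.
  apply: le_trans (_ : n * (L ^+ 2 * d x ^+ 2 / 4) <= _).
    rewrite ler_wpM2l //; have := sqr_ge0 (zeta x + g x / 2); nra.
  have L2 : 0 <= L ^+ 2 by exact: sqr_ge0.
  nra.
have b2 : oint (fun x => `|d x|) al be - e * (be - al) - oint (fun x => `|omega x|) al be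
   <= oint (fun x => (d x - omega x) * E x) al be.
  rewrite -oint_cst -ointB //; [|exact: locint_abs|exact: locint_cst].
  rewrite -ointB //; [|by apply: locintB; [exact: locint_abs|exact: locint_cst]|exact: locint_abs].
  apply: oint_le => //.
    by apply: locintB; [apply: locintB; [exact: locint_abs|exact: locint_cst]|exact: locint_abs].
  move=> x xab; rewrite mulrBl /E Dd //.
  apply: lerB; first exact: smooth_sgn_mul.
  apply: le_trans (ler_norm _) _; rewrite normrM -[leRHS]mulr1 ler_wpM2l //.
  exact: smooth_sgn_abs.
have b3 : zeta be * smooth_sgn e (d be) - zeta al * smooth_sgn e (d al) <=
   zeta be * Num.sg (d be) - zeta al * Num.sg (d al) + (`|zeta be| * Cb + `|zeta al| * Ca) * e.
  have k1 : zeta be * (smooth_sgn e (d be) - Num.sg (d be)) <= `|zeta be| * (Cb * e).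
    by apply: le_trans (ler_norm _) _; rewrite normrM ler_wpM2l // hCb.
  have k2 : - (zeta al * (smooth_sgn e (d al) - Num.sg (d al))) <= `|zeta al| * (Ca * e).
    by apply: le_trans (ler_norm _) _; rewrite normrN normrM ler_wpM2l // hCa.
  rewrite mulrBr in k1; rewrite mulrBr in k2; lra.
have b4 := ler_wpM2l (ltW lam0) b3.
rewrite /M; move: b1 b2 b4; rewrite main => b1 b2 b4; lra.
Qed.

End Kato.

(** * Test functions *)


Section SmoothFunctions.
Context {R : realType}.
Implicit Types (g h : R -> R).

Lemma is_derive_derive1 g (g' : R -> R) : (forall x, is_derive x (1 : R) g (g' x)) -> derive1 g = g'.
Proof.
by move=> dg; apply/funext => x; rewrite derive1E; exact: derive_val.
Qed.

Lemma derive1nSr n g : derive1n n.+1 g = derive1n n (derive1 g).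
Proof. by rewrite /derive1n iterSr. Qed.

Lemma smooth_of_derive g (g' : R -> R) :
  (forall x, is_derive x (1 : R) g (g' x)) -> smooth g' -> smooth g.
Proof.
move=> dg sg' [|n] x; first by case: (dg x).
rewrite derive1nSr (is_derive_derive1 dg); exact: sg'.
Qed.

Lemma smooth_is_derive g : smooth g -> forall x, is_derive x (1 : R) g (derive1 g x).
Proof. by move=> sg x; rewrite derive1E; apply: derivableP; exact: (sg 0%N). Qed.

Lemma smooth_derive1 g : smooth g -> smooth (derive1 g).
Proof. by move=> sg n x; rewrite -derive1nSr. Qed.

Lemma smooth_continuous g : smooth g -> continuous g.
Proof. by move=> /smooth_is_derive dg; exact: derive_continuous dg. Qed.

Lemma smooth_comb g h a b : smooth g -> smooth h -> smooth (fun x => a * g x + b * h x).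
Proof.
move=> sg sh n; elim: n g h sg sh => [|n ih] g h sg sh x.
  have := smooth_is_derive sg x; have := smooth_is_derive sh x => d1 d2.
  have d : is_derive x (1 : R) (fun x => a * g x + b * h x) (a * derive1 g x + b * derive1 h x).
    by apply: is_derive_eq; rewrite /GRing.scale /=; ring.
  by case: d.
have d y : is_derive y (1 : R) (fun x => a * g x + b * h x) (a * derive1 g y + b * derive1 h y).
  have := smooth_is_derive sg y; have := smooth_is_derive sh y => d1 d2.
  by apply: is_derive_eq; rewrite /GRing.scale /=; ring.
by rewrite derive1nSr (is_derive_derive1 d); apply: ih; exact: smooth_derive1.
Qed.

Lemma is_derive_translate g (g' : R -> R) (p x : R) : (forall x, is_derive x (1 : R) g (g' x)) ->
  is_derive x (1 : R) (fun y => g (y - p)) (g' (x - p)).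
Proof.
move=> dg; have dp : is_derive x (1 : R) (fun y : R => y - p) 1.
  by apply: is_derive_eq; rewrite subr0.
by have := @is_derive1_comp _ g (fun y : R => y - p) x _ _ (dg (x - p)) dp; rewrite mulr1.
Qed.

Lemma smooth_translate g p : smooth g -> smooth (fun x => g (x - p)).
Proof.
move=> sg n; elim: n g sg => [|n ih] g sg x.
  by have := is_derive_translate p x (smooth_is_derive sg) => -[].
rewrite derive1nSr (is_derive_derive1 (fun y => is_derive_translate p y (smooth_is_derive sg))).
by apply: ih; exact: smooth_derive1.
Qed.

Lemma compact_support g a b : (forall x, x <= a -> g x = 0) -> (forall x, b <= x -> g x = 0) ->
  compact (closure [set x | g x != 0]).
Proof.
move=> ga gb; apply: (subclosed_compact _ (segment_compact (a := a) (b := b))).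
  exact: closed_closure.
rewrite closureE; apply: smallest_sub; first exact: itv_closed.
move=> x /= gx; rewrite in_itv /=; apply/andP; split.
  by rewrite leNgt; apply: contra gx => /ltW /ga ->.
by rewrite leNgt; apply: contra gx => /ltW /gb ->.
Qed.

(** Meant for the two endpoints of the support of the bump, where the function is given by different
    formulas on the two sides. *)
Lemma is_derive_quadratic_bound g a C : (forall x, `|g x - g a| <= C * (x - a) ^+ 2) ->
  is_derive a (1 : R) g 0.
Proof.
move=> hC.
have C0 : 0 <= C.
  by have := hC (a + 1); rewrite addrAC subrr add0r expr1n mulr1; exact: le_trans.
have c : h^-1 *: ((g \o shift a) (h *: (1 : R)) - g a) @[h --> 0^'] --> (0 : R).
  apply/cvgrPdist_le => e e0; near=> h.
  have h0 : h != 0 by near: h; exact: nbhs_dnbhs_neq.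
  rewrite sub0r normrN /= /GRing.scale /= mulr1 normrM normfV ler_pdivrMl ?normr_gt0 //.
  apply: le_trans (hC _) _; rewrite addrK -[h ^+ 2]real_normK ?num_real // expr2 mulrA mulrC ler_wpM2l //.
  have : `|h| <= e / (C + 1).
    near: h; apply: nbhs_dnbhs; exists (e / (C + 1)); first by rewrite /= divr_gt0 //; lra.
    by move=> y /=; rewrite sub0r normrN => /ltW.
  rewrite ler_pdivlMr; last lra.
  by have := normr_ge0 h; nra.
apply: DeriveDef; first by apply/cvg_ex; exists 0.
exact/cvg_lim.
Unshelve. all: by end_near. Qed.

End SmoothFunctions.

(** * A smooth bump function supported in an interval of length delta *)

Section Bump.
Context {R : realType} (delta : R) (delta_gt0 : 0 < delta).

Let q (x : R) := x * (delta - x).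

(* This family contains the bump function and is closed under differentiation. *)
Definition bump_family (P : {poly R}) (m : nat) (x : R) : R :=
  if (0 < x) && (x < delta) then P.[x] * (q x)^-1 ^+ m * expR (- (q x)^-1) else 0.

(** With q = x (delta - x), the derivative of P q^-m exp(-1/q) is (P' q^2 - m P q' q + P q')
    q^-(m+2) exp(-1/q); this is the new numerator. *)
Definition bump_family' (P : {poly R}) (m : nat) : {poly R} :=
  let Q := 'X * (delta%:P - 'X) in
  let Q' := delta%:P - 2%:R *: 'X in
  P^`() * Q ^+ 2 - m%:R *: (P * Q' * Q) + P * Q'.

(** The exponential series gives y^(m+2) <= (m+2)! exp y for y = 1/q. The two powers beyond m become
    the factor q^2, which makes the function flat at both endpoints. *)
Lemma bump_family_sqr P m : exists C, forall x, 0 < x -> x < delta -> `|bump_family P m x| <= C * q x ^+ 2.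
Proof.
have [M M0 hM] := continuous_itv_bound 0 delta (@continuous_horner _ P).
exists (M * ((m.+2)`!%:R)) => x x0 xd; rewrite /bump_family x0 xd /=.
have q0 : 0 < q x by rewrite mulr_gt0 // subr_gt0.
have y0 : 0 < (q x)^-1 by rewrite invr_gt0.
rewrite expRN !normrM [X in _ * X * _]ger0_norm ?exprn_ge0 ?(ltW y0) //.
rewrite [X in _ * X]ger0_norm ?invr_ge0 ?expR_ge0 // -!mulrA ler_pM //.
- by rewrite mulr_ge0 // ?exprn_ge0 ?(ltW y0) // invr_ge0 expR_ge0.
- by apply: hM; rewrite !ltW.
rewrite ler_pdivrMr ?expR_gt0 //.
have h := expR_ge1Dxn m.+1 (ltW y0).
have f0 : 0 < (m.+2)`!%:R :> R by rewrite ltr0n fact_gt0.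
have h' : (q x)^-1 ^+ m.+2 <= (m.+2)`!%:R * expR (q x)^-1.
  by rewrite -ler_pdivrMl // mulrC; apply: le_trans h; rewrite lerDr.
have -> : (q x)^-1 ^+ m = (q x)^-1 ^+ m.+2 * q x ^+ 2.
  by rewrite exprSr exprSr; field; rewrite gt_eqF.
apply: le_trans (ler_wpM2r (sqr_ge0 (q x)) h') _; rewrite le_eqVlt; apply/orP; left; apply/eqP; ring.
Qed.

Lemma bump_family0 P m x : ~~ ((0 < x) && (x < delta)) -> bump_family P m x = 0.
Proof. by rewrite /bump_family => /negbTE ->. Qed.

Lemma bump_family_derive P m x :
  is_derive x (1 : R) (bump_family P m) (bump_family (bump_family' P m) m.+2 x).
Proof.
have [C hC] := bump_family_sqr P m.
have dq z : is_derive z (1 : R) q (delta - 2 * z).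
  by apply: is_derive_eq; rewrite /GRing.scale /=; ring.
have edge a : (a == 0) || (a == delta) -> is_derive a (1 : R) (bump_family P m) (bump_family (bump_family' P m) m.+2 a).
  move=> ha; have oa : ~~ ((0 < a) && (a < delta)) by case/orP: ha => /eqP ->; rewrite ltxx ?andbF.
  rewrite bump_family0 //; apply: (@is_derive_quadratic_bound _ _ _ (`|C| * delta ^+ 2)) => z.
  rewrite (bump_family0 _ _ oa) subr0.
  case: (boolP ((0 < z) && (z < delta))) => [/andP[z0 zd]|oz]; last first.
    by rewrite bump_family0 // normr0 mulr_ge0 ?sqr_ge0 // mulr_ge0 ?sqr_ge0.
  apply: le_trans (hC _ z0 zd) _; apply: le_trans (ler_wpM2r (sqr_ge0 _) (ler_norm C)) _.
  rewrite -mulrA ler_wpM2l // /q.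
  case/orP: ha => /eqP ->.
    by rewrite subr0 exprMn mulrC ler_wpM2r ?sqr_ge0 // ler_sqr ?nnegrE; lra.
  have -> : (z - delta) ^+ 2 = (delta - z) ^+ 2 by ring.
  by rewrite exprMn ler_wpM2r ?sqr_ge0 // ler_sqr ?nnegrE; lra.
have [xn|x0|->] := ltgtP x 0; last by apply: edge; rewrite eqxx.
  rewrite bump_family0; last by rewrite (ltNge 0) (ltW xn).
  apply: (@near_eq_is_derive _ _ _ (cst (0 : R))).
    near=> y; rewrite bump_family0 // negb_and -!leNgt; apply/orP; left.
    by near: y; exact: lt_le_nbhsl.
have [xd|dx|->] := ltgtP x delta; last by apply: edge; rewrite eqxx orbT.
  have qn0 : q x != 0 by rewrite mulf_neq0 // gt_eqF // subr_gt0.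
  apply: (@near_eq_is_derive _ _ _ (fun x => P.[x] * ((q x)^-1 ^+ m * expR (- (q x)^-1)))).
    near=> y; rewrite /bump_family mulrA ifT //; apply/andP; split.
      by near: y; exact: lt_nbhsr.
    by near: y; exact: lt_nbhsl.
  have dV : is_derive x (1 : R) (fun z => (q z)^-1) (- (q x) ^- 2 * (delta - 2 * x)).
    exact: (is_deriveV qn0 (dq x)).
  have dE : is_derive x (1 : R) (expR \o (fun z => - (q z)^-1)) (expR (- (q x)^-1) * (- (- (q x) ^- 2 * (delta - 2 * x)))).
    exact: is_derive1_comp.
  have dX' : is_derive x (1 : R) (fun z => (q z)^-1 ^+ m) (m%:R * (q x)^-1 ^+ m.-1 * (- (q x) ^- 2 * (delta - 2 * x))).
    have := is_deriveX m dV.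
    rewrite (_ : (fun z => (q z)^-1) ^+ m = fun z => (q z)^-1 ^+ m) //.
    by apply/funext => z; rewrite exprfctE.
  have dP := is_derive_poly P x.
  have hP : (bump_family' P m).[x] = P^`().[x] * q x ^+ 2 - m%:R * (P.[x] * (delta - 2 * x) * q x)
      + P.[x] * (delta - 2 * x).
    by rewrite /bump_family' !(hornerE, hornerXn) /q; ring.
  apply: is_derive_eq.
  rewrite /bump_family x0 xd /= hP /GRing.scale /=.
  have -> : (q x)^-1 ^+ m.+2 = (q x)^-1 ^+ m * (q x)^-2 by rewrite -addn2 exprD -[in RHS]exprVn.
  have -> : m%:R * (q x)^-1 ^+ m.-1 = m%:R * (q x)^-1 ^+ m * q x.
    case: (m) => [|k]; first by rewrite !mul0r.
    by rewrite /= exprSr; field.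
  set e := expR _; set r := (q x)^-1 ^+ m.
  move: (q x) qn0 @e @r => qx qn0 e r.
  by field.
rewrite bump_family0; last by rewrite (ltNge x delta) (ltW dx) andbF.
apply: (@near_eq_is_derive _ _ _ (cst (0 : R))).
  near=> y; rewrite bump_family0 // negb_and -!leNgt; apply/orP; right.
  by near: y; exact: lt_le_nbhsr.
Unshelve. all: by end_near. Qed.

Lemma bump_family_smooth P m : smooth (bump_family P m).
Proof.
move=> n; elim: n P m => [|n ih] P m x; first by case: (bump_family_derive P m x).
by rewrite derive1nSr (is_derive_derive1 (bump_family_derive P m)).
Qed.

Lemma mollifier_exists : exists B : R -> R,
  [/\ smooth B, (forall x, 0 <= B x), (forall x, x <= 0 -> B x = 0),
      (forall x, delta <= x -> B x = 0) & oint B 0 delta = 1].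
Proof.
pose b := bump_family 1%:P 0.
have sb : smooth b by exact: bump_family_smooth.
have ib := continuous_locint (smooth_continuous sb).
have b0 x : 0 <= b x.
  rewrite /b /bump_family; case: ifP => // _.
  by rewrite hornerC expr0 !mul1r expR_ge0.
have bl x : x <= 0 -> b x = 0 by move=> x0; rewrite /b bump_family0 // (ltNge 0) x0.
have br x : delta <= x -> b x = 0 by move=> x0; rewrite /b bump_family0 // (ltNge x) x0 andbF.
have bpos : 0 < oint b 0 delta.
  have d13 : 0 < delta / 3 by rewrite divr_gt0.
  rewrite -(oint_chasles _ 0 (delta / 3)) -(oint_chasles _ (delta / 3) (2 * delta / 3)).
  have h1 : 0 <= oint b 0 (delta / 3) by apply: oint_ge0 => //; lra.
  have h3 : 0 <= oint b (2 * delta / 3) delta by apply: oint_ge0 => //; lra.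
  (* On the middle third q is at least delta^2 / 9, so the bump is at least c there. *)
  set c := expR (- (delta ^+ 2 / 9)^-1).
  have h2 : c * (2 * delta / 3 - delta / 3) <= oint b (delta / 3) (2 * delta / 3).
    rewrite -oint_cst; apply: oint_le => //; [exact: locint_cst|lra|].
    move=> x /andP[x1 x2]; rewrite /b /bump_family ifT; last by apply/andP; split; lra.
    rewrite hornerC expr0 !mul1r ler_expR lerN2 lef_pV2 ?posrE; first by rewrite /q; nra.
      by rewrite /q mulr_gt0; lra.
    by rewrite divr_gt0 // exprn_gt0.
  have c0 : 0 < c by exact: expR_gt0.
  nra.
set c := oint b 0 delta in bpos.
(* The zero summand only gives the function the shape required by [smooth_comb]. *)
exists (fun x => c^-1 * b x + 0 * b x); split.
- exact: smooth_comb.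
- by move=> x; rewrite mul0r addr0 mulr_ge0 // invr_ge0 ltW.
- by move=> x /bl ->; rewrite !mulr0 addr0.
- by move=> x /br ->; rewrite !mulr0 addr0.
- rewrite (_ : (fun x => _) = (fun x => c^-1 * b x)); last by apply/funext => x; rewrite mul0r addr0.
  by rewrite ointZ // -/c mulVf // gt_eqF.
Qed.

End Bump.


(** * Continuous functions that annihilate third derivatives of test functions *)

Section DistributionalRegularity.
Context {R : realType}.
Implicit Types (g h H k u w : R -> R) (a b : R).
Notation mu := (@lebesgue_measure R).

Lemma Rintegral_oint h a b : locint h -> a <= b ->
  (forall x, x <= a -> h x = 0) -> (forall x, b <= x -> h x = 0) ->
  \int[mu]_x h x = oint h a b.
Proof.
move=> ih ab ha hb; rewrite ointE // [RHS]Rintegral_mkcond; apply: eq_Rintegral => x _.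
rewrite patchE; case: ifPn => // /negP; rewrite inE /= in_itv /= => /negP.
rewrite negb_and -!ltNge => /orP[xa|bx]; [exact: ha (ltW xa)|exact: hb (ltW bx)].
Qed.

Lemma oint0 k a b : a <= b -> locint k -> (forall x, a <= x <= b -> k x = 0) -> oint k a b = 0.
Proof.
move=> ab ik k0; rewrite (@eq_oint _ k (fun=> 0)) ?oint_cst ?mul0r //.
exact: locint_cst.
Qed.

Lemma prim0 k : prim k 0 = 0.
Proof. by rewrite /prim lexx itv_int1. Qed.

Lemma prim_left0 k x : locint k -> (forall y, y <= 0 -> k y = 0) -> x <= 0 -> prim k x = 0.
Proof.
move=> ik k0 x0; have : oint k x 0 = 0 by apply: oint0 => // y /andP[_ y0]; exact: k0.
by rewrite /oint prim0 sub0r => /eqP; rewrite oppr_eq0 => /eqP.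
Qed.

(* The test functions are phi = sum_i s_i T(. - p_i) with T a triple antiderivative of a
   mollifier; the three moment conditions on the s_i make phi compactly supported. *)
Lemma third_antiderivative (d : R) : 0 < d -> exists T T1 T2 T3 : R -> R,
  [/\ smooth T /\ (forall x, is_derive x (1 : R) T (T1 x)),
      (forall x, is_derive x (1 : R) T1 (T2 x)) /\ (forall x, is_derive x (1 : R) T2 (T3 x)),
      continuous T1 /\ continuous T2,
      [/\ continuous T3, (forall x, 0 <= T3 x), (forall x, d <= x -> T3 x = 0) & oint T3 0 d = 1] &
      (forall x, x <= 0 -> [/\ T x = 0, T1 x = 0, T2 x = 0 & T3 x = 0]) /\
      exists c0 c1, forall x, d <= x -> [/\ T x = c0 + c1 * (x - d) + (x - d) ^+ 2 / 2,
        T1 x = c1 + (x - d) & T2 x = 1]].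
Proof.
move=> d0; have [B [sB B0 Bl Br B1]] := mollifier_exists d0.
have cB := smooth_continuous sB; have iB := continuous_locint cB.
pose A2 := prim B; pose A1 := prim A2; pose A0 := prim A1.
have cA2 : continuous A2 by exact: prim_continuous.
have iA2 := continuous_locint cA2.
have cA1 : continuous A1 by exact: prim_continuous.
have iA1 := continuous_locint cA1.
have d2 x : is_derive x (1 : R) A2 (B x) by apply: prim_derive => //; exact: cB.
have d1 x : is_derive x (1 : R) A1 (A2 x) by apply: prim_derive => //; exact: cA2.
have d0' x : is_derive x (1 : R) A0 (A1 x) by apply: prim_derive => //; exact: cA1.
have A2l x : x <= 0 -> A2 x = 0 by exact: prim_left0.
have A1l x : x <= 0 -> A1 x = 0 by exact: prim_left0.
have A2d : A2 d = 1 by rewrite -B1 /oint prim0 subr0.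
have A2r x : d <= x -> A2 x = 1.
  move=> dx; have -> : A2 x = A2 d + oint B d x by rewrite /oint /A2; ring.
  by rewrite A2d oint0 ?addr0 // => y /andP[dy _]; exact: Br.
have A1r x : d <= x -> A1 x = A1 d + (x - d).
  move=> dx; have -> : A1 x = A1 d + oint A2 d x by rewrite /oint /A1; ring.
  rewrite (@eq_oint _ A2 (fun=> 1)) ?oint_cst ?mul1r //; first exact: locint_cst.
  by move=> y /andP[dy _]; exact: A2r.
have A0r x : d <= x -> A0 x = A0 d + A1 d * (x - d) + (x - d) ^+ 2 / 2.
  move=> dx; have -> : A0 x = A0 d + oint A1 d x by rewrite /oint /A0; ring.
  pose Q y := A1 d * (y - d) + (y - d) ^+ 2 / 2.
  have dQ y : is_derive y (1 : R) Q (A1 d + (y - d)).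
    by apply: is_derive_eq; rewrite /GRing.scale /=; field.
  have cl : continuous (fun y => A1 d + (y - d)).
    move=> y; apply: cvgD; first exact: cvg_cst.
    by apply: cvgD; [exact: cvg_id|exact: cvg_cst].
  rewrite (@eq_oint _ A1 (fun y => A1 d + (y - d))) //; first last.
    - by move=> y /andP[dy _]; exact: A1r.
    - exact: continuous_locint.
  by rewrite -(derive_isprim cl dQ) /Q; field.
exists A0, A1, A2, B; split.
- split; last exact: d0'.
  apply: smooth_of_derive d0' _; apply: smooth_of_derive d1 _.
  exact: smooth_of_derive d2 _.
- by [].
- by [].
- by [].
- split; first by move=> x x0; split => //; [exact: prim_left0|exact: A1l|exact: A2l|exact: Bl].
  by exists (A0 d), (A1 d) => x dx; split; [exact: A0r|exact: A1r|exact: A2r].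
Qed.

Lemma mollifier_approx (d e p : R) (B H : R -> R) : 0 < d -> continuous B -> continuous H ->
  (forall x, 0 <= B x) -> oint B 0 d = 1 ->
  (forall x, x <= 0 -> B x = 0) -> (forall x, d <= x -> B x = 0) ->
  (forall x, p <= x <= p + d -> `|H x - H p| <= e) ->
  forall a b, a <= p -> p + d <= b -> `|oint (fun x => H x * B (x - p)) a b - H p| <= e.
Proof.
move=> d0 cB cH B0 B1 Bl Br hH a b ap pb.
have cBp : continuous (fun x => B (x - p)).
  move=> x; apply: continuous_comp; last exact: cB.
  by apply: cvgD; [exact: cvg_id|exact: cvg_cst].
have iBp := continuous_locint cBp.
have iH := continuous_locint cH.
have iHB : locint (fun x => H x * B (x - p)) by exact: locintM.
have pd : p <= p + d by rewrite lerDl ltW.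
rewrite -(oint_chasles _ a p b) -(oint_chasles _ p (p + d) b).
rewrite (oint0 ap) //; last by move=> x /andP[_ xp]; rewrite Bl ?mulr0 // subr_le0.
rewrite (oint0 pb) //; last by move=> x /andP[xp _]; rewrite Br ?mulr0 //; lra.
have one : oint (fun x => B (x - p)) p (p + d) = 1.
  rewrite (oint_shift (- p)); last exact: continuous_locint.
  by rewrite subrr addrAC subrr add0r.
have -> : 0 + (oint (fun x => H x * B (x - p)) p (p + d) + 0) - H p
   = oint (fun x => (H x - H p) * B (x - p)) p (p + d).
  rewrite (_ : (fun x => (H x - H p) * B (x - p)) = fun x => H x * B (x - p) - H p * B (x - p)); last first.
    by apply/funext => x; rewrite mulrBl.
  by rewrite ointB ?ointZ ?one //; [ring|exact: locintZ].
have iD : locint (fun x => (H x - H p) * B (x - p)).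
  by apply: locintM => //; apply: locintB => //; exact: locint_cst.
apply: le_trans (oint_abs iD pd) _.
rewrite -[leRHS]mulr1 -one -ointZ //; apply: oint_le => //; [exact: locint_abs|exact: locintZ|].
by move=> x xp; rewrite normrM (ger0_norm (B0 _)) ler_wpM2r // hH.
Qed.

(** A discrete form of the fact that H''' = 0 as a distribution makes H quadratic: four-point
    functionals that kill polynomials of degree at most 2 also kill H. The pairing of H with phi'''
    = sum_i s_i B(. - p_i) is 0, and it tends to the combination of point values as the mollifier
    narrows. *)
Lemma test_annihilator_combination H (s0 s1 s2 s3 p0 p1 p2 p3 : R) :
  continuous H ->
  (forall (phi phi1 phi2 phi3 : R -> R) a b, a <= b -> test_function phi ->
    (forall x, is_derive x (1 : R) phi (phi1 x)) -> (forall x, is_derive x (1 : R) phi1 (phi2 x)) ->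
    (forall x, is_derive x (1 : R) phi2 (phi3 x)) ->
    continuous phi1 -> continuous phi2 -> continuous phi3 ->
    (forall x, x <= a -> [/\ phi x = 0, phi1 x = 0 & phi2 x = 0]) ->
    (forall x, b <= x -> [/\ phi x = 0, phi1 x = 0 & phi2 x = 0]) ->
    oint (fun x => H x * phi3 x) a b = 0) ->
  s0 + s1 + s2 + s3 = 0 -> s0 * p0 + s1 * p1 + s2 * p2 + s3 * p3 = 0 ->
  s0 * p0 ^+ 2 + s1 * p1 ^+ 2 + s2 * p2 ^+ 2 + s3 * p3 ^+ 2 = 0 ->
  s0 * H p0 + s1 * H p1 + s2 * H p2 + s3 * H p3 = 0.
Proof.
move=> cH hH m0 m1 m2; apply/eqP; rewrite -normr_le0.
apply: (@le_of_le_addZ _ _ _ (`|s0| + `|s1| + `|s2| + `|s3|)) => e e0; rewrite add0r.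
have near (p : R) : exists2 r : R, 0 < r & forall x : R, `|x - p| < r -> `|H x - H p| <= e.
  have /cvgrPdist_le/(_ _ e0) [r r0 hr] := cH p.
  by exists r => // x xp; rewrite distrC; apply: hr; rewrite /= distrC.
have [r0 r00 hr0] := near p0; have [r1 r10 hr1] := near p1.
have [r2 r20 hr2] := near p2; have [r3 r30 hr3] := near p3.
(* One width for the four mollifiers; halving makes it strictly smaller than each radius. *)
pose d := Num.min (Num.min r0 r1) (Num.min r2 r3) / 2.
have [d0 [dr0 [dr1 [dr2 dr3]]]] : 0 < d /\ d < r0 /\ d < r1 /\ d < r2 /\ d < r3.
  have m : 0 < Num.min (Num.min r0 r1) (Num.min r2 r3) by rewrite !lt_min r00 r10 r20 r30.
  have : Num.min (Num.min r0 r1) (Num.min r2 r3) <= r0 by rewrite !ge_min lexx.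
  have : Num.min (Num.min r0 r1) (Num.min r2 r3) <= r1 by rewrite !ge_min lexx !orbT.
  have : Num.min (Num.min r0 r1) (Num.min r2 r3) <= r2 by rewrite !ge_min lexx !orbT.
  have : Num.min (Num.min r0 r1) (Num.min r2 r3) <= r3 by rewrite !ge_min lexx !orbT.
  by rewrite /d; lra.
clearbody d.
have [T [T1 [T2 [B [[sT dT] [dT1 dT2] [cT1 cT2] [cB B0 Br B1] [Tl [c0 [c1 Tr]]]]]]]] := third_antiderivative d0.
pose comb (g : R -> R) (x : R) : R := s0 * g (x - p0) + s1 * g (x - p1) + s2 * g (x - p2) + s3 * g (x - p3).
have dcomb (g g' : R -> R) : (forall x, is_derive x (1 : R) g (g' x)) -> forall x, is_derive x (1 : R) (comb g) (comb g' x).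
  move=> dg x.
  have h0 := is_derive_translate p0 x dg; have h1 := is_derive_translate p1 x dg.
  have h2 := is_derive_translate p2 x dg; have h3 := is_derive_translate p3 x dg.
  by apply: is_derive_eq; rewrite /GRing.scale /=.
have ccomb (g : R -> R) : continuous g -> continuous (comb g).
  move=> cg x.
  have c (p : R) : (fun x : R => g (x - p)) y @[y --> x] --> g (x - p).
    apply: continuous_comp; last exact: cg.
    by apply: cvgD; [exact: cvg_id|exact: cvg_cst].
  by do 3 (apply: cvgD; last by apply: cvgM; [exact: cvg_cst|exact: c]); apply: cvgM; [exact: cvg_cst|exact: c].
have scomb : smooth (comb T).
  have t (p : R) : smooth (fun x => T (x - p)) := @smooth_translate _ T p sT.
  have := @smooth_comb _ _ _ 1 1 (@smooth_comb _ _ _ s0 s1 (t p0) (t p1)) (@smooth_comb _ _ _ s2 s3 (t p2) (t p3)).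
  by rewrite (_ : (fun x => _) = comb T) //; apply/funext => x; rewrite /comb; ring.
pose a := Num.min (Num.min p0 p1) (Num.min p2 p3).
have [a0 [a1 [a2 a3]]] : a <= p0 /\ a <= p1 /\ a <= p2 /\ a <= p3.
  by rewrite /a !ge_min !lexx !orbT.
pose b := Num.max (Num.max p0 p1) (Num.max p2 p3) + d.
have [b0 [b1 [b2 b3]]] : p0 + d <= b /\ p1 + d <= b /\ p2 + d <= b /\ p3 + d <= b.
  by rewrite /b !lerD2r !le_max !lexx !orbT.
have ab : a <= b by clear -a0 b0 d0; lra.
have zl x : x <= a -> [/\ comb T x = 0, comb T1 x = 0 & comb T2 x = 0].
  move=> xa.
  have [t01 t02 t03 _] : [/\ T (x - p0) = 0, T1 (x - p0) = 0, T2 (x - p0) = 0 & B (x - p0) = 0] by apply: Tl; clear -xa a0; lra.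
  have [t11 t12 t13 _] : [/\ T (x - p1) = 0, T1 (x - p1) = 0, T2 (x - p1) = 0 & B (x - p1) = 0] by apply: Tl; clear -xa a1; lra.
  have [t21 t22 t23 _] : [/\ T (x - p2) = 0, T1 (x - p2) = 0, T2 (x - p2) = 0 & B (x - p2) = 0] by apply: Tl; clear -xa a2; lra.
  have [t31 t32 t33 _] : [/\ T (x - p3) = 0, T1 (x - p3) = 0, T2 (x - p3) = 0 & B (x - p3) = 0] by apply: Tl; clear -xa a3; lra.
  by rewrite /comb t01 t02 t03 t11 t12 t13 t21 t22 t23 t31 t32 t33 !mulr0 !addr0.
have zr x : b <= x -> [/\ comb T x = 0, comb T1 x = 0 & comb T2 x = 0].
  move=> bx; rewrite /comb.
  have [-> -> ->] := Tr (x - p0) ltac:(clear -bx b0; lra).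
  have [-> -> ->] := Tr (x - p1) ltac:(clear -bx b1; lra).
  have [-> -> ->] := Tr (x - p2) ltac:(clear -bx b2; lra).
  have [-> -> ->] := Tr (x - p3) ltac:(clear -bx b3; lra).
  split.
  (* To the right of b each T(x - p_i) is a translate of one quadratic, so the sum depends on the
     s_i and p_i only through the three moments. *)
  - transitivity ((s0 + s1 + s2 + s3) * (c0 + c1 * (x - d) + (x - d) ^+ 2 / 2)
      - (s0 * p0 + s1 * p1 + s2 * p2 + s3 * p3) * (c1 + (x - d))
      + (s0 * p0 ^+ 2 + s1 * p1 ^+ 2 + s2 * p2 ^+ 2 + s3 * p3 ^+ 2) / 2); first by field.
    by rewrite m0 m1 m2; ring.
  - transitivity ((s0 + s1 + s2 + s3) * (c1 + (x - d)) - (s0 * p0 + s1 * p1 + s2 * p2 + s3 * p3)); first by ring.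
    by rewrite m0 m1; ring.
  - by rewrite !mulr1.
have tf : test_function (comb T).
  split => //; apply: (@compact_support _ _ a b) => x.
    by move=> /zl[].
  by move=> /zr[].
have := hH _ _ _ _ _ _ ab tf (dcomb _ _ dT) (dcomb _ _ dT1) (dcomb _ _ dT2)
  (ccomb _ cT1) (ccomb _ cT2) (ccomb _ cB) zl zr.
have it s p : locint (fun x => s * (H x * B (x - p))).
  apply: locintZ; apply: locintM; first exact: continuous_locint.
  move=> x; apply: continuous_comp; last exact: cB.
  by apply: cvgD; [exact: cvg_id|exact: cvg_cst].
have it1 p : locint (fun x => H x * B (x - p)).
  by have := it 1 p; rewrite (_ : (fun x => _) = fun x => H x * B (x - p)) //; apply/funext => x; rewrite mul1r.
have -> : (fun x => H x * comb B x) = (fun x => s0 * (H x * B (x - p0)) + s1 * (H x * B (x - p1))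
    + s2 * (H x * B (x - p2)) + s3 * (H x * B (x - p3))).
  by apply/funext => x; rewrite /comb; ring.
rewrite !ointD //; [|exact: locintD|by apply: locintD => //; exact: locintD].
rewrite !ointZ // => E.
have app p r : d < r -> (forall x, `|x - p| < r -> `|H x - H p| <= e) -> a <= p -> p + d <= b ->
    `|oint (fun x => H x * B (x - p)) a b - H p| <= e.
  move=> dr hr ap pb; apply: (@mollifier_approx d) => //.
    by move=> x /Tl[].
  by move=> x /andP[px xd]; apply: hr; rewrite ger0_norm; clear -px xd dr; lra.
have k0 := app _ _ dr0 hr0 a0 b0; have k1 := app _ _ dr1 hr1 a1 b1.
have k2 := app _ _ dr2 hr2 a2 b2; have k3 := app _ _ dr3 hr3 a3 b3.
move: E k0 k1 k2 k3.
set o0 := oint _ a b; set o1 := oint _ a b; set o2 := oint _ a b; set o3 := oint _ a b => E k0 k1 k2 k3.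
have -> : s0 * H p0 + s1 * H p1 + s2 * H p2 + s3 * H p3
   = - (s0 * (o0 - H p0) + s1 * (o1 - H p1) + s2 * (o2 - H p2) + s3 * (o3 - H p3)).
  by move: E; clear; lra.
rewrite normrN !mulrDl.
by do 3 (apply: le_trans (ler_normD _ _) _; apply: lerD; last by rewrite normrM ler_wpM2l);
  rewrite normrM ler_wpM2l.
Qed.

End DistributionalRegularity.

(** * Regularity of distributional solutions *)


Section IntegrableFunctions.
Context {R : realType}.
Implicit Types (g h k l q r G : R -> R) (a b x y c e X : R).
Notation mu := (@lebesgue_measure R).

Definition lim_r g c := forall e, 0 < e -> exists X, forall x, X <= x -> `|g x - c| <= e.
Definition lim_l g c := forall e, 0 < e -> exists X, forall x, x <= X -> `|g x - c| <= e.

(** Integrability over the line, phrased with bounded intervals because [kato_line] delivers its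
    bounds in that form; [integrable_l1] and [l1_integrable] give the equivalence. *)
Definition l1 k := locint k /\ exists M, forall a b, a <= b -> oint (fun x => `|k x|) a b <= M.

Lemma lim_l_reflect g c : lim_r (fun x => g (- x)) c <-> lim_l g c.
Proof.
split=> h e e0; have [X hX] := h e e0; exists (- X) => x xX.
  by have := hX (- x); rewrite opprK; apply; lra.
by apply: hX; lra.
Qed.

Lemma lim_r_comb g h c d s t : lim_r g c -> lim_r h d ->
  lim_r (fun x => s * g x + t * h x) (s * c + t * d).
Proof.
move=> hg hh e e0.
have p : 0 < `|s| + `|t| + 1 by have := normr_ge0 s; have := normr_ge0 t; lra.
have e1 : 0 < e / (`|s| + `|t| + 1) by rewrite divr_gt0.
have [X hX] := hg _ e1; have [Y hY] := hh _ e1.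
exists (Num.max X Y) => x; rewrite ge_max => /andP[Xx Yx].
have -> : s * g x + t * h x - (s * c + t * d) = s * (g x - c) + t * (h x - d) by ring.
apply: le_trans (ler_normD _ _) _; rewrite !normrM.
apply: le_trans (lerD (ler_wpM2l (normr_ge0 s) (hX _ Xx)) (ler_wpM2l (normr_ge0 t) (hY _ Yx))) _.
rewrite -mulrDl mulrA ler_pdivrMr //; nra.
Qed.

Lemma lim_l_comb g h c d s t : lim_l g c -> lim_l h d ->
  lim_l (fun x => s * g x + t * h x) (s * c + t * d).
Proof. by move=> /lim_l_reflect hg /lim_l_reflect hh; apply/lim_l_reflect; exact: (lim_r_comb s t hg hh). Qed.

Lemma lim_r_uniq g c d : lim_r g c -> lim_r g d -> c = d.
Proof.
move=> hc hd; apply/eqP; rewrite -subr_eq0 -normr_le0; apply/ler_addgt0Pl => e e0; rewrite addr0.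
have e2 : 0 < e / 2 by rewrite divr_gt0.
have [X hX] := hc _ e2; have [Y hY] := hd _ e2; pose x := Num.max X Y.
have h1 := hX x (_ : X <= x); have h2 := hY x (_ : Y <= x).
rewrite le_max lexx in h1; rewrite le_max lexx orbT in h2.
have -> : c - d = (g x - d) - (g x - c) by ring.
by apply: le_trans (ler_normB _ _) _; have := h1 isT; have := h2 isT; lra.
Qed.

Lemma l1_reflect k : l1 k -> l1 (fun x => k (- x)).
Proof.
move=> [ik [M hM]]; split; first exact: locint_reflect.
exists M => a b ab; rewrite (@oint_reflect _ (fun x => `|k x|)); last exact: locint_abs.
by apply: hM; lra.
Qed.

Lemma l1_prim_lim_r k : l1 k -> exists c, lim_r (prim k) c.
Proof.
(* Write k = |k| - (|k| - k): the primitive of a nonnegative integrable function is monotone and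
   bounded. *)
suff pos k' : (forall x, 0 <= k' x) -> l1 k' -> exists c, lim_r (prim k') c.
  move=> [ik [M hM]].
  have ia := locint_abs ik.
  have id_ := locintB ia ik.
  have [c hc] : exists c, lim_r (prim (fun x => `|k x|)) c.
    apply: pos => //; split => //; exists M => a b ab; have := hM a b ab.
    by rewrite (_ : (fun x => `| `|k x| |) = fun x => `|k x|) //; apply/funext => x; rewrite normr_id.
  have [d hd] : exists d, lim_r (prim (fun x => `|k x| - k x)) d.
    apply: pos => [x|]; first by rewrite subr_ge0 ler_norm.
    split => //; exists (2 * M) => a b ab; have := hM a b ab => h.
    apply: le_trans (_ : oint (fun x => 2 * `|k x|) a b <= _); last by rewrite ointZ // ler_wpM2l.
    apply: oint_le => //; [exact: locint_abs|exact: locintZ|].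
    by move=> x _; apply: le_trans (ler_normB _ _) _; rewrite normr_id; lra.
  exists (1 * c + (-1) * d).
  have := lim_r_comb 1 (-1) hc hd.
  rewrite (_ : (fun x => 1 * _ + _) = prim k) //; apply/funext => x.
  have := ointB 0 x ia ik; rewrite /oint !prim0; lra.
move=> k0 [ik [M hM]].
have nn : (fun x => `|k' x|) = k' by apply/funext => x; rewrite ger0_norm.
rewrite nn in hM.
pose S := [set prim k' x | x in [set x | 0 <= x]].
have hS : has_sup S.
  split; first by exists (prim k' 0), 0 => //=.
  by exists M => _ [x x0 <-]; have := hM 0 x x0; rewrite /oint prim0 subr0.
exists (sup S) => e e0.
have [_ [X X0 <-] hX] := sup_adherent e0 hS.
exists X => x Xx.
have h1 : prim k' x <= sup S by apply: sup_upper_bound => //; exists x => //=; exact: le_trans Xx.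
have h2 : 0 <= oint k' X x by apply: oint_ge0.
by rewrite /oint in h2; rewrite ler0_norm; lra.
Qed.

Lemma prim_reflect k x : locint k -> prim k (- x) = - prim (fun y => k (- y)) x.
Proof.
move=> ik; have := oint_reflect x 0 ik; rewrite /oint !prim0 oppr0 prim0; lra.
Qed.

Lemma l1_prim_lim_l k : l1 k -> exists c, lim_l (prim k) c.
Proof.
move=> lk; have [c hc] := l1_prim_lim_r (l1_reflect lk); exists (- c); apply/lim_l_reflect.
have := lim_r_comb (-1) 0 hc hc; rewrite mul0r addr0 mulN1r.
rewrite (_ : (fun x => _) = fun x => prim k (- x)) //; apply/funext => x.
by rewrite prim_reflect; [lra|case: lk].
Qed.

Lemma integrable_l1 k : mu.-integrable setT (EFin \o k) -> l1 k.
Proof.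
move=> ik; have lk := integrable_locint ik; split => //.
exists (\int[mu]_x `|k x|) => a b ab.
rewrite ointE //; last exact: locint_abs.
have inn := integrable_norm ik.
rewrite Rintegral_mkcond; apply: le_Rintegral => //.
  rewrite -restrict_EFin; apply/integrable_restrict => //; rewrite setTI.
  exact: integrableS inn.
by move=> x _; rewrite patchE; case: ifP => _; [exact: lexx|exact: normr_ge0].
Qed.

Lemma locint_le k l : measurable_fun [set: R] k -> locint l -> (forall x, `|k x| <= `|l x|) -> locint k.
Proof.
move=> mk il h; split => // a b; apply: (le_integrable _ _ _ (locint_itv a b il)) => //.
  by apply/measurable_EFinP; exact: measurable_funTS.
by move=> x _; rewrite lee_fin.
Qed.

Lemma locint_locally_integrable k : locint k -> locally_integrable setT k.
Proof.
move=> ik; split; [exact: locint_meas|exact: openT|move=> K _ cK].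
have [M [Mr hM]] := compact_bounded cK.
have sub : K `<=` `[- (`|M| + 1), `|M| + 1].
  move=> x Kx; have : `|x| <= `|M| + 1 by apply: (hM (`|M| + 1)) => //; have := ler_norm M; lra.
  by rewrite /= in_itv /= ler_norml.
have := locint_itv (- (`|M| + 1)) (`|M| + 1) ik => /integrableP[mk]; apply: le_lt_trans.
apply: ge0_subset_integral => //; first exact: compact_measurable.
apply: measurableT_comp => //; apply: measurableT_comp => //; exact: (measurable_funTS (locint_meas ik)).
Qed.

(** Lebesgue differentiation applied to the integral from -n, for each n; a countable intersection
    of full-measure sets covers the line. *)
Lemma oint_ae0 k : locint k -> (forall a b, oint k a b = 0) -> {ae mu, forall x, k x = 0}.
Proof.
move=> ik k0.
have h n : {ae mu, forall x, - n%:R < x -> k x = 0}.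
  have := @FTC1 R k (BLeft (- n%:R)) (fun y => locint_itv _ _ ik) (locint_locally_integrable ik).
  apply: filterS; first exact: (ae_filter_ringOfSetsType mu).
  move=> x hx nx.
  have [_] := hx ltac:(by rewrite lte_fin); move=> <-.
  rewrite derive1E.
  have : is_derive x (1 : R) (fun y => \int[mu]_(t in `[(- n%:R), y]) k t) 0.
    apply: (@near_eq_is_derive _ _ _ (cst (0 : R))).
    near=> y; rewrite -ointE ?k0 //; near: y; exact: lt_le_nbhsr.
  by move=> d; exact: derive_val.
have := ae_foralln h; apply: filterS; move=> x hx.
have [n hn] : exists n : nat, `|x| < n%:R by exists (Num.truncn `|x|).+1; exact: truncnS_gt.
apply: (hx n); rewrite ltrNl; apply: le_lt_trans hn; rewrite -normrN; exact: ler_norm.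
Unshelve. all: by end_near. Qed.

Lemma eq_oint_ae k l a b : locint k -> locint l -> {ae mu, forall x, k x = l x} ->
  oint k a b = oint l a b.
Proof.
move=> ik il kl; wlog ab : a b / a <= b => [hw|].
  have [/hw//|/ltW/hw h] := leP a b.
  by rewrite ointNN h -ointNN.
rewrite !ointE // /Rintegral; congr fine; apply: ae_eq_integral => //.
- exact: measurable_int (locint_itv a b ik).
- exact: measurable_int (locint_itv a b il).
- move: kl; apply: filterS; first exact: (ae_filter_ringOfSetsType mu).
  by move=> x kl _; rewrite /= kl.
Qed.

(* If q has limit c at infinity then G grows like c x up to a bounded error. *)
Lemma l1_slope_r G q r c : l1 G -> locint q -> l1 r -> isprim G (fun x => q x + r x) ->
  lim_r q c -> c = 0.
Proof.
move=> [iG [M hM]] iq [ir [N hN]] hG hq.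
apply/eqP; rewrite -normr_le0 leNgt; apply/negP => c0.
have [X hX] := hq (`|c| / 2) ltac:(by rewrite divr_gt0).
have M0 : 0 <= M by have := hM 0 0 (lexx _); rewrite ointxx.
have N0 : 0 <= N by have := hN 0 0 (lexx _); rewrite ointxx.
pose Y := X + 2 * (N + `|G X| + 1) / `|c|.
have XY : X <= Y by rewrite lerDl divr_ge0 // mulr_ge0 //; have := normr_ge0 (G X); lra.
have big x : Y <= x -> 1 <= `|G x|.
  move=> Yx; have Xx : X <= x by exact: le_trans Yx.
  have e1 := hG X x; rewrite ointD // in e1.
  have e2 : `|oint q X x - c * (x - X)| <= `|c| / 2 * (x - X).
    rewrite -oint_cst -ointB //; last exact: locint_cst.
    apply: oint_bound => //; first by apply: locintB => //; exact: locint_cst.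
    by move=> y /andP[Xy _]; exact: hX.
  have e3 : `|oint r X x| <= N by apply: le_trans (oint_abs ir Xx) _; exact: hN.
  have e4 : `|c * (x - X)| <= `|G x| + `|G X| + `|oint r X x| + `|oint q X x - c * (x - X)|.
    have {1}-> : c * (x - X) = G x - G X - oint r X x - (oint q X x - c * (x - X)) by rewrite e1; ring.
    apply: le_trans (ler_normB _ _) _; rewrite lerD2r.
    apply: le_trans (ler_normB _ _) _; rewrite lerD2r; exact: ler_normB.
  rewrite normrM (ger0_norm (_ : 0 <= x - X)) in e4; last by rewrite subr_ge0.
  have e5 : 2 * (N + `|G X| + 1) <= `|c| * (x - X).
    have : 2 * (N + `|G X| + 1) / `|c| <= x - X by move: Yx; rewrite /Y; lra.
    by rewrite ler_pdivrMr // [leRHS]mulrC.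
  lra.
have := hM Y (Y + (M + 1)) ltac:(lra).
have : oint (fun=> 1) Y (Y + (M + 1)) <= oint (fun x => `|G x|) Y (Y + (M + 1)).
  apply: oint_le; [exact: locint_cst|exact: locint_abs|lra|].
  by move=> x /andP[Yx _]; exact: big.
rewrite oint_cst; lra.
Qed.

Lemma l1_slope_l G q r c : l1 G -> locint q -> l1 r -> isprim G (fun x => q x + r x) ->
  lim_l q c -> c = 0.
Proof.
move=> lG iq lr hG /lim_l_reflect hq.
apply/eqP; rewrite -oppr_eq0; apply/eqP.
apply: (@l1_slope_r (fun x => G (- x)) (fun x => - q (- x)) (fun x => - r (- x))).
- exact: l1_reflect.
- by apply: locintN; exact: locint_reflect.
- have [ir [M hM]] := l1_reflect lr; split; first exact: locintN.
  exists M => a b ab; have := hM a b ab.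
  by rewrite (_ : (fun x => `|- r (- x)|) = (fun x => `|r (- x)|)) //; apply/funext => x; rewrite normrN.
- move=> a b.
  have ii : locint (fun x => q x + r x) by apply: locintD => //; case: lr.
  rewrite (_ : (fun x => _) = fun x => - (q (- x) + r (- x))); last first.
    by apply/funext => x; rewrite opprD.
  rewrite ointN; last exact: (locint_reflect ii).
  rewrite (@oint_reflect _ (fun x => q x + r x)) // -ointNN; exact: hG.
- have := lim_r_comb (-1) 0 hq hq; rewrite mul0r addr0 mulN1r.
  by rewrite (_ : (fun x => _) = fun x => - q (- x)) //; apply/funext => x; rewrite mul0r addr0 mulN1r.
Qed.

End IntegrableFunctions.


(** * From distributional solutions to continuous solutions of the integrated equation *)

Section ViscousProfiles.
Context {R : realType}.
Implicit Types (f : R -> R -> R) (fl fr u w V W : R -> R) (L eps lam a b x : R).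
Notation mu := (@lebesgue_measure R).

Definition split_flux f fl fr L :=
  [/\ forall x (t : R), f x t = if x <= 0 then fl t else fr t,
      forall s t : R, `|fl s - fl t| <= L * `|s - t|,
      forall s t : R, `|fr s - fr t| <= L * `|s - t|,
      fl 0 = 0 /\ fr 0 = 0 & 0 <= L].

(* The integrated form of the resolvent equation, with V' = u and W' = w. *)
Definition viscous f eps lam W V u :=
  [/\ continuous u, isprim V u &
      isprim (fun x => lam * eps * u x) (fun x => V x - W x + lam * f x (u x))].

Lemma lipschitz_continuous (g : R -> R) L : (forall s t, `|g s - g t| <= L * `|s - t|) -> continuous g.
Proof.
move=> hg x; apply/cvgrPdist_le => e e0; near=> y.
apply: le_trans (hg _ _) _.
have p : 0 < `|L| + 1 by have := normr_ge0 L; lra.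
have : `|x - y| <= e / (`|L| + 1).
  near: y; exists (e / (`|L| + 1)) => /=; first by rewrite divr_gt0.
  by move=> y /ltW.
rewrite ler_pdivlMr // => h; have := normr_ge0 (x - y); have := ler_norm L; nra.
Unshelve. all: by end_near. Qed.

Lemma split_flux_meas f fl fr L u : split_flux f fl fr L -> measurable_fun setT u ->
  measurable_fun setT (fun x => f x (u x)).
Proof.
move=> [hf hl hr _ _] mu_.
rewrite (_ : (fun x => f x (u x)) = fun x => if x <= 0 then fl (u x) else fr (u x)); last first.
  by apply/funext => x; exact: hf.
apply: measurable_fun_ifT.
- by apply: measurable_fun_ler => //; exact: measurable_cst.
- by apply: measurableT_comp => //; apply: continuous_measurable_fun; exact: lipschitz_continuous hl.
- by apply: measurableT_comp => //; apply: continuous_measurable_fun; exact: lipschitz_continuous hr.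
Qed.

Lemma split_flux_lip f fl fr L x (s t : R) : split_flux f fl fr L -> `|f x s - f x t| <= L * `|s - t|.
Proof. by move=> [hf hl hr _ _]; rewrite !hf; case: ifP. Qed.

Lemma split_flux0 f fl fr L x : split_flux f fl fr L -> f x 0 = 0.
Proof. by move=> [hf _ _ [h1 h2] _]; rewrite hf h1 h2; case: ifP. Qed.

Lemma split_flux_abs f fl fr L x (t : R) : split_flux f fl fr L -> `|f x t| <= L * `|t|.
Proof.
move=> hf; have := split_flux_lip x t 0 hf.
by rewrite (split_flux0 x hf) !subr0.
Qed.

Lemma split_flux_locint f fl fr L u : split_flux f fl fr L -> locint u -> locint (fun x => f x (u x)).
Proof.
move=> hf iu; apply: (@locint_le _ _ (fun x => L * u x)); last first.
- move=> x; apply: le_trans (split_flux_abs _ _ hf) _.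
  by rewrite normrM ger0_norm //; case: hf.
- exact: locintZ.
- by apply: (split_flux_meas hf); exact: locint_meas.
Qed.

Lemma split_flux_l1 f fl fr L u : split_flux f fl fr L -> l1 u -> l1 (fun x => f x (u x)).
Proof.
move=> hf [iu [M hM]]; have if_ := split_flux_locint hf iu; split => //.
have L0 : 0 <= L by case: hf.
exists (L * M) => a b ab; apply: le_trans (_ : oint (fun x => L * `|u x|) a b <= _).
  apply: oint_le => //; [exact: locint_abs|by apply: locintZ; exact: locint_abs|].
  by move=> x _; exact: split_flux_abs hf.
rewrite ointZ; last exact: locint_abs.
by rewrite ler_wpM2l // hM.
Qed.

Lemma l1Z u (c : R) : l1 u -> l1 (fun x => c * u x).
Proof.
move=> [iu [M hM]]; split; first exact: locintZ.
exists (`|c| * M) => a b ab.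
rewrite (_ : (fun x => _) = fun x => `|c| * `|u x|); last by apply/funext => x; rewrite normrM.
by rewrite ointZ ?ler_wpM2l ?hM //; exact: locint_abs.
Qed.

Lemma interpolate_quadratic (H : R -> R) :
  (forall s0 s1 s2 s3 p0 p1 p2 p3 : R, s0 + s1 + s2 + s3 = 0 ->
    s0 * p0 + s1 * p1 + s2 * p2 + s3 * p3 = 0 ->
    s0 * p0 ^+ 2 + s1 * p1 ^+ 2 + s2 * p2 ^+ 2 + s3 * p3 ^+ 2 = 0 ->
    s0 * H p0 + s1 * H p1 + s2 * H p2 + s3 * H p3 = 0) ->
  exists c1 c2 : R, forall a b, H b - H a = c1 * (b - a) + c2 * (b ^+ 2 - a ^+ 2).
Proof.
move=> hH.
have E x : H x = (x - 1) * (x - 2) / 2 * H 0 - x * (x - 2) * H 1 + x * (x - 1) / 2 * H 2.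
  (* Lagrange interpolation at 0, 1, 2: the weights reproduce polynomials of degree at most 2 at x,
     so the three moments vanish. *)
  have := hH (- ((x - 1) * (x - 2) / 2)) (x * (x - 2)) (- (x * (x - 1) / 2)) 1 0 1 2 x.
  move=> /(_ _)/wrap[]; first by field.
  move=> /(_ _)/wrap[]; first by field.
  move=> /(_ _)/wrap[]; first by field.
  by lra.
exists (- (3 / 2) * H 0 + 2 * H 1 - H 2 / 2), (H 0 / 2 - H 1 + H 2 / 2) => a b.
by rewrite (E b) (E a); field.
Qed.

(** An integration by parts of u - w turns the weak equation into <V - W + lam f, phi'> + lam eps
    <u, phi''> = 0, and a second one gives <lam eps u - F, phi''> = 0. A further primitive yields a
    continuous function, whose point values mollification can recover, at the price of a third
    derivative on phi. *)
Lemma solution_annihilates f fl fr L eps lam u w V W :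
  split_flux f fl fr L -> locint u -> locint w -> isprim V u -> isprim W w ->
  solves_resolvent f eps lam w u ->
  let F := prim (fun x => V x - W x + lam * f x (u x)) in
  forall (phi phi1 phi2 phi3 : R -> R) a b, a <= b -> test_function phi ->
    (forall x, is_derive x (1 : R) phi (phi1 x)) -> (forall x, is_derive x (1 : R) phi1 (phi2 x)) ->
    (forall x, is_derive x (1 : R) phi2 (phi3 x)) ->
    continuous phi1 -> continuous phi2 -> continuous phi3 ->
    (forall x, x <= a -> [/\ phi x = 0, phi1 x = 0 & phi2 x = 0]) ->
    (forall x, b <= x -> [/\ phi x = 0, phi1 x = 0 & phi2 x = 0]) ->
    oint (fun x => prim (fun y => lam * eps * u y - F y) x * phi3 x) a b = 0.
Proof.
move=> hf iu iw hV hW hs F phi phi1 phi2 phi3 a b ab tphi d0 d1 d2 c1 c2 c3 zl zr.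
have c0 : continuous phi := derive_continuous d0.
have cV := isprim_continuous iu hV; have cW := isprim_continuous iw hW.
have ifu := split_flux_locint hf iu.
have iV := continuous_locint cV; have iW := continuous_locint cW.
have ik : locint (fun x => V x - W x + lam * f x (u x)).
  by apply: locintD; [exact: locintB|exact: locintZ].
have cF : continuous F by exact: prim_continuous.
have iF := continuous_locint cF.
have ih : locint (fun y => lam * eps * u y - F y) by apply: locintB => //; exact: locintZ.
have [za0 za1 za2] := zl a (lexx _); have [zb0 zb1 zb2] := zr b (lexx _).
have D1 : derive1 phi = phi1 by exact: is_derive_derive1.
have D2 : derive1 phi1 = phi2 by exact: is_derive_derive1.
have supp (k g : R -> R) : locint k -> continuous g -> (forall x, x <= a -> g x = 0) ->
    (forall x, b <= x -> g x = 0) -> distribution_of k g = oint (fun x => k x * g x) a b.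
  move=> ik' cg gl gr; apply: Rintegral_oint => //; first exact: locintM.
    by move=> x /gl ->; rewrite mulr0.
  by move=> x /gr ->; rewrite mulr0.
have z1l x : x <= a -> phi1 x = 0 by case/zl.
have z1r x : b <= x -> phi1 x = 0 by case/zr.
have z2l x : x <= a -> phi2 x = 0 by case/zl.
have z2r x : b <= x -> phi2 x = 0 by case/zr.
have z0l x : x <= a -> phi x = 0 by case/zl.
have z0r x : b <= x -> phi x = 0 by case/zr.
have := hs _ tphi; rewrite /distribution_deriv D1 D2.
rewrite !supp // => E.
have I1 : oint (fun x => (u x - w x) * phi x + (V x - W x) * phi1 x) a b = 0.
  have -> := oint_by_parts a b (locintB iu iw) (isprimB iu iw hV hW) c1 (derive_isprim c1 d0).
  by rewrite za0 zb0 !mulr0 subrr.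
have I2 : oint (fun x => (V x - W x + lam * f x (u x)) * phi1 x + F x * phi2 x) a b = 0.
  have -> := oint_by_parts a b ik (isprim_prim _) c2 (derive_isprim c2 d1).
  by rewrite za1 zb1 !mulr0 subrr.
have I3 := oint_by_parts a b ih (isprim_prim _) c3 (derive_isprim c3 d2).
rewrite za2 zb2 !mulr0 subrr in I3.
have jF : locint (fun x => F x * phi2 x) by exact: locintM.
have ju0 : locint (fun x => u x * phi x) by exact: locintM.
have jw0 : locint (fun x => w x * phi x) by exact: locintM.
have ju2 : locint (fun x => u x * phi2 x) by exact: locintM.
have jf1 : locint (fun x => f x (u x) * phi1 x) by exact: locintM.
have jV1 : locint (fun x => (V x - W x) * phi1 x) by apply: locintM => //; exact: locintB.
have jH3 : locint (fun x => prim (fun y => lam * eps * u y - F y) x * phi3 x).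
  by apply: locintM => //; apply: continuous_locint; exact: prim_continuous.
move: I1 I2 I3.
rewrite (_ : (fun x => (u x - w x) * phi x + (V x - W x) * phi1 x) =
  (fun x => (u x * phi x - w x * phi x) + (V x - W x) * phi1 x)); last by apply/funext => x; rewrite mulrBl.
rewrite ointD ?ointB //; last exact: locintB.
rewrite (_ : (fun x => (V x - W x + lam * f x (u x)) * phi1 x + F x * phi2 x) =
  (fun x => (V x - W x) * phi1 x + lam * (f x (u x) * phi1 x) + F x * phi2 x)); last first.
  by apply/funext => x; ring.
rewrite ointD //; last by apply: locintD => //; exact: locintZ.
rewrite ointD //; last exact: locintZ.
rewrite ointZ //.
rewrite ointD //; last exact: locintM.
rewrite (_ : (fun x => (lam * eps * u x - F x) * phi2 x) =
  (fun x => lam * eps * (u x * phi2 x) - F x * phi2 x)); last by apply/funext => x; ring.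
rewrite ointB //; last exact: locintZ.
rewrite ointZ // => I1 I2 I3.
move: E I1 I2 I3; set o1 := oint _ a b; set o2 := oint _ a b; set o3 := oint _ a b; set o4 := oint _ a b.
set o5 := oint _ a b; set o6 := oint _ a b; set o7 := oint _ a b.
nra.
Qed.

(** The continuous primitive of [lam * eps * u0 - F] is quadratic, so almost everywhere u0 is (F +
    affine) / (lam eps), which is continuous. The slope of the affine part shifts V - W by a
    constant in the integrated equation, and integrability of u forces that constant to be 0. *)
Lemma solution_regularity f fl fr L eps lam u0 w :
  split_flux f fl fr L -> 0 < eps -> 0 < lam ->
  mu.-integrable setT (EFin \o u0) -> mu.-integrable setT (EFin \o w) ->
  solves_resolvent f eps lam w u0 ->
  exists u V W, [/\ viscous f eps lam W V u, isprim W w, l1 u,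
    {ae mu, forall x, u0 x = u x} &
    [/\ lim_l V 0, lim_l W 0 & lim_r (fun x => V x - W x) 0]].
Proof.
move=> hf eps0 lam0 /integrable_l1 lu0 /integrable_l1 lw hs.
have le0 : 0 < lam * eps by rewrite mulr_gt0.
have iu0 : locint u0 by case: lu0.
have iw : locint w by case: lw.
have [cu hcu] := l1_prim_lim_l lu0; have [cw hcw] := l1_prim_lim_l lw.
have [du hdu] := l1_prim_lim_r lu0; have [dw hdw] := l1_prim_lim_r lw.
pose V x := prim u0 x - cu; pose W x := prim w x - cw.
have hV : isprim V u0 by move=> a b; rewrite /V /oint; ring.
have hW : isprim W w by move=> a b; rewrite /W /oint; ring.
have cV := isprim_continuous iu0 hV; have cW := isprim_continuous iw hW.
have iVW : locint (fun x => V x - W x) by apply: locintB; exact: continuous_locint.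
have ifu := split_flux_locint hf iu0.
pose k x := V x - W x + lam * f x (u0 x).
have ik : locint k by apply: locintD => //; exact: locintZ.
pose F := prim k.
have cF : continuous F by exact: prim_continuous.
have iF := continuous_locint cF.
pose h x := lam * eps * u0 x - F x.
have ih : locint h by apply: locintB => //; exact: locintZ.
have [c1 [c2 hH]] : exists c1 c2 : R, forall a b, prim h b - prim h a = c1 * (b - a) + c2 * (b ^+ 2 - a ^+ 2).
  apply: interpolate_quadratic => s0 s1 s2 s3 p0 p1 p2 p3 m0 m1 m2.
  apply: test_annihilator_combination m0 m1 m2; first exact: prim_continuous.
  exact: (solution_annihilates hf iu0 iw hV hW hs).
pose A x := c1 + 2 * c2 * x.
have cA : continuous A.
  by move=> x; apply: cvgD; [exact: cvg_cst|apply: cvgM; [exact: cvg_cst|exact: cvg_id]].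
have iA := continuous_locint cA.
have hA : isprim (fun x => c1 * x + c2 * x ^+ 2) A.
  by apply: derive_isprim => // x; apply: is_derive_eq; rewrite /GRing.scale /A /=; ring.
have hhA a b : oint h a b = oint A a b by rewrite -hA /oint hH; ring.
pose u x := (lam * eps)^-1 * (F x + A x).
have cu' : continuous u.
  by move=> x; apply: cvgM; [exact: cvg_cst|apply: cvgD; [exact: cF|exact: cA]].
have iu := continuous_locint cu'.
have u0u : {ae mu, forall x, u0 x = u x}.
  have := @oint_ae0 _ (fun x => h x - A x) (locintB ih iA) (fun a b => _).
  move=> /(_ _)/wrap[]; first by move=> a b; rewrite ointB // hhA subrr.
  apply: filterS; first exact: (ae_filter_ringOfSetsType mu).
  move=> x; rewrite /h /u => /eqP; rewrite subr_eq0 => /eqP e.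
  by rewrite -e; field; rewrite !gt_eqF.
have uu a b : oint u0 a b = oint u a b by exact: eq_oint_ae.
have aau : {ae mu, forall x, `|u0 x| = `|u x|}.
  by move: u0u; apply: filterS; [exact: (ae_filter_ringOfSetsType mu)|move=> x ->].
have lu : l1 u.
  split => //; case: lu0 => _ [M hM]; exists M => a b ab.
  by rewrite -(eq_oint_ae a b (locint_abs iu0) (locint_abs iu) aau); exact: hM.
have ifu' := split_flux_locint hf iu.
have ff a b : oint (fun x => f x (u0 x)) a b = oint (fun x => f x (u x)) a b.
  apply: eq_oint_ae => //.
  by move: u0u; apply: filterS; [exact: (ae_filter_ringOfSetsType mu)|move=> x ->].
have hG : isprim (fun x => lam * eps * u x) (fun x => (V x - W x + 2 * c2) + lam * f x (u x)).
  move=> a b; rewrite ointD; [|by apply: locintD => //; exact: locint_cst|exact: locintZ].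
  rewrite ointD //; last exact: locint_cst.
  rewrite oint_cst ointZ // -ff.
  have -> : lam * eps * u b - lam * eps * u a = F b - F a + (A b - A a) by rewrite /u; field; rewrite !gt_eqF.
  rewrite (isprim_prim k a b) /k ointD; [|by []|exact: locintZ].
  by rewrite ointZ // /A; ring.
have lG : l1 (fun x => lam * eps * u x) by exact: l1Z.
have lf : l1 (fun x => lam * f x (u x)) by apply: l1Z; exact: split_flux_l1 hf lu.
have iq : locint (fun x => V x - W x + 2 * c2) by apply: locintD => //; exact: locint_cst.
have limV : lim_l V 0.
  by move=> e e0; have [X hX] := hcu e e0; exists X => x xX; rewrite subr0; exact: hX.
have limW : lim_l W 0.
  by move=> e e0; have [X hX] := hcw e e0; exists X => x xX; rewrite subr0; exact: hX.
(* Near -oo, V - W tends to 0 and lam f(x, u) is integrable, so a nonzero constant would make u grow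
   linearly. *)
have c20 : 2 * c2 = 0.
  apply: (l1_slope_l lG iq lf hG) => e e0.
  have := lim_l_comb 1 (-1) limV limW => /(_ e e0)[X hX]; exists X => x xX.
  have := hX x xX; rewrite !mulr0 addr0 subr0.
  by rewrite (_ : _ - 2 * c2 = 1 * V x + -1 * W x) //; ring.
have hG' : isprim (fun x => lam * eps * u x) (fun x => (V x - W x) + lam * f x (u x)).
  move=> a b; rewrite hG; congr (oint _ a b); apply/funext => x; rewrite c20 addr0 //.
exists u, V, W; split => //; first by split => // a b; rewrite -uu; exact: hV.
split => //.
have limD : lim_r (fun x => V x - W x) (du - cu - (dw - cw)).
  move=> e e0; have := lim_r_comb 1 (-1) hdu hdw => /(_ e e0)[X hX]; exists X => x xX.
  have := hX x xX; rewrite /V /W.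
  by rewrite (_ : prim u0 x - cu - _ - _ = 1 * prim u0 x + -1 * prim w x - (1 * du + -1 * dw)) //; ring.
(* The same growth argument at +oo: u and w have equal total mass. *)
by have <- := l1_slope_r lG iVW lf hG' limD.
Qed.

End ViscousProfiles.

(** * A priori bounds for the viscous equation *)


Section AprioriBounds.
Context {R : realType}.
Implicit Types (f : R -> R -> R) (fl fr u w V W : R -> R) (L eps lam a b x : R).
Notation mu := (@lebesgue_measure R).

(** Dropping the left endpoint matters on intervals starting at 0: at x = 0 the flux is still [fl],
    while everywhere to the right it is [fr]. *)
Lemma eq_oint_oc (k l : R -> R) a b : locint k -> locint l -> a <= b ->
  (forall x, a < x -> x <= b -> k x = l x) -> oint k a b = oint l a b.
Proof.
move=> ik il ab h; rewrite !ointE //.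
rewrite -!Rintegral_itv_obnd_cbnd.
- apply: eq_Rintegral => x; rewrite inE /= in_itv /= => /andP[? ?]; exact: h.
- by apply: integrableS (locint_itv a b il) => //; apply: subset_itvr; rewrite bnd_simp.
- by apply: integrableS (locint_itv a b ik) => //; apply: subset_itvr; rewrite bnd_simp.
Qed.

Lemma continuous_oint0 (g : R -> R) : continuous g -> (forall a b, oint g a b = 0) -> forall x, g x = 0.
Proof.
move=> cg h x.
have d1 := prim_derive (continuous_locint cg) (cg x).
have d2 : is_derive x (1 : R) (prim g) 0.
  have -> : prim g = cst 0 by apply/funext => y; have := h 0 y; rewrite /oint prim0 subr0.
  exact: is_derive_cst.
by rewrite -(@derive_val _ _ _ _ _ _ _ d1) (@derive_val _ _ _ _ _ _ _ d2).
Qed.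

(** [kato] is applied with [fl] on the left of 0 and with [fr] on the right. Both d and V - W are
    continuous at 0, so the two boundary terms produced there cancel and the jump of the flux leaves
    no trace. *)
Lemma kato_line f fl fr L eps lam u1 u2 w1 w2 V1 V2 W1 W2 a b :
  split_flux f fl fr L -> 0 < eps -> 0 < lam -> locint w1 -> locint w2 ->
  isprim W1 w1 -> isprim W2 w2 ->
  viscous f eps lam W1 V1 u1 -> viscous f eps lam W2 V2 u2 -> a <= 0 -> 0 <= b ->
  oint (fun x => `|u1 x - u2 x|) a b <= oint (fun x => `|w1 x - w2 x|) a b +
    (((V1 b - W1 b) - (V2 b - W2 b)) * Num.sg (u1 b - u2 b) -
     ((V1 a - W1 a) - (V2 a - W2 a)) * Num.sg (u1 a - u2 a)).
Proof.
move=> hf eps0 lam0 iw1 iw2 hW1 hW2 [cu1 hV1 hu1] [cu2 hV2 hu2] a0 b0.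
pose z x := (V1 x - W1 x) - (V2 x - W2 x); rewrite -/(z a) -/(z b).
have iu1 := continuous_locint cu1; have iu2 := continuous_locint cu2.
have cV1 := isprim_continuous iu1 hV1; have cV2 := isprim_continuous iu2 hV2.
have cW1 := isprim_continuous iw1 hW1; have cW2 := isprim_continuous iw2 hW2.
have cz : continuous z.
  by move=> x; apply: cvgB; apply: cvgB; [exact: cV1|exact: cW1|exact: cV2|exact: cW2].
have lamn : lam != 0 by rewrite gt_eqF.
pose d x := u1 x - u2 x; pose om x := w1 x - w2 x; pose ze x := lam^-1 * z x.
have cd : continuous d by move=> x; apply: cvgB; [exact: cu1|exact: cu2].
have cze : continuous ze by move=> x; apply: cvgM; [exact: cvg_cst|exact: cz].
have io : locint om by exact: locintB.
have hz x y : lam * (ze y - ze x) = oint (fun x => d x - om x) x y.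
  rewrite ointB //; last exact: continuous_locint.
  by rewrite /d /om !ointB // -hV1 -hV2 -hW1 -hW2 /ze /z; field.
have if1 := split_flux_locint hf iu1; have if2 := split_flux_locint hf iu2.
have half (h : R -> R) x y : continuous h -> (forall s t, `|h s - h t| <= L * `|s - t|) -> x <= y ->
    (forall s t, x < s -> s <= y -> f s t = h t) ->
    oint (fun s => `|d s|) x y <= oint (fun s => `|om s|) x y +
      lam * (ze y * Num.sg (d y) - ze x * Num.sg (d x)).
  move=> ch Lh xy fh.
  pose g s := h (u1 s) - h (u2 s).
  have cg : continuous g.
    move=> s; apply: cvgB; apply: continuous_comp;
      [exact: cu1|exact: ch|exact: cu2|exact: ch].
  apply: (@kato R L eps lam x y d g ze om) => //.
  - move=> p q xp pq qy.
    have e1 := hu1 p q; have e2 := hu2 p q.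
    have -> : eps * (d q - d p) = lam^-1 * ((lam * eps * u1 q - lam * eps * u1 p) - (lam * eps * u2 q - lam * eps * u2 p)).
      by rewrite /d; field.
    have iF V W (u' : R -> R) : continuous V -> continuous W -> locint (fun x => f x (u' x)) ->
        locint (fun x => V x - W x + lam * f x (u' x)).
      move=> cV cW i; apply: locintD; last exact: locintZ.
      by apply: locintB; exact: continuous_locint.
    rewrite e1 e2 -ointB; [|exact: iF|exact: iF].
    rewrite -ointZ; last by apply: locintB; exact: iF.
    apply: eq_oint_oc => //.
    + by apply: locintZ; apply: locintB; exact: iF.
    + by apply: locintD; exact: continuous_locint.
    + move=> s ps sq; rewrite !fh; [|lra..].
      by rewrite /g /ze /z; field.
  - move=> s _; exact: Lh.
have [hfl hl hr _ _] := hf.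
have h1 := half fl a 0 (lipschitz_continuous hl) hl a0.
have h2 := half fr 0 b (lipschitz_continuous hr) hr b0.
move: h1 h2 => /(_ _)/wrap[]; first by move=> s t _ s0; rewrite hfl s0.
move=> h1 /(_ _)/wrap[]; first by move=> s t s0 _; rewrite hfl leNgt s0.
move=> h2; have := lerD h1 h2; rewrite oint_chasles.
have e x : lam * (ze x * Num.sg (d x)) = z x * Num.sg (d x) by rewrite /ze; field.
rewrite !mulrBr !e => h.
change (oint (fun x => `|d x|) a b <= oint (fun x => `|om x|) a b + (z b * Num.sg (d b) - z a * Num.sg (d a))).
apply: le_trans h _; rewrite -(oint_chasles (fun x => `|om x|) a 0 b); lra.
Qed.

Lemma oint_mono (k : R -> R) a b c d : locint k -> (forall x, 0 <= k x) -> c <= a -> a <= b -> b <= d ->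
  oint k a b <= oint k c d.
Proof.
move=> ik k0 ca ab bd; rewrite -(oint_chasles k c a d) -(oint_chasles k a b d).
have := oint_ge0 ik ca (fun x _ => k0 x); have := oint_ge0 ik bd (fun x _ => k0 x); lra.
Qed.

(** Supplies arbitrarily remote endpoints at which u - 1 has sign -1, as [viscous_le1] requires. *)
Lemma l1_lt1_r u X : l1 u -> exists2 b, X <= b & u b < 1.
Proof.
move=> [iu [M hM]]; apply: contrapT => h.
have u1 x : X <= x -> 1 <= u x by move=> Xx; rewrite leNgt; apply/negP => ux; apply: h; exists x.
have M0 : 0 <= M by have := hM X X (lexx _); rewrite ointxx.
have := hM X (X + (M + 1)) ltac:(lra).
have : oint (fun=> 1) X (X + (M + 1)) <= oint (fun x => `|u x|) X (X + (M + 1)).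
  apply: oint_le; [exact: locint_cst|exact: locint_abs|lra|].
  by move=> x /andP[Xx _]; apply: le_trans (u1 _ Xx) (ler_norm _).
by rewrite oint_cst; lra.
Qed.

Lemma l1_lt1_l u X : l1 u -> exists2 a, a <= X & u a < 1.
Proof.
move=> /l1_reflect /(l1_lt1_r (- X))[b bX ub]; exists (- b) => //; lra.
Qed.

Definition decays V W :=
  [/\ lim_l V 0, lim_l W 0 & lim_r (fun x => V x - W x) 0].

Lemma decays_ends V W e a b : decays V W -> 0 < e -> exists c d, [/\ c <= a, b <= d,
  forall x, x <= c -> `|V x - W x| <= e & forall x, d <= x -> `|V x - W x| <= e].
Proof.
move=> [hV hW hz] e0.
have := lim_l_comb 1 (-1) hV hW => /(_ e e0)[X hX]; have [Y hY] := hz e e0.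
exists (Num.min X a), (Num.max Y b); split; rewrite ?ge_min ?le_max ?lexx ?orbT // => x.
  rewrite le_min => /andP[xX _]; have := hX x xX; rewrite !mulr0 addr0 subr0.
  by rewrite mul1r mulN1r.
by rewrite ge_max => /andP[Yx _]; have := hY x Yx; rewrite subr0.
Qed.

Lemma viscous0 f fl fr L eps lam : split_flux f fl fr L ->
  viscous f eps lam (fun=> 0) (fun=> 0) (fun=> 0).
Proof.
move=> hf; split; first by move=> x; exact: cvg_cst.
  by move=> a b; rewrite oint_cst mul0r subrr.
move=> a b /=; rewrite (_ : (fun x => _) = (fun=> 0)) ?oint_cst ?mul0r ?mulr0 ?subrr //.
by apply/funext => x; rewrite (split_flux0 x hf); ring.
Qed.

(** The shift [lam * fl 1] of the primitive of the datum cancels the flux of the constant state 1;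
    one shift serves both half-lines because [fl 1 = fr 1]. *)
Lemma viscous1 f fl fr L eps lam : split_flux f fl fr L -> fl 1 = fr 1 ->
  viscous f eps lam (fun x => x + lam * fl 1) id (fun=> 1).
Proof.
move=> [hf _ _ _ _] h1; split; first by move=> x; exact: cvg_cst.
  by move=> a b; rewrite oint_cst mul1r.
move=> a b /=; rewrite (_ : (fun x => _) = (fun=> 0)) ?oint_cst ?mul0r ?subrr //.
by apply/funext => x; rewrite hf -h1 if_same; ring.
Qed.

(** Comparison with the zero solution: the integral of |u| is at most that of |w| = w up to boundary
    terms. Since V - W decays at both ends, the integrals of w and u differ by little, so |u| - u
    has integral 0. *)
Lemma viscous_ge0 f fl fr L eps lam u w V W : split_flux f fl fr L -> 0 < eps -> 0 < lam ->
  locint w -> isprim W w -> {ae mu, forall x, 0 <= w x} ->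
  viscous f eps lam W V u -> decays V W -> forall x, 0 <= u x.
Proof.
move=> hf eps0 lam0 iw hW w0 vu dec.
have [cu hV hu] := vu; have iu := continuous_locint cu.
have cg : continuous (fun x => `|u x| - u x).
  by move=> x; apply: cvgB; [apply: cvg_norm; exact: cu|exact: cu].
have g0 x : 0 <= `|u x| - u x by rewrite subr_ge0 ler_norm.
have ig := continuous_locint cg.
have key a b : a <= b -> oint (fun x => `|u x| - u x) a b <= 0.
  move=> ab; apply/ler_addgt0Pl => e e0; rewrite addr0.
  have e4 : 0 < e / 4 by rewrite divr_gt0.
  have [c [d [ca bd hc hd]]] := decays_ends (Num.min a 0) (Num.max b 0) dec e4.
  have h1 := hc c (lexx _); have h2 := hd d (lexx _).
  move: ca bd; rewrite le_min ge_max => /andP[ca c0] /andP[bd d0].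
  apply: le_trans (oint_mono ig g0 ca ab bd) _.
  have hW0 : isprim (fun=> 0 : R) (fun=> 0 : R) by move=> x y; rewrite oint_cst mul0r subrr.
  have := kato_line hf eps0 lam0 iw (locint_cst 0) hW hW0 vu (viscous0 eps lam hf) c0 d0.
  rewrite ointB //; last exact: locint_abs.
  rewrite (_ : (fun x => `|u x - 0|) = fun x => `|u x|); last by apply/funext => x; rewrite subr0.
  rewrite (_ : (fun x => `|w x - 0|) = fun x => `|w x|); last by apply/funext => x; rewrite subr0.
  rewrite (@eq_oint_ae _ (fun x => `|w x|) w c d (locint_abs iw) iw); last first.
    by move: w0; apply: filterS; [exact: (ae_filter_ringOfSetsType mu)|move=> x wx; rewrite ger0_norm].
  rewrite -hW -hV !subr0.
  have bnd (p q : R) : `|p| <= e / 4 -> `|p * Num.sg q| <= e / 4.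
    move=> hp; rewrite normrM -[leRHS]mulr1 ler_pM // normr_sg; by case: (q != 0).
  have := bnd _ (u d) h2; have := bnd _ (u c) h1.
  move: h1 h2; rewrite !ler_norml => /andP[? ?] /andP[? ?] /andP[? ?] /andP[? ?]; lra.
have z : forall x, `|u x| - u x = 0.
  apply: continuous_oint0 => // a b; wlog ab : a b / a <= b => [hw|].
    have [/hw//|/ltW/hw h] := leP a b; by rewrite ointNN h oppr0.
  by apply/eqP; rewrite eq_le key //= oint_ge0.
by move=> x; have := z x => /eqP; rewrite subr_eq0 => /eqP <-.
Qed.

(** Comparison with the constant solution 1. That solution does not decay, so the boundary terms are
    computed exactly instead: at endpoints where u < 1 both signs are -1, and the terms turn the
    integral of 1 - w into that of 1 - u. Hence |u - 1| + (u - 1) has integral 0. *)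
Lemma viscous_le1 f fl fr L eps lam u w V W : split_flux f fl fr L -> fl 1 = fr 1 ->
  0 < eps -> 0 < lam ->
  locint w -> isprim W w -> {ae mu, forall x, w x <= 1} -> l1 u ->
  viscous f eps lam W V u -> forall x, u x <= 1.
Proof.
move=> hf f1 eps0 lam0 iw hW w1 lu vu.
have [cu hV hu] := vu; have iu := continuous_locint cu.
have i1 : locint (fun=> 1 : R) by exact: locint_cst.
have cg : continuous (fun x => `|u x - 1| + (u x - 1)).
  move=> x; have c : (fun x => u x - 1) y @[y --> x] --> u x - 1.
    by apply: cvgB; [exact: cu|exact: cvg_cst].
  by apply: cvgD => //; apply: cvg_norm.
have g0 x : 0 <= `|u x - 1| + (u x - 1) by have := ler_norm (- (u x - 1)); rewrite normrN; lra.
have ig := continuous_locint cg.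
have key a b : a <= b -> oint (fun x => `|u x - 1| + (u x - 1)) a b <= 0.
  move=> ab.
  have [c ca uc] := l1_lt1_l (Num.min a 0) lu; have [d bd ud] := l1_lt1_r (Num.max b 0) lu.
  move: ca bd; rewrite le_min ge_max => /andP[ca c0] /andP[bd d0].
  apply: le_trans (oint_mono ig g0 ca ab bd) _.
  have hW1 : isprim (fun x : R => x + lam * fl 1) (fun=> 1 : R) by move=> x y; rewrite oint_cst mul1r; ring.
  have := kato_line hf eps0 lam0 iw i1 hW hW1 vu (viscous1 eps lam hf f1) c0 d0.
  rewrite (@eq_oint_ae _ (fun x => `|w x - 1|) (fun x => 1 - w x) c d); first last.
  - move: w1; apply: filterS; [exact: (ae_filter_ringOfSetsType mu)|move=> x wx].
    by rewrite ler0_norm ?opprB // subr_le0.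
  - exact: locintB.
  - by apply: locint_abs; exact: locintB.
  have iu1 : locint (fun x => `|u x - 1|) by apply: locint_abs; exact: locintB.
  rewrite (ointD c d iu1 (locintB iu i1)) (ointB c d iu i1) (ointB c d i1 iw) !oint_cst -hW -hV.
  rewrite (ltr0_sg (_ : u d - 1 < 0)) ?subr_lt0 // (ltr0_sg (_ : u c - 1 < 0)) ?subr_lt0 //.
  lra.
have z : forall x, `|u x - 1| + (u x - 1) = 0.
  apply: continuous_oint0 => // a b; wlog ab : a b / a <= b => [hw|].
    have [/hw//|/ltW/hw h] := leP a b; by rewrite ointNN h oppr0.
  by apply/eqP; rewrite eq_le key //= oint_ge0.
by move=> x; have := z x; have := normr_ge0 (u x - 1); lra.
Qed.

Lemma viscous_contraction f fl fr L eps lam u1 u2 w1 w2 V1 V2 W1 W2 M :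
  split_flux f fl fr L -> 0 < eps -> 0 < lam -> locint w1 -> locint w2 ->
  isprim W1 w1 -> isprim W2 w2 ->
  viscous f eps lam W1 V1 u1 -> viscous f eps lam W2 V2 u2 ->
  decays V1 W1 -> decays V2 W2 ->
  (forall a b, a <= b -> oint (fun x => `|w1 x - w2 x|) a b <= M) ->
  forall a b, a <= b -> oint (fun x => `|u1 x - u2 x|) a b <= M.
Proof.
move=> hf eps0 lam0 iw1 iw2 hW1 hW2 v1 v2 dec1 dec2 hM a b ab.
have [cu1 _ _] := v1; have [cu2 _ _] := v2.
have iu1 := continuous_locint cu1; have iu2 := continuous_locint cu2.
apply/ler_addgt0Pl => e e0.
have e8 : 0 < e / 8 by rewrite divr_gt0.
have [c1 [d1 [ca1 bd1 hc1 hd1]]] := decays_ends (Num.min a 0) (Num.max b 0) dec1 e8.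
have [c2 [d2 [ca2 bd2 hc2 hd2]]] := decays_ends (Num.min a 0) (Num.max b 0) dec2 e8.
pose c := Num.min c1 c2; pose d := Num.max d1 d2.
have cc1 : c <= c1 by rewrite ge_min lexx.
have cc2 : c <= c2 by rewrite ge_min lexx orbT.
have dd1 : d1 <= d by rewrite le_max lexx.
have dd2 : d2 <= d by rewrite le_max lexx orbT.
move: ca1 bd1; rewrite le_min ge_max => /andP[ca c0] /andP[bd d0].
have ii : locint (fun x => `|u1 x - u2 x|) by apply: locint_abs; exact: locintB.
have c00 : c <= 0 by lra.
have d00 : 0 <= d by lra.
apply: le_trans (oint_mono ii (fun x => normr_ge0 _) (_ : c <= a) ab (_ : b <= d)) _; [lra|lra|].
have := kato_line hf eps0 lam0 iw1 iw2 hW1 hW2 v1 v2 c00 d00.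
have := hM c d ltac:(lra).
have bnd (p q : R) : `|p| <= e / 4 -> `|p * Num.sg q| <= e / 4.
  move=> hp; rewrite normrM -[leRHS]mulr1 ler_pM // normr_sg; by case: (_ != 0).
have zd : `|V1 d - W1 d - (V2 d - W2 d)| <= e / 4.
  by apply: le_trans (ler_normB _ _) _; have := hd1 d dd1; have := hd2 d dd2; lra.
have zc : `|V1 c - W1 c - (V2 c - W2 c)| <= e / 4.
  by apply: le_trans (ler_normB _ _) _; have := hc1 c cc1; have := hc2 c cc2; lra.
have := bnd _ (u1 d - u2 d) zd; have := bnd _ (u1 c - u2 c) zc.
rewrite !ler_norml => /andP[? ?] /andP[? ?]; lra.
Qed.

End AprioriBounds.

(** * Doubling of variables on a half-line *)


Section Doubling.
Context {R : realType}.
Implicit Types (u w V W K g : R -> R) (L eps lam eta a b c p r s x y : R).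

Definition left_cont K x := forall e, 0 < e -> exists2 r, 0 < r & forall s, x - r <= s <= x -> `|K s - K x| <= e.

Lemma continuous_left_cont K x : {for x, continuous K} -> left_cont K x.
Proof.
move=> cK e e0; have /cvgrPdist_le/(_ _ e0)[r /= r0 hr] := cK.
exists (r / 2); first by rewrite divr_gt0.
move=> s /andP[s1 s2]; rewrite distrC; apply: hr => /=.
by rewrite ger0_norm ?subr_ge0 //; lra.
Qed.

Lemma touch_left_slope V u x r c p : continuous u -> isprim V u -> 0 < r ->
  (forall s, x - r <= s <= x -> V s - V x <= p * (s - x) + c * (s - x) ^+ 2) -> p <= u x.
Proof.
move=> cu hV r0 h; rewrite leNgt; apply/negP => ux.
have e0 : 0 < (p - u x) / 2 by rewrite divr_gt0 // subr_gt0.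
have [d d0 hd] := continuous_left_cont (cu x) e0.
set e := (p - u x) / 2 in e0 hd.
have c1 : 0 < `|c| + 1 by have := normr_ge0 c; lra.
(* On this length u stays below p - e, while the parabola changes the mean slope by at most |c| t <=
   e / 2. *)
pose t := Num.min (Num.min d r) (e / (`|c| + 1) / 2).
have t0 : 0 < t by rewrite !lt_min d0 r0 /= divr_gt0 // divr_gt0.
have td : t <= d by rewrite !ge_min lexx.
have tr : t <= r by rewrite !ge_min lexx orbT.
have te : t <= e / (`|c| + 1) / 2 by rewrite !ge_min lexx !orbT.
have := h (x - t) ltac:(by apply/andP; split; lra).
have iu := continuous_locint cu.
have : oint u (x - t) x <= oint (fun=> p - e) (x - t) x.
  apply: oint_le => //; [exact: locint_cst|lra|move=> s /andP[s1 s2]].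
  have := hd s ltac:(by apply/andP; split; lra).
  by rewrite ler_norml => /andP[_]; rewrite /e; lra.
rewrite -hV oint_cst.
have -> : x - t - x = - t by ring.
have -> : x - (x - t) = t by ring.
rewrite sqrrN => h1 h2.
have h3 : e * t <= c * t ^+ 2 by lra.
have h4 : (`|c| + 1) * t <= e / 2.
  by move: te; rewrite [e / _ / 2]mulrAC ler_pdivlMr // [t * _]mulrC.
have h5 : c * t ^+ 2 <= `|c| * t ^+ 2 by rewrite ler_wpM2r ?sqr_ge0 // ler_norm.
nra.
Qed.

Lemma touch_right_slope V u x r c p : continuous u -> isprim V u -> 0 < r ->
  (forall s, x <= s <= x + r -> V s - V x <= p * (s - x) + c * (s - x) ^+ 2) -> u x <= p.
Proof.
move=> cu hV r0 h.
have cu' : continuous (fun s => - u (- s)).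
  by move=> s; apply: cvgN; apply: continuous_comp; [apply: cvgN; exact: cvg_id|exact: cu].
have hV' : isprim (fun s => V (- s)) (fun s => - u (- s)).
  move=> a b; rewrite ointN; last by apply: locint_reflect; exact: continuous_locint.
  by rewrite oint_reflect -?ointNN ?hV //; exact: continuous_locint.
have := @touch_left_slope _ _ (- x) r c (- p) cu' hV' r0 _.
rewrite opprK lerN2; apply => s /andP[s1 s2].
have := h (- s) ltac:(by apply/andP; split; lra).
by rewrite (_ : c * (- s - x) ^+ 2 = c * (s - - x) ^+ 2); [lra|ring].
Qed.

(* One-sided second-order condition: only the behaviour to the left of the touching
   point matters, which also covers boundary points and fluxes that jump to the right. *)
Lemma touch_left_curvature V u K x r c p : locint K -> continuous u -> isprim V u ->
  left_cont K x -> 0 < r ->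
  (forall s, x - r <= s <= x -> u x - u s = oint K s x) ->
  (forall s, x - r <= s <= x -> V s - V x <= p * (s - x) + c * (s - x) ^+ 2) ->
  u x = p -> K x <= 2 * c.
Proof.
move=> iK cu hV lK r0 hu h ux; rewrite leNgt; apply/negP => Kc.
have e0 : 0 < (K x - 2 * c) / 2 by rewrite divr_gt0 // subr_gt0.
have [d d0 hd] := lK _ e0.
set e := (K x - 2 * c) / 2 in e0 hd.
pose t := Num.min d r.
have t0 : 0 < t by rewrite !lt_min d0 r0.
have td : t <= d by rewrite !ge_min lexx.
have tr : t <= r by rewrite !ge_min lexx orbT.
have := h (x - t) ltac:(by apply/andP; split; lra).
have us s : x - t <= s <= x -> u s <= p - (2 * c + e) * (x - s).
  move=> /andP[s1 s2].
  have : oint (fun=> 2 * c + e) s x <= oint K s x.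
    apply: oint_le => //; [exact: locint_cst|move=> y /andP[y1 y2]].
    have := hd y ltac:(by apply/andP; split; lra).
    by rewrite ler_norml => /andP[+ _]; rewrite /e; lra.
  by rewrite oint_cst -hu ?ux; [lra|apply/andP; split; lra].
pose k := 2 * c + e.
have cl : continuous (fun s => p - k * (x - s)).
  move=> s; apply: cvgB; first exact: cvg_cst.
  by apply: cvgM; [exact: cvg_cst|apply: cvgB; [exact: cvg_cst|exact: cvg_id]].
have pl : isprim (fun s => p * s + k * (x - s) ^+ 2 / 2) (fun s => p - k * (x - s)).
  by apply: derive_isprim => // s; apply: is_derive_eq; rewrite /GRing.scale /=; field.
have : oint u (x - t) x <= oint (fun s => p - k * (x - s)) (x - t) x.
  apply: oint_le; [exact: continuous_locint|exact: continuous_locint|lra|exact: us].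
rewrite -hV -pl.
have -> : x - t - x = - t by ring.
have -> : x - (x - t) = t by ring.
have t2 : 0 < t ^+ 2 by rewrite exprn_gt0.
rewrite subrr sqrrN expr0n /= /k => h1 h2.
have : e * t ^+ 2 <= 0 by lra.
nra.
Qed.

(** A problem with a single flux on the left half-line, with no condition at 0; [profile_half_right]
    brings the right half-line to this form. V and u remain functions on the line, and only the
    equation is restricted. *)
Definition half_viscous g eps lam W V u :=
  [/\ continuous u, isprim V u, forall x, 0 <= u x <= 1, lim_l V 0 &
   forall a b, a <= b -> b <= 0 -> lam * eps * (u b - u a) = oint (fun x => V x - W x + lam * g (u x)) a b].

Lemma isprim01_le V u : continuous u -> isprim V u -> (forall x, 0 <= u x <= 1) ->
  forall a b, a <= b -> V a <= V b <= V a + (b - a).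
Proof.
move=> cu hV u01 a b ab; have iu := continuous_locint cu.
have := hV a b; have := oint_ge0 iu ab (fun x _ => proj1 (andP (u01 x))).
have := oint_le iu (locint_cst 1) ab (fun x _ => proj2 (andP (u01 x))).
rewrite oint_cst => h1 h2 h3; apply/andP; split; lra.
Qed.

Lemma lim_l0_ge0 V : (forall a b, a <= b -> V a <= V b) -> lim_l V 0 -> forall x, 0 <= V x.
Proof.
move=> nd lV x; rewrite leNgt; apply/negP => Vx.
have [X hX] := lV (- V x / 2) ltac:(by rewrite divr_gt0 // oppr_gt0).
have := hX (Num.min X x) ltac:(by rewrite ge_min lexx).
have := nd (Num.min X x) x ltac:(by rewrite ge_min lexx orbT).
by rewrite subr0 ler_norml => h /andP[h1 _]; lra.
Qed.

(** The viscosity subsolution inequality at a point touched from above: there V'' is at most 2 c and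
    equals (V - W + lam g(u)) / (lam eps). Only the left side of x enters, so x = 0 is allowed. *)
Lemma half_viscous_curvature g eps lam W V u x r c : 0 < eps -> 0 < lam -> continuous g -> continuous W ->
  half_viscous g eps lam W V u -> x <= 0 -> 0 < r ->
  (forall s, x - r <= s <= x -> V s - V x <= u x * (s - x) + c * (s - x) ^+ 2) ->
  V x <= W x - lam * g (u x) + lam * eps * (2 * c).
Proof.
move=> eps0 lam0 cg cW [cu hV u01 lV hu] x0 r0 h.
have le0 : 0 < lam * eps by rewrite mulr_gt0.
have cV := isprim_continuous (continuous_locint cu) hV.
have ck : continuous (fun x => V x - W x + lam * g (u x)).
  move=> y; apply: cvgD; first by apply: cvgB; [exact: cV|exact: cW].
  by apply: cvgM; [exact: cvg_cst|apply: continuous_comp; [exact: cu|exact: cg]].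
pose K y := (lam * eps)^-1 * (V y - W y + lam * g (u y)).
have cK : continuous K by move=> y; apply: cvgM; [exact: cvg_cst|exact: ck].
have := @touch_left_curvature V u K x r c (u x) (continuous_locint cK) cu hV (continuous_left_cont (cK x)) r0.
move=> /(_ _ h erefl)/wrap[].
  move=> s /andP[_ sx]; rewrite ointZ -?hu //; last exact: continuous_locint.
  by field; rewrite !gt_eqF.
by rewrite /K ler_pdivrMl //; lra.
Qed.

Lemma half_viscous_curvatureN g eps lam W V u x r c : 0 < eps -> 0 < lam -> continuous g -> continuous W ->
  half_viscous g eps lam W V u -> x <= 0 -> 0 < r ->
  (forall s, x - r <= s <= x -> V x - V s <= - u x * (s - x) + c * (s - x) ^+ 2) ->
  W x - lam * g (u x) - lam * eps * (2 * c) <= V x.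
Proof.
move=> eps0 lam0 cg cW [cu hV u01 lV hu] x0 r0 h.
have le0 : 0 < lam * eps by rewrite mulr_gt0.
have cV := isprim_continuous (continuous_locint cu) hV.
have ck : continuous (fun x => V x - W x + lam * g (u x)).
  move=> y; apply: cvgD; first by apply: cvgB; [exact: cV|exact: cW].
  by apply: cvgM; [exact: cvg_cst|apply: continuous_comp; [exact: cu|exact: cg]].
pose K y := - (lam * eps)^-1 * (V y - W y + lam * g (u y)).
have cK : continuous K by move=> y; apply: cvgM; [exact: cvg_cst|exact: ck].
have cNu : continuous (fun x => - u x) by move=> y; apply: cvgN; exact: cu.
have hNV : isprim (fun x => - V x) (fun x => - u x).
  by move=> a b; rewrite ointN -?hV; [ring|exact: continuous_locint].
have := @touch_left_curvature _ _ K x r c (- u x) (continuous_locint cK) cNu hNV (continuous_left_cont (cK x)) r0.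
move=> /(_ _)/wrap[].
  move=> s /andP[_ sx]; rewrite ointZ -?hu //; last exact: continuous_locint.
  by field; rewrite !gt_eqF.
move=> /(_ _ erefl)/wrap[]; first by move=> s /h; lra.
by rewrite /K mulNr -mulrN ler_pdivrMl //; lra.
Qed.

(** The tilt a in the doubled function V1(x) - V2(y) - (x - y)^2 / (2 eta) - a (x - y) serves the
    boundary. With [a = u1 0] and ordered slopes, the one-sided slope inequalities become equalities
    when the maximum lies at x = 0 or y = 0. With ordered values and a = 0, a maximum at 0 is too
    small to contradict the claim. In both cases the two slopes coincide at the maximum and the flux
    terms cancel. *)
Lemma half_viscous_compare g L eps1 eps2 lam eta E a W V1 V2 u1 u2 :
  (forall s t, `|g s - g t| <= L * `|s - t|) ->
  (forall x y, `|W x - W y| <= `|x - y|) ->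
  0 < eps1 -> 0 < eps2 -> 0 < lam -> 0 < eta -> 0 <= E ->
  half_viscous g eps1 lam W V1 u1 -> half_viscous g eps2 lam W V2 u2 ->
  (a = u1 0 /\ u1 0 <= u2 0) \/ (a = 0 /\ V1 0 <= V2 0 + E) ->
  forall x, x <= 0 -> V1 x - V2 x <= E + 2 * eta + lam * (eps1 + eps2) / eta.
Proof.
move=> gL W1 eps10 eps20 lam0 eta0 E0 hv1 hv2 bc xh xh0.
rewrite leNgt; apply/negP => hM; set M := V1 xh - V2 xh in hM.
have [cu1 hV1 u101 lV1 hu1] := hv1; have [cu2 hV2 u201 lV2 hu2] := hv2.
have cg := lipschitz_continuous gL.
have cW : continuous W by apply: (@lipschitz_continuous _ _ 1) => s t; rewrite mul1r.
have cV1 := isprim_continuous (continuous_locint cu1) hV1.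
have cV2 := isprim_continuous (continuous_locint cu2) hV2.
have m1 := isprim01_le cu1 hV1 u101; have m2 := isprim01_le cu2 hV2 u201.
have nd1 x y : x <= y -> V1 x <= V1 y by move=> /m1/andP[].
have nd2 x y : x <= y -> V2 x <= V2 y by move=> /m2/andP[].
have V10 := lim_l0_ge0 nd1 lV1; have V20 := lim_l0_ge0 nd2 lV2.
have a01 : 0 <= a <= 1 by case: bc => -[-> _] //; rewrite lexx ler01.
have /andP[a0 a1] := a01.
pose Phi (z : R * R) := V1 z.1 - V2 z.2 - (z.1 - z.2) ^+ 2 / (2 * eta) - a * (z.1 - z.2).
(* Left of N the mass V1 is at most eta / 2; this confines the maximum to a compact square and keeps
   it off the edges at N. *)
have [X hX] := lV1 (eta / 2) ltac:(by rewrite divr_gt0).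
pose N := Num.min (Num.min X xh) 0.
have NX : N <= X by rewrite !ge_min lexx.
have Nxh : N <= xh by rewrite !ge_min lexx orbT.
have N0 : N <= 0 by rewrite ge_min lexx orbT.
have VN : V1 N <= eta / 2 by have := hX N NX; rewrite subr0 ler_norml => /andP[].
clearbody N.
have cPhi : continuous Phi.
  move=> z.
  have c1 : (fun z : R * R => z.1) y @[y --> z] --> z.1 by exact: cvg_fst.
  have c2 : (fun z : R * R => z.2) y @[y --> z] --> z.2 by exact: cvg_snd.
  apply: cvgB; [apply: cvgB; [apply: cvgB|]|].
  - by apply: continuous_comp; [exact: c1|exact: cV1].
  - by apply: continuous_comp; [exact: c2|exact: cV2].
  - apply: cvgM; last exact: cvg_cst.
    by apply: cvgM; apply: cvgB.
  - by apply: cvgM; [exact: cvg_cst|apply: cvgB].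
have [|||[x y]] := @compact_EVT_max _ R Phi (`[N, 0]%classic `*` `[N, 0]%classic).
- by exists (xh, xh) => /=; rewrite !in_itv /= Nxh xh0.
- by apply: compact_setX; exact: segment_compact.
- exact: continuous_subspaceT.
rewrite inE /= !in_itv /= => -[/andP[Nx x0] /andP[Ny y0]] hmax.
have PM : M <= Phi (x, y).
  have := hmax (xh, xh); rewrite inE /= !in_itv /= Nxh xh0 => /(_ (conj isT isT)).
  by rewrite /Phi /= subrr expr0n /= mul0r mulr0 !subr0.
pose t := x - y; have Et : t = x - y by [].
have ePhi : Phi (x, y) = V1 x - V2 y - t ^+ 2 / (2 * eta) - a * t by [].
clearbody t.
have extra : 0 < lam * (eps1 + eps2) / eta by rewrite divr_gt0 // mulr_gt0 // addr_gt0.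
have quad k : k * t - t ^+ 2 / (2 * eta) <= k ^+ 2 * eta / 2.
  have : 0 <= (t - k * eta) ^+ 2 / (2 * eta) by rewrite divr_ge0 ?sqr_ge0 // mulr_ge0 // ltW.
  have -> : (t - k * eta) ^+ 2 / (2 * eta) = t ^+ 2 / (2 * eta) - k * t + k ^+ 2 * eta / 2.
    by field; rewrite gt_eqF.
  lra.
have a2 : a ^+ 2 * eta <= eta by rewrite ger_pMl // expr_le1.
have b2 : (1 - a) ^+ 2 * eta <= eta by rewrite ger_pMl // expr_le1 //; clear -a0 a1; lra.
have xN : N < x.
  rewrite lt_neqAle Nx andbT; apply/eqP => Nxe.
  have := quad (- a); rewrite sqrrN; have := V20 y; rewrite ePhi -Nxe in PM; lra.
(* If y = N, the bound u1 <= 1 gives V1(x) <= eta / 2 + t, and the penalty absorbs (1 - a) t up to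
   eta / 2. *)
have yN : N < y.
  rewrite lt_neqAle Ny andbT; apply/eqP => Nye.
  have yx : y <= x by rewrite -Nye ltW.
  have := quad (1 - a); have := V20 y; have /andP[_] := m1 _ _ yx.
  rewrite -Et ePhi -Nye in PM *; lra.
have maxx s : N <= s -> s <= 0 -> V1 s - V1 x <= (t / eta + a) * (s - x) + (2 * eta)^-1 * (s - x) ^+ 2.
  move=> Ns s0; have := hmax (s, y); rewrite inE /= !in_itv /= Ns s0 Ny y0 => /(_ (conj isT isT)).
  rewrite ePhi /Phi /= => h.
  have -> : (t / eta + a) * (s - x) + (2 * eta)^-1 * (s - x) ^+ 2 =
     (s - y) ^+ 2 / (2 * eta) - t ^+ 2 / (2 * eta) + a * (s - x) by rewrite Et; field; rewrite gt_eqF.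
  by move: h; rewrite Et; clear; lra.
have maxy s : N <= s -> s <= 0 -> V2 y - V2 s <= - (t / eta + a) * (s - y) + (2 * eta)^-1 * (s - y) ^+ 2.
  move=> Ns s0; have := hmax (x, s); rewrite inE /= !in_itv /= Ns s0 Nx x0 => /(_ (conj isT isT)).
  rewrite ePhi /Phi /= => h.
  have -> : - (t / eta + a) * (s - y) + (2 * eta)^-1 * (s - y) ^+ 2 =
     (x - s) ^+ 2 / (2 * eta) - t ^+ 2 / (2 * eta) - a * (s - y) by rewrite Et; field; rewrite gt_eqF.
  by move: h; rewrite Et; clear; lra.
have rx : 0 < x - N by rewrite subr_gt0.
have ry : 0 < y - N by rewrite subr_gt0.
have lx s : x - (x - N) <= s <= x -> V1 s - V1 x <= (t / eta + a) * (s - x) + (2 * eta)^-1 * (s - x) ^+ 2.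
  by move=> /andP[s1 s2]; apply: maxx; [clear -s1 Nx|clear -s2 x0]; lra.
have ly s : y - (y - N) <= s <= y -> V2 y - V2 s <= - (t / eta + a) * (s - y) + (2 * eta)^-1 * (s - y) ^+ 2.
  by move=> /andP[s1 s2]; apply: maxy; [clear -s1 Ny|clear -s2 y0]; lra.
have cNu2 : continuous (fun x => - u2 x) by move=> z; apply: cvgN; exact: cu2.
have hNV2 : isprim (fun x => - V2 x) (fun x => - u2 x).
  by move=> p q; rewrite ointN -?hV2; [ring|exact: continuous_locint].
have ly' s : y - (y - N) <= s <= y -> - V2 s - - V2 y <= - (t / eta + a) * (s - y) + (2 * eta)^-1 * (s - y) ^+ 2.
  by move=> /ly; clear; lra.
have p1 := touch_left_slope cu1 hV1 rx lx.
have p2 := touch_left_slope cNu2 hNV2 ry ly'.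
have q1 : x < 0 -> u1 x <= t / eta + a.
  move=> xneg; apply: (@touch_right_slope V1 u1 x (- x) (2 * eta)^-1) => //; first by rewrite oppr_gt0.
  by move=> s /andP[s1 s2]; apply: maxx; [clear -s1 Nx|clear -s2]; lra.
have q2 : y < 0 -> t / eta + a <= u2 y.
  move=> yneg; rewrite -lerN2.
  apply: (@touch_right_slope (fun x => - V2 x) (fun x => - u2 x) y (- y) (2 * eta)^-1) => //; first by rewrite oppr_gt0.
  move=> s /andP[s1 s2]; have Ns : N <= s by clear -s1 Ny; lra.
  have s0 : s <= 0 by clear -s2 y0; lra.
  by have := maxy s Ns s0; clear; lra.
(* Interior points give equality of slopes directly. At x = 0, [p1] reads a >= t / eta + a with t >=
   0, so t = 0. At y = 0, [p2] reads t / eta + a <= u2 0 in reverse, with t <= 0 and a <= u2 0, so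
   all are equal. *)
have [E1 E2] : u1 x = t / eta + a /\ u2 y = t / eta + a.
  case: bc => [[ea u12]|[ea V12]].
  - have sx : x = 0 -> t / eta = 0.
      move=> x00; move: p1; rewrite x00 ea => p1.
      have h : t / eta <= 0 by clear -p1; lra.
      have : 0 <= t / eta by apply: divr_ge0 (ltW eta0); rewrite Et x00; clear -y0; lra.
      by clear -h; lra.
    have sy : y = 0 -> t / eta = 0 /\ a = u2 0.
      move=> y00; move: p2; rewrite y00 => p2.
      have ht : t / eta <= 0.
        by apply: mulr_le0_ge0; [rewrite Et y00 subr0|rewrite invr_ge0 ltW].
      by rewrite lerN2 in p2; rewrite ea in p2 *; clear -p2 u12 ht; split; lra.
    split.
      have [xneg|xpos|x00] := ltgtP x 0; [|by move: xpos; rewrite ltNge x0|].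
        by apply/eqP; rewrite eq_le p1 q1.
      by rewrite sx // x00 ea add0r.
    have [yneg|ypos|y00] := ltgtP y 0; [|by move: ypos; rewrite ltNge y0|].
      by apply/eqP; rewrite eq_le q2 // andbT -lerN2.
    by have [-> ->] := sy y00; rewrite y00 add0r.
  - rewrite ePhi ea mul0r subr0 in PM.
    have xneg : x < 0.
      rewrite lt_neqAle x0 andbT; apply/eqP => x00.
      have := quad 1; have /andP[_] := m2 _ _ y0; rewrite x00 in PM Et; move: PM hM extra eta0 V12; clear -Et; nra.
    have yneg : y < 0.
      rewrite lt_neqAle y0 andbT; apply/eqP => y00.
      have := quad 0; have := nd1 _ _ x0; rewrite y00 in PM Et; move: PM hM extra eta0 V12; clear -Et; nra.
    split; first by apply/eqP; rewrite eq_le p1 q1.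
    by apply/eqP; rewrite eq_le q2 // andbT -lerN2.
have C1 := half_viscous_curvature eps10 lam0 cg cW hv1 x0 rx _ (c := (2 * eta)^-1).
have C2 := half_viscous_curvatureN eps20 lam0 cg cW hv2 y0 ry _ (c := (2 * eta)^-1).
move: C1 C2; rewrite E1 E2 => /(_ lx) C1 /(_ ly) C2.
have e2 : 2 * (2 * eta)^-1 = eta^-1 by field; rewrite gt_eqF.
rewrite e2 in C1 C2.
(* Both the common slope t / eta + a and a lie in [0, 1], so |t| <= eta. This bounds the difference
   of W at the two points and the tilt by eta each, whence 2 eta. *)
have tb : `|t / eta| <= 1.
  have /andP[v0 v1] := u101 x; rewrite E1 in v0 v1.
  by rewrite ler_norml; clear -v0 v1 a0 a1; apply/andP; split; lra.
have te : `|t| <= eta.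
  by move: tb; rewrite normrM normfV (gtr0_norm eta0) ler_pdivrMr // mul1r.
have := W1 x y; rewrite -Et => hW.
have := ler_norm (W x - W y) => hW'.
have : - (a * t) <= eta.
  have nt : - t <= eta by apply: le_trans te; rewrite -normrN ler_norm.
  by clear -nt a0 a1 eta0; have [t0|t0] := leP 0 t; nra.
have : 0 <= t ^+ 2 / (2 * eta) by rewrite divr_ge0 ?sqr_ge0 // mulr_ge0 // ltW.
move: PM hM; rewrite ePhi.
have -> : lam * (eps1 + eps2) / eta = lam * eps1 * eta^-1 + lam * eps2 * eta^-1 by ring.
clear -C1 C2 hW hW' te E0; lra.
Qed.

End Doubling.


(** * Uniform closeness of the primitives for two viscosities *)

Section ProfileComparison.
Context {R : realType}.
Implicit Types (f : R -> R -> R) (fl fr u w V W g : R -> R) (L eps lam eta a b x m : R).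
Notation mu := (@lebesgue_measure R).

Definition profile f eps lam W V u :=
  [/\ viscous f eps lam W V u, decays V W, forall x, 0 <= u x <= 1 & l1 u].

(* A primitive W of some w with 0 <= w <= 1 almost everywhere. *)
Definition datum w W := [/\ locint w, isprim W w & forall a b, a <= b -> 0 <= W b - W a <= b - a].

(** Truncating w to [0, 1] changes it only on a null set and makes the bounds pointwise. *)
Lemma ae_oint_bounds w a b : locint w -> {ae mu, forall x, 0 <= w x <= 1} -> a <= b ->
  0 <= oint w a b <= b - a.
Proof.
move=> iw w01 ab; pose v x := Num.max 0 (Num.min (w x) 1).
have vw : {ae mu, forall x, v x = w x}.
  move: w01; apply: filterS; first exact: (ae_filter_ringOfSetsType mu).
  by move=> x /andP[w0 w1]; rewrite /v min_l // max_r.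
have v01 x : 0 <= v x <= 1 by rewrite /v le_max lexx ge_max ler01 ge_min lexx orbT.
have iv : locint v.
  apply: (@bounded_locint _ _ 1).
    apply: measurable_maxr; first exact: measurable_cst.
    by apply: measurable_minr; [exact: locint_meas|exact: measurable_cst].
  by move=> x; have /andP[v0 v1] := v01 x; rewrite ger0_norm.
rewrite -(eq_oint_ae a b iv iw vw); apply/andP; split.
  by apply: oint_ge0 => // x _; have /andP[] := v01 x.
have -> : b - a = oint (fun=> 1) a b by rewrite oint_cst mul1r.
by apply: oint_le => //; [exact: locint_cst|move=> x _; have /andP[] := v01 x].
Qed.

Lemma ae_datum w W : locint w -> isprim W w -> {ae mu, forall x, 0 <= w x <= 1} -> datum w W.
Proof. by move=> iw hW w01; split => // a b ab; rewrite hW; exact: ae_oint_bounds. Qed.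

Lemma datum_lip w W a b : datum w W -> `|W a - W b| <= `|a - b|.
Proof.
move=> hw; wlog ab : a b / a <= b => [h|].
  have [/h//|/ltW/h] := leP a b; by rewrite distrC (distrC b).
have [_ _ /(_ _ _ ab)/andP[h1 h2]] := hw.
by rewrite distrC ger0_norm // distrC ger0_norm // subr_ge0.
Qed.

Lemma profile_half_left f fl fr L eps lam w W V u : split_flux f fl fr L ->
  datum w W -> profile f eps lam W V u -> half_viscous fl eps lam W V u.
Proof.
move=> hf [iw hW _] [[cu hV hu] [lV _ _] u01 _]; split => // a b ab b0.
have iu := continuous_locint cu.
have cV := isprim_continuous iu hV; have cW := isprim_continuous iw hW.
have [hfe hl _ _ _] := hf.
rewrite mulrBr hu; apply: eq_oint => //.
- apply: locintD; first by apply: locintB; exact: continuous_locint.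
  by apply: locintZ; exact: split_flux_locint hf iu.
- apply: locintD; first by apply: locintB; exact: continuous_locint.
  apply: locintZ; apply: continuous_locint => x; apply: continuous_comp; first exact: cu.
  exact: (lipschitz_continuous hl).
- by move=> x /andP[_ xb]; rewrite hfe (le_trans xb b0).
Qed.

(** The mass is counted from the right: [m - V (- x)] vanishes at -oo and has slope u(-x) >= 0. The
    reflection changes the sign of the flux and exchanges upper and lower bounds for V, but not for
    u. *)
Lemma profile_half_right f fl fr L eps lam w W V u m : split_flux f fl fr L ->
  datum w W -> profile f eps lam W V u -> lim_r V m ->
  half_viscous (fun t => - fr t) eps lam (fun x => m - W (- x)) (fun x => m - V (- x)) (fun x => u (- x)).
Proof.
move=> hf [iw hW _] [[cu hV hu] _ u01 _] hm.
have iu := continuous_locint cu.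
have cV := isprim_continuous iu hV; have cW := isprim_continuous iw hW.
have [hfe _ hr _ _] := hf.
have cfu : continuous (fun x => fr (u x)).
  by move=> x; apply: continuous_comp; [exact: cu|exact: (lipschitz_continuous hr)].
split.
- by move=> x; apply: continuous_comp; [apply: cvgN; exact: cvg_id|exact: cu].
- by move=> a b; rewrite oint_reflect // -hV; ring.
- by move=> x; exact: u01.
- apply/lim_l_reflect => e e0; have [X hX] := hm e e0; exists X => x /hX.
  by rewrite opprK subr0 distrC.
- move=> a b ab b0.
  have -> : lam * eps * (u (- b) - u (- a)) = - (lam * eps * u (- a) - lam * eps * u (- b)) by ring.
  have iV := continuous_locint cV; have iW := continuous_locint cW.
  have ik : locint (fun x => V x - W x + lam * fr (u x)).
    by apply: locintD; [exact: locintB|apply: locintZ; exact: continuous_locint].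
  rewrite hu (@eq_oint_oc _ _ (fun x => V x - W x + lam * fr (u x))); first last.
  + by move=> x bx _; rewrite hfe leNgt (_ : 0 < x) //; apply: le_lt_trans bx; rewrite oppr_ge0.
  + by rewrite lerN2.
  + exact: ik.
  + by apply: locintD; [exact: locintB|apply: locintZ; exact: split_flux_locint hf iu].
  rewrite -oint_reflect // -ointN; last exact: (locint_reflect ik).
  by congr (oint _ a b); apply/funext => x; ring.
Qed.

Lemma profile_lim_r f eps lam W V u : profile f eps lam W V u -> exists2 m, lim_r V m & lim_r W m.
Proof.
move=> [[cu hV _] [_ _ hz] _ lu].
have [c hc] := l1_prim_lim_r lu.
have hVc : lim_r V (c + V 0).
  move=> e e0; have [X hX] := hc e e0; exists X => x /hX.
  by have := hV 0 x; rewrite /oint prim0 => h; rewrite (_ : V x - _ = prim u x - c) //; lra.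
exists (c + V 0) => //.
have := lim_r_comb 1 (-1) hVc hz; rewrite mul1r mulr0 addr0.
by rewrite (_ : (fun x => _) = W) //; apply/funext => x; ring.
Qed.

(** The comparison is run twice. With E = 0 and the ordering of the slopes it yields |V1 0 - V2 0|
    <= B; with E = B and this bound as boundary data it yields 2 B on both half-lines. *)
Lemma profile_close f fl fr L eps1 eps2 lam eta w W V1 V2 u1 u2 :
  split_flux f fl fr L -> 0 < eps1 -> 0 < eps2 -> 0 < lam -> 0 < eta ->
  datum w W -> profile f eps1 lam W V1 u1 -> profile f eps2 lam W V2 u2 ->
  forall x, `|V1 x - V2 x| <= 2 * (2 * eta + lam * (eps1 + eps2) / eta).
Proof.
move=> hf e10 e20 lam0 eta0 hw p1 p2.
have [m hV1 hW1] := profile_lim_r p1; have [m2 hV2 hW2] := profile_lim_r p2.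
have mm := lim_r_uniq hW1 hW2; rewrite -{m2 hW2}mm in hV2.
have l1_ := profile_half_left hf hw p1; have l2 := profile_half_left hf hw p2.
have r1 := profile_half_right hf hw p1 hV1; have r2 := profile_half_right hf hw p2 hV2.
have [_ hl hr _ _] := hf.
have hr' s t : `|- fr s - - fr t| <= L * `|s - t| by rewrite -opprD normrN; exact: hr.
have Wl x y : `|W x - W y| <= `|x - y| by exact: datum_lip hw.
have Wr x y : `|(m - W (- x)) - (m - W (- y))| <= `|x - y|.
  have := Wl (- y) (- x); rewrite (_ : m - _ - _ = W (- y) - W (- x)); last ring.
  by rewrite (_ : - y - - x = x - y) //; ring.
set B := 2 * eta + lam * (eps1 + eps2) / eta.
have B0 : 0 <= B by rewrite addr_ge0 ?mulr_ge0 ?invr_ge0 ?addr_ge0 // ltW.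
have Bsym : 2 * eta + lam * (eps2 + eps1) / eta = B by rewrite (addrC eps2).
have left12 a (E : R) : 0 <= E -> (a = u1 0 /\ u1 0 <= u2 0) \/ (a = 0 /\ V1 0 <= V2 0 + E) ->
    forall x, x <= 0 -> V1 x - V2 x <= E + B.
  move=> E0 bc x x0; rewrite addrA.
  exact: (half_viscous_compare hl Wl e10 e20 lam0 eta0 E0 l1_ l2 bc x0).
have left21 a (E : R) : 0 <= E -> (a = u2 0 /\ u2 0 <= u1 0) \/ (a = 0 /\ V2 0 <= V1 0 + E) ->
    forall x, x <= 0 -> V2 x - V1 x <= E + B.
  move=> E0 bc x x0; rewrite -Bsym addrA.
  exact: (half_viscous_compare hl Wl e20 e10 lam0 eta0 E0 l2 l1_ bc x0).
have right12 a (E : R) : 0 <= E -> (a = u1 0 /\ u1 0 <= u2 0) \/ (a = 0 /\ V2 0 <= V1 0 + E) ->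
    forall x, 0 <= x -> V2 x - V1 x <= E + B.
  move=> E0 bc x x0; rewrite addrA.
  have := @half_viscous_compare _ _ _ _ _ _ _ _ a _ _ _ _ _ hr' Wr e10 e20 lam0 eta0 E0 r1 r2.
  rewrite oppr0 => /(_ _ (- x))/wrap[]; first by case: bc => -[-> h]; [left|right; split => //; lra].
  by rewrite oppr_le0 opprK => /(_ x0); lra.
have right21 a (E : R) : 0 <= E -> (a = u2 0 /\ u2 0 <= u1 0) \/ (a = 0 /\ V1 0 <= V2 0 + E) ->
    forall x, 0 <= x -> V1 x - V2 x <= E + B.
  move=> E0 bc x x0; rewrite -Bsym addrA.
  have := @half_viscous_compare _ _ _ _ _ _ _ _ a _ _ _ _ _ hr' Wr e20 e10 lam0 eta0 E0 r2 r1.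
  rewrite oppr0 => /(_ _ (- x))/wrap[]; first by case: bc => -[-> h]; [left|right; split => //; lra].
  by rewrite oppr_le0 opprK => /(_ x0); lra.
clear l1_ l2 r1 r2 hr hr' hl Wl Wr p1 p2 hV1 hV2 hW1.
have z0 : `|V1 0 - V2 0| <= B.
  rewrite ler_norml; have [u12|/ltW u21] := leP (u1 0) (u2 0).
  - have h1 := left12 _ _ (lexx 0) (or_introl (conj erefl u12)) _ (lexx 0).
    have h2 := right12 _ _ (lexx 0) (or_introl (conj erefl u12)) _ (lexx 0).
    by rewrite !add0r in h1 h2; apply/andP; split; lra.
  - have h1 := left21 _ _ (lexx 0) (or_introl (conj erefl u21)) _ (lexx 0).
    have h2 := right21 _ _ (lexx 0) (or_introl (conj erefl u21)) _ (lexx 0).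
    by rewrite !add0r in h1 h2; apply/andP; split; lra.
move: z0; rewrite ler_norml => /andP[z1 z2] x; rewrite ler_norml.
have k1 : V1 0 <= V2 0 + B by lra.
have k2 : V2 0 <= V1 0 + B by lra.
have [x0|/ltW x0] := leP x 0.
- have h1 := left12 _ _ B0 (or_intror (conj erefl k1)) _ x0.
  have h2 := left21 _ _ B0 (or_intror (conj erefl k2)) _ x0.
  by apply/andP; split; lra.
- have h1 := right12 _ _ B0 (or_intror (conj erefl k2)) _ x0.
  have h2 := right21 _ _ B0 (or_intror (conj erefl k1)) _ x0.
  by apply/andP; split; lra.
Qed.

End ProfileComparison.

(** * Translates and L1 compactness *)


Section TranslationEstimates.
Context {R : realType}.
Implicit Types (f : R -> R -> R) (fl fr u w V W g : R -> R) (L eps lam a b x s h K C e : R).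
Notation mu := (@lebesgue_measure R).

Lemma measurable_indic_itv a b : measurable_fun [set: R] (\1_(`[a, b]%classic : set R) : R -> R).
Proof. exact: measurable_indic. Qed.

Lemma integral_indic_oint (k : R -> R) a b : locint k -> a <= b ->
  (\int[mu]_x (k x * \1_(`[a, b]%classic : set R) x)%:E = (oint k a b)%:E)%E.
Proof.
move=> ik ab; rewrite (ointE ik ab) /Rintegral fineK.
  rewrite [RHS]integral_mkcond; apply: eq_integral => x _; rewrite patchE indicE.
  by case: ifP => _; rewrite ?mulr1 ?mulr0.
by apply: integrable_fin_num; [exact: measurable_itv|exact: locint_itv].
Qed.

(** The difference quotient is the mean of u(x - s) over 0 <= s <= h, so u minus the quotient is the
    mean of u(x) - u(x - s), and Tonelli exchanges the integrals in x and s. The indicators in [P]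
    allow integration over the whole plane. *)
Lemma average_bound u V K h C : continuous u -> isprim V u -> K <= 0 -> 0 < h ->
  (forall s, 0 <= s <= h -> oint (fun x => `|u x - u (x - s)|) K 0 <= C) ->
  oint (fun x => `|u x - (V x - V (x - h)) / h|) K 0 <= C.
Proof.
move=> cu hV K0 h0 hC.
have iu := continuous_locint cu; have cV := isprim_continuous iu hV.
have cus s : continuous (fun x => u (x - s)).
  move=> x; apply: continuous_comp; last exact: cu.
  by apply: cvgB; [exact: cvg_id|exact: cvg_cst].
have cux x : continuous (fun s => u (x - s)).
  move=> s; apply: continuous_comp; last exact: cu.
  by apply: cvgB; [exact: cvg_cst|exact: cvg_id].
have cd s : continuous (fun x => `|u x - u (x - s)|).
  by move=> x; apply: cvg_norm; apply: cvgB; [exact: cu|exact: cus].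
have cdx x : continuous (fun s => `|u x - u (x - s)|).
  by move=> s; apply: cvg_norm; apply: cvgB; [exact: cvg_cst|exact: cux].
pose D x := `|u x - (V x - V (x - h)) / h|.
have cD : continuous D.
  move=> x; apply: cvg_norm; apply: cvgB; first exact: cu.
  apply: cvgM; last exact: cvg_cst.
  apply: cvgB; first exact: cV.
  apply: continuous_comp; last exact: cV.
  by apply: cvgB; [exact: cvg_id|exact: cvg_cst].
have Dx x : h * D x <= oint (fun s => `|u x - u (x - s)|) 0 h.
  have -> : h * D x = `|oint (fun s => u x - u (x - s)) 0 h|.
    rewrite ointB; [|exact: locint_cst|exact: continuous_locint].
    rewrite oint_cst subr0.
    have -> : oint (fun s => u (x - s)) 0 h = V x - V (x - h).
      have := oint_reflect 0 h (locint_shift x iu); rewrite oint_shift // oppr0 add0r.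
      rewrite -hV (_ : - h + x = x - h); last ring.
      by move=> <-; congr (oint _ 0 h); apply/funext => s; rewrite addrC.
    rewrite /D -{1}(gtr0_norm h0) -normrM; congr (`|_|).
    by field; rewrite gt_eqF.
  by apply: oint_abs; [apply: locintB; [exact: locint_cst|exact: continuous_locint]|exact: ltW].
pose P (z : R * R) : R := `|u z.1 - u (z.1 - z.2)| * (\1_(`[K, 0]%classic : set R) z.1 * \1_(`[0, h]%classic : set R) z.2).
have mu_u : measurable_fun setT u by exact: continuous_measurable_fun.
have mP : measurable_fun [set: (measurableTypeR R * measurableTypeR R)%type] P.
  apply: measurable_funM; last first.
    apply: measurable_funM.
      by apply: measurableT_comp; [exact: measurable_indic_itv|exact: measurable_fst].
    by apply: measurableT_comp; [exact: measurable_indic_itv|exact: measurable_snd].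
  apply: measurableT_comp => //; apply: measurable_funB.
    by apply: measurableT_comp; [exact: mu_u|exact: measurable_fst].
  apply: measurableT_comp; first exact: mu_u.
  by apply: measurable_funB; [exact: measurable_fst|exact: measurable_snd].
have P0 z : (0 <= (P z)%:E)%E by rewrite lee_fin mulr_ge0 // mulr_ge0 // indicE.
have mEP : measurable_fun [set: (measurableTypeR R * measurableTypeR R)%type] (EFin \o P) by exact/measurable_EFinP.
have in1 x : (\int[mu]_s (P (x, s))%:E = (oint (fun s => `|u x - u (x - s)|) 0 h * \1_(`[K, 0]%classic : set R) x)%:E)%E.
  rewrite mulrC -(ointZ _ _ _ (continuous_locint (cdx x))).
  rewrite -(integral_indic_oint (locintZ _ (continuous_locint (cdx x))) (ltW h0)).
  by apply: eq_integral => s _; congr EFin; rewrite /P /=; ring.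
have in2 s : (\int[mu]_x (P (x, s))%:E = (oint (fun x => `|u x - u (x - s)|) K 0 * \1_(`[0, h]%classic : set R) s)%:E)%E.
  rewrite mulrC -(ointZ _ _ _ (continuous_locint (cd s))).
  rewrite -(integral_indic_oint (locintZ _ (continuous_locint (cd s))) K0).
  by apply: eq_integral => x _; congr EFin; rewrite /P /=; ring.
have l1 : ((h * oint D K 0)%:E <= \int[mu]_x \int[mu]_s (EFin \o P) (x, s))%E.
  rewrite -(ointZ _ _ _ (continuous_locint cD)).
  rewrite -(integral_indic_oint (locintZ _ (continuous_locint cD)) K0).
  apply: ge0_le_integral.
  - exact: measurableT.
  - move=> x _; rewrite lee_fin; apply: mulr_ge0; last by rewrite indicE ler0n.
    by apply: mulr_ge0; [exact: ltW|exact: normr_ge0].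
  - apply/measurable_EFinP; apply: measurable_funM; last exact: measurable_indic_itv.
    exact: (locint_meas (locintZ _ (continuous_locint cD))).
  - exact: (measurable_fun_fubini_tonelli_F (m2 := mu) (EFin \o P) mEP P0).
  - move=> x _; rewrite in1 lee_fin; apply: ler_wpM2r; [by rewrite indicE ler0n|exact: Dx].
have C0 : 0 <= C.
  apply: le_trans (hC 0 _); last by rewrite lexx ltW.
  by apply: oint_ge0; [exact: continuous_locint|exact: K0|].
have l2 : (\int[mu]_s \int[mu]_x (EFin \o P) (x, s) <= (h * C)%:E)%E.
  have -> : h * C = oint (fun=> C) 0 h by rewrite oint_cst subr0 mulrC.
  rewrite -(integral_indic_oint (locint_cst C) (ltW h0)); apply: ge0_le_integral.
  - exact: measurableT.
  - by move=> s _; apply: integral_ge0 => x _; exact: P0.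
  - exact: (measurable_fun_fubini_tonelli_G (m1 := mu) (EFin \o P) mEP P0).
  - by apply/measurable_EFinP; apply: measurable_funM; [exact: measurable_cst|exact: measurable_indic_itv].
  - move=> s _; rewrite in2 lee_fin indicE.
    case: (boolP (s \in _)) => [|_]; last by rewrite !mulr0.
    rewrite !mulr1 inE /= in_itv /=; exact: hC.
have := le_trans l1 (le_trans (_ : _ <= _)%E l2); rewrite (fubini_tonelli (m1 := mu) (m2 := mu) (EFin \o P) mEP P0) => /(_ (lexx _)).
by rewrite lee_fin ler_pM2l.
Qed.

(** On the compact set of pairs with |k x - k y| >= e the distance |x - y| attains a minimum, which
    is positive; half of it serves as d. *)
Lemma uniform_continuous_itv (k : R -> R) a b e : continuous k -> 0 < e ->
  exists2 d, 0 < d & forall x y, a <= x <= b -> a <= y <= b -> `|x - y| <= d -> `|k x - k y| <= e.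
Proof.
move=> ck e0.
pose A := (`[a, b]%classic `*` `[a, b]%classic) `&` [set z : R * R | e <= `|k z.1 - k z.2|].
have c1 : continuous (fun z : R * R => z.1) by move=> z; exact: cvg_fst.
have c2 : continuous (fun z : R * R => z.2) by move=> z; exact: cvg_snd.
have cA : compact A.
  apply: compact_closedI; first by apply: compact_setX; exact: segment_compact.
  apply: (@preimage_closed _ _ (fun z : R * R => `|k z.1 - k z.2|) [set r : R | e <= r]).
    move=> z _; apply: cvg_norm; apply: cvgB; apply: continuous_comp;
      [exact: c1|exact: ck|exact: c2|exact: ck].
  exact: closed_ge.
have [A0|A0] := pselect (A !=set0); last first.
  exists 1 => // x y xab yab _; rewrite leNgt; apply/negP => ke; apply: A0; exists (x, y).
  by split; [split; rewrite /= in_itv|exact: ltW].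
have [|[p q]] := @compact_EVT_min _ R (fun z : R * R => `|z.1 - z.2|) A A0 cA.
  apply: continuous_subspaceT => z; apply: cvg_norm; apply: cvgB; [exact: c1|exact: c2].
rewrite inE => -[_ /= kpq] hmin.
have pq : 0 < `|p - q|.
  rewrite normr_gt0 subr_eq0; apply/eqP => E; move: kpq; rewrite E subrr normr0; lra.
exists (`|p - q| / 2); first by rewrite divr_gt0.
move=> x y xab yab xy; rewrite leNgt; apply/negP => ke.
have := hmin (x, y); rewrite inE => /(_ _)/wrap[].
  by split; [split; rewrite /= in_itv|exact: ltW].
by move=> /= h; lra.
Qed.

Lemma translation_continuity w K e : locint w -> K <= 0 -> 0 < e ->
  exists2 d, 0 < d & forall s, 0 <= s <= d -> oint (fun x => `|w (x - s) - w x|) K 0 <= e.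
Proof.
move=> iw K0 e0.
have e3 : 0 < e / 3 by rewrite divr_gt0.
(* The approximation of w must also cover the translates by s <= 1. *)
have K1 : K - 1 <= 0 by lra.
have [k ck hk] := locint_approx iw K1 e3.
have ik := continuous_locint ck.
have e4 : 0 < e / 3 / (1 - K) by rewrite divr_gt0 //; lra.
have [d0 d00 hd] := uniform_continuous_itv (K - 1) 0 ck e4.
exists (Num.min d0 1); first by rewrite lt_min d00 ltr01.
move=> s /andP[s0]; rewrite le_min => /andP[sd s1].
have iws := locint_shift (- s) iw; have iks := locint_shift (- s) ik.
have i1 : locint (fun x => `|w (x - s) - k (x - s)|) by apply: locint_abs; exact: locintB.
have i2 : locint (fun x => `|k (x - s) - k x|) by apply: locint_abs; exact: locintB.
have i3 : locint (fun x => `|w x - k x|) by apply: locint_abs; exact: locintB.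
apply: le_trans (_ : oint (fun x => `|w (x - s) - k (x - s)| + `|k (x - s) - k x| + `|w x - k x|) K 0 <= _).
  apply: oint_le => //; [by apply: locint_abs; exact: locintB|by apply: locintD => //; exact: locintD|].
  move=> x _; rewrite (_ : w (x - s) - w x = (w (x - s) - k (x - s)) + (k (x - s) - k x) - (w x - k x)); last ring.
  by apply: le_trans (ler_normB _ _) _; rewrite lerD2r; exact: ler_normD.
have i12 : locint (fun x => `|w (x - s) - k (x - s)| + `|k (x - s) - k x|) by exact: locintD.
rewrite (ointD _ _ i12 i3) (ointD _ _ i1 i2).
have mono (q r : R) : K - 1 <= q -> q <= r -> r <= 0 -> oint (fun x => `|w x - k x|) q r <= e / 3.
  by move=> h1 h2 h3; apply: le_trans (ltW hk); apply: oint_mono.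
have h1 : oint (fun x => `|w (x - s) - k (x - s)|) K 0 <= e / 3.
  rewrite (@oint_shift _ (- s) (fun x => `|w x - k x|)) //; apply: mono; lra.
have h2 : oint (fun x => `|k (x - s) - k x|) K 0 <= e / 3.
  apply: le_trans (_ : oint (fun=> e / 3 / (1 - K)) K 0 <= _).
    apply: oint_le => //; first exact: locint_cst.
    move=> x /andP[Kx x0]; apply: hd; [apply/andP; split; lra|apply/andP; split; lra|].
    by rewrite (_ : x - s - x = - s); [rewrite normrN ger0_norm|ring].
  rewrite oint_cst mulrAC ler_pdivrMr; last lra.
  rewrite ler_pM2l //; lra.
have h3 : oint (fun x => `|w x - k x|) K 0 <= e / 3 by apply: mono; lra.
lra.
Qed.

(* Kato's inequality for u and its translate; the boundary terms are at most |s|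
   because the total flux varies at rate |u - w| <= 1. *)
Lemma half_translate g L eps lam w W V u K s : (forall p q, `|g p - g q| <= L * `|p - q|) ->
  0 < eps -> 0 < lam -> datum w W -> half_viscous g eps lam W V u -> K <= 0 -> 0 <= s ->
  oint (fun x => `|u (x - s) - u x|) K 0 <= oint (fun x => `|w (x - s) - w x|) K 0 + 2 * s.
Proof.
move=> gL eps0 lam0 hw [cu hV u01 _ hu] K0 s0.
have [iw hW _] := hw.
have iu := continuous_locint cu; have cV := isprim_continuous iu hV; have cW := isprim_continuous iw hW.
have cg := lipschitz_continuous gL.
have lamn : lam != 0 by rewrite gt_eqF.
have csh (k : R -> R) : continuous k -> continuous (fun x => k (x - s)).
  move=> ck x; apply: continuous_comp; last exact: ck.
  by apply: cvgB; [exact: cvg_id|exact: cvg_cst].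
pose z x := V x - W x.
have cz : continuous z by move=> x; apply: cvgB; [exact: cV|exact: cW].
pose ze x := lam^-1 * (z (x - s) - z x).
have zs x : `|z (x - s) - z x| <= s.
  have xs : x - s <= x by lra.
  have /andP[v0 v1] := isprim01_le cu hV u01 xs.
  have [_ _ /(_ _ _ xs)/andP[w0 w1]] := hw.
  by rewrite /z ler_norml; apply/andP; split; lra.
have cgu : continuous (fun x => g (u x)).
  by move=> x; apply: continuous_comp; [exact: cu|exact: cg].
have czg : continuous (fun x => z x + lam * g (u x)).
  by move=> x; apply: cvgD; [exact: cz|apply: cvgM; [exact: cvg_cst|exact: cgu]].
have := @kato R L eps lam K 0 (fun x => u (x - s) - u x) (fun x => g (u (x - s)) - g (u x)) ze
  (fun x => w (x - s) - w x) K0 eps0 lam0.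
move=> /(_ _)/wrap[]; first by move=> x; apply: cvgB; [exact: csh|exact: cu].
move=> /(_ _)/wrap[].
  move=> x; apply: cvgB; last exact: cgu.
  exact: (csh (fun x => g (u x)) cgu).
move=> /(_ _)/wrap[].
  by move=> x; apply: cvgM; [exact: cvg_cst|apply: cvgB; [exact: csh|exact: cz]].
move=> /(_ _)/wrap[]; first by apply: locintB => //; exact: (locint_shift (- s) iw).
move=> /(_ _)/wrap[].
  move=> a b Ka ab b0.
  have e1 := hu a b ab b0; have e2 := hu (a - s) (b - s) ltac:(lra) ltac:(lra).
  rewrite -(oint_shift (- s)) in e2; last exact: continuous_locint.
  rewrite (_ : eps * _ = lam^-1 * (lam * eps * (u (b - s) - u (a - s)) - lam * eps * (u b - u a))); last by field.
  rewrite e1 e2 -ointB; [|exact: (locint_shift (- s) (continuous_locint czg))|exact: continuous_locint].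
  rewrite -ointZ; last by apply: locintB; [exact: (locint_shift (- s) (continuous_locint czg))|exact: continuous_locint].
  by congr (oint _ a b); apply/funext => x; rewrite /ze /z; field.
move=> /(_ _)/wrap[].
  move=> a b Ka ab b0.
  have ius := locint_shift (- s) iu; have iws := locint_shift (- s) iw.
  rewrite ointB; [|exact: locintB|exact: locintB].
  rewrite !ointB // !oint_shift // -!hV -!hW /ze /z; by field.
move=> /(_ _)/wrap[]; first by move=> x _; exact: gL.
move=> h; apply: le_trans h _; rewrite lerD2l.
have bnd x (q : R) : `|lam * (ze x * Num.sg q)| <= s.
  rewrite (_ : lam * (ze x * Num.sg q) = (z (x - s) - z x) * Num.sg q); last by rewrite /ze; field.
  rewrite normrM -[leRHS]mulr1 ler_pM // normr_sg; by case: (q != 0).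
have := bnd 0 (u (0 - s) - u 0); have := bnd K (u (K - s) - u K).
rewrite mulrBr !ler_norml => /andP[? ?] /andP[? ?]; lra.
Qed.

Lemma half_L1_of_sup lam w W K e : 0 < lam -> datum w W -> K <= 0 -> 0 < e ->
  exists2 rho, 0 < rho & forall g L eps1 eps2 V1 V2 u1 u2,
    (forall p q, `|g p - g q| <= L * `|p - q|) -> 0 < eps1 -> 0 < eps2 ->
    half_viscous g eps1 lam W V1 u1 -> half_viscous g eps2 lam W V2 u2 ->
    (forall x, `|V1 x - V2 x| <= rho) -> oint (fun x => `|u1 x - u2 x|) K 0 <= e.
Proof.
move=> lam0 hw K0 e0; have [iw _ _] := hw.
have e8 : 0 < e / 8 by rewrite divr_gt0.
have [d d0 hd] := translation_continuity iw K0 e8.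
(* Translation by s <= h then costs at most e / 8 + 2 h <= e / 4, for every viscosity. *)
pose h := Num.min d (e / 16).
have h0 : 0 < h by rewrite lt_min d0 divr_gt0.
have hhd : h <= d by rewrite ge_min lexx.
have hhe : h <= e / 16 by rewrite ge_min lexx orbT.
have p0 : 0 < 8 * (1 - K) by lra.
(* The two quotients differ by at most 2 rho / h = e / (4 (1 - K)), which integrates to at most e /
   4 over the interval from K to 0; 1 - K is positive even for K = 0. *)
exists (e * h / (8 * (1 - K))); first by rewrite divr_gt0 // mulr_gt0.
move=> g L eps1 eps2 V1 V2 u1 u2 gL e10 e20 hv1 hv2 hV12.
have avg eps V u : 0 < eps -> half_viscous g eps lam W V u ->
    oint (fun x => `|u x - (V x - V (x - h)) / h|) K 0 <= e / 4.
  move=> eps0 hv; have [cu hV _ _ _] := hv.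
  apply: average_bound => // s /andP[s0 sh].
  have := half_translate gL eps0 lam0 hw hv K0 s0.
  have := hd s ltac:(by apply/andP; split; lra).
  rewrite (_ : (fun x => `|u (x - s) - u x|) = (fun x => `|u x - u (x - s)|)); last first.
    by apply/funext => x; rewrite distrC.
  lra.
have a1 := avg _ _ _ e10 hv1; have a2 := avg _ _ _ e20 hv2.
have [cu1 hV1 _ _ _] := hv1; have [cu2 hV2 _ _ _] := hv2.
have cV1 := isprim_continuous (continuous_locint cu1) hV1.
have cV2 := isprim_continuous (continuous_locint cu2) hV2.
have cA (V : R -> R) : continuous V -> continuous (fun x => (V x - V (x - h)) / h).
  move=> cV x; apply: cvgM; last exact: cvg_cst.
  apply: cvgB; first exact: cV.
  apply: continuous_comp; last exact: cV.
  by apply: cvgB; [exact: cvg_id|exact: cvg_cst].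
have iA1 : locint (fun x => `|u1 x - (V1 x - V1 (x - h)) / h|).
  by apply: locint_abs; apply: locintB; apply: continuous_locint => //; exact: cA.
have iA2 : locint (fun x => `|u2 x - (V2 x - V2 (x - h)) / h|).
  by apply: locint_abs; apply: locintB; apply: continuous_locint => //; exact: cA.
pose c := e / (4 * (1 - K)).
have ic : locint (fun _ : R => c) by exact: locint_cst.
apply: le_trans (_ : oint (fun x => `|u1 x - (V1 x - V1 (x - h)) / h| + `|u2 x - (V2 x - V2 (x - h)) / h| + c) K 0 <= _).
  apply: oint_le => //.
  - by apply: locint_abs; apply: locintB; exact: continuous_locint.
  - by apply: locintD => //; exact: locintD.
  move=> x _.
  rewrite (_ : u1 x - u2 x = (u1 x - (V1 x - V1 (x - h)) / h) - (u2 x - (V2 x - V2 (x - h)) / h)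
    + ((V1 x - V2 x) - (V1 (x - h) - V2 (x - h))) / h); last by field; rewrite gt_eqF.
  apply: le_trans (ler_normD _ _) _; apply: lerD; first exact: ler_normB.
  rewrite normrM normfV (gtr0_norm h0) ler_pdivrMr //.
  apply: le_trans (ler_normB _ _) _.
  have := hV12 x; have := hV12 (x - h).
  have -> : c * h = 2 * (e * h / (8 * (1 - K))) by rewrite /c; field; lra.
  lra.
have i12 := locintD iA1 iA2.
rewrite (ointD _ _ i12 ic) (ointD _ _ iA1 iA2) oint_cst.
have : c * (0 - K) <= e / 4.
  rewrite /c mulrAC ler_pdivrMr; last lra.
  nra.
lra.
Qed.

End TranslationEstimates.

(** * Existence for the viscous equation *)


Section SupContraction.
Context {R : realType}.
Implicit Types (p q : R -> R) (x y c C theta : R).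

Definition bounded_continuous p := continuous p /\ exists M, forall x, `|p x| <= M.

Lemma uniform_limit_bounded_continuous (P : nat -> R -> R) p :
  (forall n, bounded_continuous (P n)) ->
  (forall e, 0 < e -> exists n, forall x, `|p x - P n x| <= e) -> bounded_continuous p.
Proof.
move=> hP hp; split.
  move=> x; apply/cvgrPdist_le => e e0.
  have [n hn] := hp (e / 3) ltac:(by rewrite divr_gt0).
  have [cn _] := hP n.
  have := cn x => /cvgrPdist_le/(_ (e / 3)); rewrite divr_gt0 // => /(_ isT).
  apply: filterS => y hy.
  have -> : p x - p y = (p x - P n x) + (P n x - P n y) - (p y - P n y) by ring.
  apply: le_trans (ler_normB _ _) _; apply: le_trans (lerD (ler_normD _ _) (lexx _)) _.
  have := hn x; have := hn y; lra.
have [n hn] := hp 1 ltr01; have [_ [M hM]] := hP n.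
exists (M + 1) => x; have -> : p x = P n x + (p x - P n x) by ring.
apply: le_trans (ler_normD _ _) _; exact: lerD.
Qed.

Lemma sup_fixed_point (T : (R -> R) -> (R -> R)) theta : 0 <= theta -> theta < 1 ->
  (forall p, bounded_continuous p -> bounded_continuous (T p)) ->
  (forall p q c, bounded_continuous p -> bounded_continuous q ->
     (forall x, `|p x - q x| <= c) -> forall x, `|T p x - T q x| <= theta * c) ->
  exists2 p, bounded_continuous p & forall x, T p x = p x.
Proof.
move=> th0 th1 TX Tc; pose P n := iter n T (fun=> 0).
have P0b : bounded_continuous (fun _ : R => 0 : R).
  by split; [move=> x; exact: cvg_cst|exists 0 => x; rewrite normr0].
have Pb n : bounded_continuous (P n) by elim: n => //= n; exact: TX.
have [_ [C hC]] := TX _ P0b.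
have C0 : 0 <= C by exact: le_trans (normr_ge0 _) (hC 0).
have step n x : `|P n.+1 x - P n x| <= C * theta ^+ n.
  elim: n x => [|n ih] x; first by rewrite expr0 mulr1 /= subr0.
  have := Tc _ _ _ (Pb n.+1) (Pb n) ih x.
  by rewrite exprS mulrCA.
have th : 0 < 1 - theta by rewrite subr_gt0.
(* The tail of the geometric series that bounds the steps: the n-th step is at most r n - r (n + 1),
   so distances telescope. *)
pose r n := C * theta ^+ n / (1 - theta).
have far n k x : `|P (n + k)%N x - P n x| <= r n - r (n + k)%N.
  elim: k => [|k ih]; first by rewrite addn0 !subrr normr0.
  rewrite addnS.
  have -> : P (n + k).+1 x - P n x = (P (n + k).+1 x - P (n + k)%N x) + (P (n + k)%N x - P n x) by ring.
  apply: le_trans (ler_normD _ _) _.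
  apply: le_trans (lerD (step (n + k)%N x) ih) _.
  rewrite le_eqVlt; apply/orP; left; apply/eqP; rewrite /r exprS; field.
  by rewrite gt_eqF.
have r0 n : 0 <= r n by rewrite /r divr_ge0 ?mulr_ge0 ?exprn_ge0 // ltW.
have far' n k x : (n <= k)%N -> `|P k x - P n x| <= r n.
  by move=> nk; have := far n (k - n)%N x; rewrite subnKC // => h; apply: le_trans h _; rewrite gerBl.
have rlim : r n @[n --> \oo] --> (0 : R).
  have h : theta ^+ n @[n --> \oo] --> (0 : R) by apply: cvg_expr; rewrite ger0_norm.
  rewrite (_ : 0 = C * 0 * (1 - theta)^-1); last by rewrite mulr0 mul0r.
  by apply: cvgM; [apply: cvgM; [exact: cvg_cst|exact: h]|exact: cvg_cst].
have rsmall e : 0 < e -> exists n, r n <= e.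
  move=> e0; have /cvgrPdist_le/(_ _ e0)[N _ /(_ N (leqnn _))] := rlim.
  by rewrite sub0r normrN ger0_norm //; exists N.
have cvgP x : cvg (P n x @[n --> \oo]).
  apply: cauchy_cvg; apply: cauchy_exP => e e0.
  have [N hN] := rsmall (e / 2) ltac:(by rewrite divr_gt0).
  exists (P N x); exists N => // k /= Nk.
  rewrite /ball /= distrC; apply: le_lt_trans (far' N k x Nk) _; lra.
pose p x := lim (P n x @[n --> \oo]).
have close n x : `|p x - P n x| <= r n.
  have h : `|P k x - P n x| @[k --> \oo] --> `|p x - P n x|.
    by apply: cvg_norm; apply: cvgB; [exact: cvgP|exact: cvg_cst].
  apply: (closed_cvg (fun y : R => y <= r n) _ _ _ h); first exact: closed_le.
  by exists n => // k /= nk; exact: far'.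
have pb : bounded_continuous p.
  apply: uniform_limit_bounded_continuous Pb _ => e e0.
  by have [n hn] := rsmall e e0; exists n => x; exact: le_trans (close n x) hn.
exists p => // x; apply/eqP; rewrite -subr_eq0 -normr_le0; apply/ler_addgt0Pl => e e0; rewrite addr0.
have [n hn] := rsmall (e / 2) ltac:(by rewrite divr_gt0).
have h1 := Tc _ _ _ pb (Pb n) (close n) x.
have h2 := close n.+1 x.
have h3 : r n.+1 <= r n.
  rewrite /r ler_pM2r ?invr_gt0 // exprS ler_wpM2l //.
  by rewrite ler_piMl ?exprn_ge0 // ltW.
have h4 : theta * r n <= r n by rewrite ler_piMl // ltW.
have -> : T p x - p x = (T p x - T (P n) x) - (p x - P n.+1 x) by rewrite /=; ring.
apply: le_trans (ler_normB _ _) _; lra.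
Qed.

End SupContraction.

(** * Bounded solutions of a first-order equation by exponential convolution *)

Section ExponentialKernel.
Context {R : realType}.
Implicit Types (q k : R -> R) (x y c M kap : R).

Let weighted kap q s := expR (kap^-1 * s) * q s.

(* The bounded solution of kap y' + y = q. *)
Definition exp_conv kap q x :=
  kap^-1 * (expR (- (kap^-1 * x)) * (prim (weighted kap q) x - xget 0 [set c | lim_l (prim (weighted kap q)) c])).

Let expk_derive kap c x : is_derive x (1 : R) (fun s => expR (c * s)) (c * expR (c * x)).
Proof.
have d : is_derive x (1 : R) (fun s => c * s) c.
  by apply: is_derive_eq; rewrite /GRing.scale /= mulr1.
by have := is_derive1_comp (is_derive_expR (c * x)) d; rewrite mulrC.
Qed.

Let expk_continuous c : continuous (fun s : R => expR (c * s)).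
Proof. by move=> x; apply: (derive_continuous (expk_derive 0 c)). Qed.

Let expk_oint kap a b : 0 < kap -> oint (fun s => expR (kap^-1 * s)) a b = kap * (expR (kap^-1 * b) - expR (kap^-1 * a)).
Proof.
move=> k0; have c : continuous (fun s => kap^-1 * expR (kap^-1 * s)).
  by move=> x; apply: cvgM; [exact: cvg_cst|exact: expk_continuous].
rewrite (derive_isprim c (expk_derive 0 kap^-1) a b) ointZ; last exact: continuous_locint (@expk_continuous _).
by rewrite mulrA divff ?mul1r // gt_eqF.
Qed.

Let weighted_locint kap q M : measurable_fun setT q -> (forall x, `|q x| <= M) -> locint (weighted kap q).
Proof.
move=> mq hq; rewrite /weighted (_ : (fun _ => _) = fun s => q s * expR (kap^-1 * s)); last first.
  by apply/funext => s; rewrite mulrC.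
by apply: locintM; [exact: bounded_locint hq|exact: expk_continuous].
Qed.

Let weighted_abs kap q c s : `|q s| <= c -> `|weighted kap q s| <= c * expR (kap^-1 * s).
Proof. by move=> h; rewrite normrM ger0_norm ?expR_ge0 // mulrC ler_wpM2r ?expR_ge0. Qed.

(** The exponential weight is integrable only towards -oo; cutting the function off at 0 makes it
    integrable without changing increments of the primitive on the left. *)
Let weighted_lim kap q M : 0 < kap -> measurable_fun setT q -> (forall x, `|q x| <= M) ->
  exists c, lim_l (prim (weighted kap q)) c.
Proof.
move=> k0 mq hq; have iw := weighted_locint kap mq hq.
pose k s := if s <= 0 then weighted kap q s else 0.
have M0 : 0 <= M by exact: le_trans (normr_ge0 _) (hq 0).
have ik : locint k.
  apply: (@locint_le _ _ _ _ iw).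
    apply: measurable_fun_ifT; [|exact: (locint_meas iw)|exact: measurable_cst].
    by apply: measurable_fun_ler => //; exact: measurable_cst.
  by move=> x; rewrite /k; case: ifP => // _; rewrite normr0.
have ie : locint (fun s => M * expR (kap^-1 * s)).
  by apply: locintZ; exact: continuous_locint (@expk_continuous _).
have lk : l1 k.
  split => //; exists (M * kap) => a b ab.
  apply: le_trans (_ : oint (fun x => `|k x|) (Num.min a 0) (Num.max b 0) <= _).
    apply: oint_mono => //; [exact: locint_abs|by rewrite ge_min lexx|by rewrite le_max lexx].
  have h1 : Num.min a 0 <= 0 by rewrite ge_min lexx orbT.
  have h2 : 0 <= Num.max b 0 by rewrite le_max lexx orbT.
  rewrite -(oint_chasles _ (Num.min a 0) 0).
  rewrite (@eq_oint_oc _ (fun x => `|k x|) (fun=> 0) 0) //; first last.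
  - by move=> x x0 _; rewrite /k leNgt x0 normr0.
  - exact: locint_cst.
  - exact: locint_abs.
  rewrite oint_cst mul0r addr0.
  apply: le_trans (_ : oint (fun s => M * expR (kap^-1 * s)) (Num.min a 0) 0 <= _).
    apply: oint_le => //; first exact: locint_abs.
    by move=> x /andP[_ x0]; rewrite /k x0; exact: weighted_abs.
  rewrite ointZ; last exact: continuous_locint (@expk_continuous _).
  rewrite expk_oint // mulr0 expR0 ler_wpM2l // ler_piMr ?(ltW k0) //.
have [c hc] := l1_prim_lim_l lk; exists c => e e0.
have [X hX] := hc e e0; exists (Num.min X 0) => x; rewrite le_min => /andP[xX x0].
have := hX x xX; congr (`|_ - c| <= e).
have : oint k x 0 = oint (weighted kap q) x 0.
  by apply: eq_oint => // s /andP[_ s0]; rewrite /k s0.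
rewrite /oint !prim0; lra.
Qed.

Let weighted_bound kap k c d x : 0 < kap -> locint k -> 0 <= c -> (forall s, `|k s| <= c * expR (kap^-1 * s)) ->
  lim_l (prim k) d -> `|prim k x - d| <= c * kap * expR (kap^-1 * x).
Proof.
move=> k0 ik c0 hk hd; apply/ler_addgt0Pl => e e0.
have [X hX] := hd e e0; pose y := Num.min X x.
have yX : y <= X by rewrite ge_min lexx.
have yx : y <= x by rewrite ge_min lexx orbT.
have := hX y yX => h1.
have h2 : `|oint k y x| <= c * kap * expR (kap^-1 * x).
  apply: le_trans (oint_abs ik yx) _.
  have ie : locint (fun s => expR (kap^-1 * s)) by exact: continuous_locint (@expk_continuous _).
  apply: le_trans (_ : oint (fun s => c * expR (kap^-1 * s)) y x <= _).
    by apply: oint_le => //; [exact: locint_abs|exact: locintZ].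
  rewrite ointZ // expk_oint // -mulrA ler_wpM2l // ler_wpM2l ?(ltW k0) // gerBl expR_ge0 //.
have -> : prim k x - d = (prim k y - d) + oint k y x by rewrite /oint; ring.
apply: le_trans (ler_normD _ _) _; exact: lerD.
Qed.

Lemma exp_conv_continuous kap q M : measurable_fun setT q -> (forall x, `|q x| <= M) -> continuous (exp_conv kap q).
Proof.
move=> mq hq x; rewrite /exp_conv; apply: cvgM; first exact: cvg_cst.
apply: cvgM; last by apply: cvgB; [exact: (prim_continuous (weighted_locint kap mq hq))|exact: cvg_cst].
by rewrite -mulNr (_ : (fun y => _) = fun y => expR (- kap^-1 * y)); [exact: expk_continuous|apply/funext => y; rewrite mulNr].
Qed.

Lemma exp_conv_isprim kap q M : 0 < kap -> measurable_fun setT q -> (forall x, `|q x| <= M) ->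
  isprim (fun x => kap * exp_conv kap q x) (fun x => q x - exp_conv kap q x).
Proof.
move=> k0 mq hq a b.
have iw := weighted_locint kap mq hq.
set c := xget 0 [set c | lim_l (prim (weighted kap q)) c].
pose Q x := prim (weighted kap q) x - c.
have hQ : isprim Q (weighted kap q) by move=> x y; rewrite /Q /oint; ring.
pose g x := - kap^-1 * expR (- kap^-1 * x).
have cg : continuous g by move=> x; apply: cvgM; [exact: cvg_cst|exact: expk_continuous].
have hG := derive_isprim cg (expk_derive 0 (- kap^-1)).
have kn : kap != 0 by rewrite gt_eqF.
have E x : kap * exp_conv kap q x = Q x * expR (- kap^-1 * x).
  by rewrite /exp_conv -/c mulrA divff // mul1r mulrC mulNr.
rewrite !E -(oint_by_parts a b iw hQ cg hG); congr (oint _ a b); apply/funext => x.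
have -> : exp_conv kap q x = kap^-1 * (Q x * expR (- kap^-1 * x)) by rewrite -E mulrA mulVf // mul1r.
have ee : expR (kap^-1 * x) * expR (- kap^-1 * x) = 1 by rewrite mulNr expRxMexpNx_1.
rewrite /weighted /g -mulrA [q x * _]mulrC mulrA ee; ring.
Qed.

(** The kernel is a probability density: the integral of exp(s / kap) up to x is kap exp(x / kap),
    exactly the inverse of the prefactor. *)
Lemma exp_conv_lip kap q1 q2 M c x : 0 < kap -> measurable_fun setT q1 -> measurable_fun setT q2 ->
  (forall x, `|q1 x| <= M) -> (forall x, `|q2 x| <= M) -> (forall x, `|q1 x - q2 x| <= c) ->
  `|exp_conv kap q1 x - exp_conv kap q2 x| <= c.
Proof.
move=> k0 m1 m2 h1 h2 h12.
have i1 := weighted_locint kap m1 h1; have i2 := weighted_locint kap m2 h2.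
rewrite /exp_conv; set c1 := xget _ _; set c2 := xget _ _.
have l1_ : lim_l (prim (weighted kap q1)) c1.
  by have [d hd] := weighted_lim k0 m1 h1; exact: (@xgetPex _ 0 [set c | lim_l (prim (weighted kap q1)) c] (ex_intro _ d hd)).
have l2_ : lim_l (prim (weighted kap q2)) c2.
  by have [d hd] := weighted_lim k0 m2 h2; exact: (@xgetPex _ 0 [set c | lim_l (prim (weighted kap q2)) c] (ex_intro _ d hd)).
pose k s := weighted kap q1 s - weighted kap q2 s.
have pk y : prim k y = prim (weighted kap q1) y - prim (weighted kap q2) y.
  by have := ointB 0 y i1 i2; rewrite /oint !prim0; lra.
have lk : lim_l (prim k) (c1 - c2).
  have := lim_l_comb 1 (-1) l1_ l2_; rewrite mul1r mulN1r.
  by rewrite (_ : (fun x => _) = prim k) //; apply/funext => y; rewrite pk; ring.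
have c0 : 0 <= c by exact: le_trans (normr_ge0 _) (h12 0).
have hk s : `|k s| <= c * expR (kap^-1 * s).
  by rewrite /k /weighted -mulrBr normrM ger0_norm ?expR_ge0 // mulrC ler_wpM2r ?expR_ge0.
have := weighted_bound x k0 (locintB i1 i2) c0 hk lk.
rewrite -mulrBr -mulrBr.
have -> : prim (weighted kap q1) x - c1 - (prim (weighted kap q2) x - c2) = prim k x - (c1 - c2) by rewrite pk; ring.
move=> h; rewrite normrM gtr0_norm ?invr_gt0 // ler_pdivrMl //.
rewrite normrM ger0_norm ?expR_ge0 // expRN ler_pdivrMl ?expR_gt0 //.
apply: le_trans h _; rewrite le_eqVlt; apply/orP; left; apply/eqP; ring.
Qed.

Lemma exp_conv_abs kap q M x : 0 < kap -> measurable_fun setT q -> (forall x, `|q x| <= M) ->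
  `|exp_conv kap q x| <= M.
Proof.
move=> k0 mq hq; rewrite /exp_conv; set c := xget _ _.
have lc : lim_l (prim (weighted kap q)) c.
  by have [d hd] := weighted_lim k0 mq hq; exact: (@xgetPex _ 0 [set c | lim_l (prim (weighted kap q)) c] (ex_intro _ d hd)).
have M0 : 0 <= M by exact: le_trans (normr_ge0 _) (hq 0).
have h := weighted_bound x k0 (weighted_locint kap mq hq) M0 (fun s => weighted_abs kap (hq s)) lc.
rewrite normrM gtr0_norm ?invr_gt0 // ler_pdivrMl //.
rewrite normrM ger0_norm ?expR_ge0 // expRN ler_pdivrMl ?expR_gt0 //.
apply: le_trans h _; rewrite le_eqVlt; apply/orP; left; apply/eqP; ring.
Qed.

End ExponentialKernel.


(** * Green function, sup-norm contraction, and solvability for every lam *)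

Section ViscousExistence.
Context {R : realType}.
Implicit Types (f : R -> R -> R) (fl fr p q u w V W : R -> R) (L eps lam kap a b c x : R).
Notation mu := (@lebesgue_measure R).

Lemma bounded_continuous_meas p : bounded_continuous p -> measurable_fun setT p.
Proof. by move=> [cp _]; exact: continuous_measurable_fun. Qed.

(* V and V' are half the sum and the scaled difference of the two bounded
   solutions of kap y' + y = q and - kap y' + y = q, which factor 1 - (kap d/dx)^2. *)
Definition green_deriv kap q x := (2 * kap)^-1 * (exp_conv kap (fun y => q (- y)) (- x) - exp_conv kap q x).
Definition green kap q x := 2^-1 * (exp_conv kap (fun y => q (- y)) (- x) + exp_conv kap q x).

Lemma green_spec kap q M : 0 < kap -> measurable_fun setT q -> (forall x, `|q x| <= M) ->
  [/\ bounded_continuous (green kap q), bounded_continuous (green_deriv kap q),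
      isprim (green kap q) (green_deriv kap q) &
      isprim (fun x => kap ^+ 2 * green_deriv kap q x) (fun x => green kap q x - q x)].
Proof.
move=> k0 mq hq.
have kn : kap != 0 by rewrite gt_eqF.
pose q' y := q (- y).
have mq' : measurable_fun setT q' by apply: measurableT_comp => //; exact: oppr_measurable.
have hq' x : `|q' x| <= M by exact: hq.
have iq := bounded_locint mq hq; have iq' := bounded_locint mq' hq'.
pose y1 := exp_conv kap q; pose y2 x := exp_conv kap q' (- x).
have b1 x : `|y1 x| <= M by exact: exp_conv_abs.
have b2 x : `|y2 x| <= M by exact: exp_conv_abs.
have p1 : isprim (fun x => kap * y1 x) (fun x => q x - y1 x) := exp_conv_isprim k0 mq hq.
have p2 : isprim (fun x => kap * exp_conv kap q' x) (fun x => q' x - exp_conv kap q' x) := exp_conv_isprim k0 mq' hq'.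
have wc (k y : R -> R) : measurable_fun setT k -> (forall x, `|k x| <= M) -> y = exp_conv kap k -> locint (fun x => k x - y x).
  move=> mk hk ->.
  by apply: locintB; [exact: bounded_locint hk|apply: continuous_locint; exact: exp_conv_continuous mk hk].
have w1 : locint (fun x => q x - y1 x) by exact: wc hq erefl.
have w2 : locint (fun x => q' x - exp_conv kap q' x) by exact: wc hq' erefl.
have p2' : isprim (fun x => kap * y2 x) (fun x => y2 x - q x).
  move=> a b; rewrite /y2 p2 ointNN -oint_reflect // -ointN; last exact: (locint_reflect w2).
  by congr (oint _ a b); apply/funext => x; rewrite /q' !opprK; ring.
have w2' : locint (fun x => y2 x - q x).
  have := locintN (locint_reflect w2); rewrite (_ : (fun x => _) = fun x => y2 x - q x) //.
  by apply/funext => x; rewrite /q' !opprK /y2 /q'; ring.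
have cscale (y : R -> R) k : locint k -> isprim (fun x => kap * y x) k -> continuous y.
  move=> ik py; rewrite (_ : y = fun x => kap^-1 * (kap * y x)).
    by move=> x; apply: cvgM; [exact: cvg_cst|exact: (isprim_continuous ik py)].
  by apply/funext => x; rewrite mulrA mulVf // mul1r.
have c1 : continuous y1 := cscale _ _ w1 p1.
have c2 : continuous y2 := cscale _ _ w2' p2'.
have eG : green kap q = fun x => 2^-1 * (y2 x + y1 x) by [].
have eD : green_deriv kap q = fun x => (2 * kap)^-1 * (y2 x - y1 x) by [].
clearbody y1 y2.
have iD : locint (fun x => y2 x - y1 x) by apply: locintB; exact: continuous_locint.
split.
- rewrite eG; split.
    by move=> x; apply: cvgM; [exact: cvg_cst|apply: cvgD; [exact: c2|exact: c1]].
  exists M => x; rewrite normrM gtr0_norm ?invr_gt0 // ler_pdivrMl //.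
  by apply: le_trans (ler_normD _ _) _; move: (b1 x) (b2 x); clear; lra.
- rewrite eD; split.
    by move=> x; apply: cvgM; [exact: cvg_cst|apply: cvgB; [exact: c2|exact: c1]].
  exists (kap^-1 * M) => x; rewrite normrM gtr0_norm ?invr_gt0 ?mulr_gt0 //.
  rewrite ler_pdivrMl ?mulr_gt0 // mulrA -[2 * kap * _]mulrA divff // mulr1.
  by apply: le_trans (ler_normB _ _) _; move: (b1 x) (b2 x); clear; lra.
- move=> a b; rewrite eG eD ointZ //.
  have -> : oint (fun x => y2 x - y1 x) a b = (kap * y2 b - kap * y2 a) + (kap * y1 b - kap * y1 a).
    rewrite p1 p2' -(ointD _ _ w2' w1); congr (oint _ a b); apply/funext => x; clear; ring.
  by field.
- move=> a b; rewrite eD eG.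
  have -> : (fun x => 2^-1 * (y2 x + y1 x) - q x) = (fun x => 2^-1 * ((y2 x - q x) - (q x - y1 x))).
    by apply/funext => x; field.
  rewrite ointZ; last exact: locintB.
  by rewrite ointB // -p1 -p2'; field.
Qed.

Lemma green_deriv_lip kap q1 q2 M c x : 0 < kap -> measurable_fun setT q1 -> measurable_fun setT q2 ->
  (forall x, `|q1 x| <= M) -> (forall x, `|q2 x| <= M) -> (forall x, `|q1 x - q2 x| <= c) ->
  `|green_deriv kap q1 x - green_deriv kap q2 x| <= kap^-1 * c.
Proof.
move=> k0 m1 m2 h1 h2 h12.
have e1 := exp_conv_lip x k0 m1 m2 h1 h2 h12.
have e2 : `|exp_conv kap (fun y => q1 (- y)) (- x) - exp_conv kap (fun y => q2 (- y)) (- x)| <= c.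
  apply: (exp_conv_lip (- x) k0 _ _ (fun y => h1 (- y)) (fun y => h2 (- y)) (fun y => h12 (- y))).
    by apply: measurableT_comp => //; exact: oppr_measurable.
  by apply: measurableT_comp => //; exact: oppr_measurable.
rewrite /green_deriv -mulrBr normrM gtr0_norm ?invr_gt0 ?mulr_gt0 //.
rewrite ler_pdivrMl ?mulr_gt0 // mulrA -[2 * kap * _]mulrA divff ?gt_eqF // mulr1.
set s1 := exp_conv kap _ (- x) in e2 *; set s2 := exp_conv kap _ (- x) in e2 *.
set t1 := exp_conv kap _ x in e1 *; set t2 := exp_conv kap _ x in e1 *.
clearbody s1 s2 t1 t2; clear -e1 e2.
have -> : s1 - t1 - (s2 - t2) = (s1 - s2) - (t1 - t2) by ring.
by apply: le_trans (ler_normB _ _) _; lra.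
Qed.

(** Fixed point in the slope p: solve V - kap^2 V'' = W - nu f(x, p), nu = kap^2 / eps, and return
    V'. The derivative of the Green function costs 1 / kap, so the contraction constant is nu L /
    kap = kap L / eps <= 1/2. *)
Lemma viscous_exists_small f fl fr L eps kap W : split_flux f fl fr L -> 0 < eps -> 0 < kap ->
  kap * L <= eps / 2 -> bounded_continuous W ->
  exists V u, viscous f eps (kap ^+ 2 / eps) W V u /\ bounded_continuous V.
Proof.
move=> hf eps0 k0 kL [cW [MW hW]].
have L0 : 0 <= L by case: hf.
set nu := kap ^+ 2 / eps.
have nu0 : 0 < nu by rewrite divr_gt0 // exprn_gt0.
pose Q p x := W x - nu * f x (p x).
have mQ p : bounded_continuous p -> measurable_fun setT (Q p).
  move=> bp; apply: measurable_funB; first exact: continuous_measurable_fun.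
  apply: measurable_funM; first exact: measurable_cst.
  exact: split_flux_meas hf (bounded_continuous_meas bp).
have bQ p M : (forall x, `|p x| <= M) -> forall x, `|Q p x| <= MW + nu * (L * M).
  move=> hp x; apply: le_trans (ler_normB _ _) _; apply: lerD => //.
  rewrite normrM gtr0_norm // ler_pM2l //; apply: le_trans (split_flux_abs x (p x) hf) _.
  by rewrite ler_wpM2l.
pose T p := green_deriv kap (Q p).
have [] := @sup_fixed_point _ T 2^-1.
- by rewrite invr_ge0.
- by rewrite invf_lt1 // ltr1n.
- move=> p bp; have [_ [M hM]] := bp.
  by have [] := green_spec k0 (mQ _ bp) (bQ _ _ hM).
- move=> p q c bp bq hpq x; have [_ [M hM]] := bp; have [_ [M' hM']] := bq.
  pose B := Num.max (MW + nu * (L * M)) (MW + nu * (L * M')).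
  have h1 y : `|Q p y| <= B by apply: le_trans (bQ _ _ hM y) _; rewrite le_max lexx.
  have h2 y : `|Q q y| <= B by apply: le_trans (bQ _ _ hM' y) _; rewrite le_max lexx orbT.
  have h3 y : `|Q p y - Q q y| <= nu * (L * c).
    have -> : Q p y - Q q y = - (nu * (f y (p y) - f y (q y))) by rewrite /Q; ring.
    rewrite normrN normrM gtr0_norm // ler_pM2l //; apply: le_trans (split_flux_lip y _ _ hf) _.
    by rewrite ler_wpM2l.
  apply: le_trans (green_deriv_lip x k0 (mQ _ bp) (mQ _ bq) h1 h2 h3) _.
  have c0 : 0 <= c by exact: le_trans (normr_ge0 _) (hpq 0).
  have -> : kap^-1 * (nu * (L * c)) = (kap * L / eps) * c by rewrite /nu; field; rewrite !gt_eqF.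
  by rewrite ler_wpM2r // ler_pdivrMr // [2^-1 * _]mulrC.
move=> p bp Tp; have [_ [M hM]] := bp.
have [bG bD pG pD] := green_spec k0 (mQ _ bp) (bQ _ _ hM).
have Dp : green_deriv kap (Q p) = p by apply/funext => x; exact: Tp.
rewrite Dp in pG pD.
exists (green kap (Q p)), p; split => //; split => //; first by case: bp.
move=> a b; have -> : nu * eps = kap ^+ 2 by rewrite /nu; field; rewrite gt_eqF.
by rewrite pD; congr (oint _ a b); apply/funext => x; rewrite /Q; ring.
Qed.

(** At x = 0 the flux takes its left value, so the right-hand side is left-continuous even there;
    this is the continuity that [touch_left_curvature] asks for. *)
Lemma viscous_left_cont f fl fr L u x : split_flux f fl fr L -> continuous u -> left_cont (fun y => f y (u y)) x.
Proof.
move=> [hf hl hr _ _] cu.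
have [x0|x0] := leP x 0.
  have cc : continuous (fun y => fl (u y)).
    by move=> y; apply: continuous_comp; [exact: cu|exact: (lipschitz_continuous hl)].
  move=> e e0; have [r r0 hr'] := continuous_left_cont (cc x) e0; exists r => // s sx.
  have s0 : s <= 0 by case/andP: sx => _ h; exact: le_trans h x0.
  by rewrite !hf x0 s0; exact: hr'.
have cc : continuous (fun y => fr (u y)).
  by move=> y; apply: continuous_comp; [exact: cu|exact: (lipschitz_continuous hr)].
move=> e e0; have [r r0 hr'] := continuous_left_cont (cc x) e0.
exists (Num.min r (x / 2)); first by rewrite lt_min r0 divr_gt0.
move=> s /andP[sx1 sx2].
have m1 : Num.min r (x / 2) <= r by rewrite ge_min lexx.
have m2 : Num.min r (x / 2) <= x / 2 by rewrite ge_min lexx orbT.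
have s0 : 0 < s by lra.
rewrite !hf (lt_geF x0) (lt_geF s0); apply: hr'; apply/andP; split; lra.
Qed.

Lemma left_cont_comb (k l : R -> R) (s t x : R) : left_cont k x -> left_cont l x ->
  left_cont (fun y => s * k y + t * l y) x.
Proof.
move=> hk hl e e0.
have p : 0 < `|s| + `|t| + 1 by have := normr_ge0 s; have := normr_ge0 t; lra.
have e1 : 0 < e / (`|s| + `|t| + 1) by rewrite divr_gt0.
have [r r0 hr] := hk _ e1; have [r' r0' hr'] := hl _ e1.
exists (Num.min r r'); first by rewrite lt_min r0 r0'.
move=> y /andP[y1 y2].
have m1 : Num.min r r' <= r by rewrite ge_min lexx.
have m2 : Num.min r r' <= r' by rewrite ge_min lexx orbT.
have h1 := hr y ltac:(by apply/andP; split; lra).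
have h2 := hr' y ltac:(by apply/andP; split; lra).
have -> : s * k y + t * l y - (s * k x + t * l x) = s * (k y - k x) + t * (l y - l x) by ring.
apply: le_trans (ler_normD _ _) _; rewrite !normrM.
apply: le_trans (lerD (ler_wpM2l (normr_ge0 s) h1) (ler_wpM2l (normr_ge0 t) h2)) _.
rewrite -mulrDl mulrA ler_pdivrMr //; clear -e0; nra.
Qed.

(* V1 - V2 is penalized by d^2 x^2 to compensate for the noncompact line. *)
Lemma viscous_sup_le f fl fr L eps lam W1 W2 V1 V2 u1 u2 c : split_flux f fl fr L -> 0 < eps -> 0 < lam ->
  bounded_continuous W1 -> bounded_continuous W2 -> bounded_continuous V1 -> bounded_continuous V2 ->
  viscous f eps lam W1 V1 u1 -> viscous f eps lam W2 V2 u2 ->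
  (forall x, W1 x - W2 x <= c) -> forall x, V1 x - V2 x <= c.
Proof.
move=> hf eps0 lam0 [cW1 _] [cW2 _] [cV1 [B1 hB1]] [cV2 [B2 hB2]] [cu1 hV1 hu1] [cu2 hV2 hu2] hW xh.
have L0 : 0 <= L by case: hf.
have le0 : 0 < lam * eps by rewrite mulr_gt0.
pose V x := V1 x - V2 x; pose u x := u1 x - u2 x; pose W x := W1 x - W2 x.
pose B := B1 + B2.
have hB x : `|V x| <= B by apply: le_trans (ler_normB _ _) _; exact: lerD.
have B0 : 0 <= B by exact: le_trans (normr_ge0 _) (hB 0).
have iu1 := continuous_locint cu1; have iu2 := continuous_locint cu2.
have cV : continuous V by move=> x; apply: cvgB; [exact: cV1|exact: cV2].
have cu : continuous u by move=> x; apply: cvgB; [exact: cu1|exact: cu2].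
have hV : isprim V u by exact: isprimB.
(* The costs per unit of d: the penalty at [xh], the flux difference and the curvature of the
   penalty. At the maximum y the slope is 2 d^2 y, and |d y| <= B + 1 because the penalty there is
   at most 2 B. *)
pose C := xh ^+ 2 + lam * L * (2 * (B + 1)) + 2 * lam * eps.
have C0 : 0 <= C.
  have l0 := ltW lam0; have B1_0 : 0 <= B + 1 by rewrite addr_ge0.
  rewrite /C -[2 * lam * eps]mulrA addr_ge0 //; last exact: mulr_ge0 (ltW le0).
  by rewrite addr_ge0 ?sqr_ge0 // !mulr_ge0.
suff main d : 0 < d -> d <= 1 -> V xh <= c + C * d.
  apply: (@le_of_le_addZ _ _ _ C) => e e0.
  apply: le_trans (main (Num.min e 1) _ _) _; rewrite ?lt_min ?e0 ?ltr01 ?ge_min ?lexx ?orbT //.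
  by rewrite lerD2l ler_wpM2l // ge_min lexx.
move=> d0 d1; have d2 : 0 < d ^+ 2 by rewrite exprn_gt0.
pose Phi x := V x - d ^+ 2 * x ^+ 2.
(* Beyond N the penalty exceeds 2 B + 1, so [Phi] lies below [Phi 0] and its maximum over the line
   is attained between -N and N. *)
pose N := (2 * B + 1) / d ^+ 2 + 1.
have N1 : 1 <= N by rewrite lerDr divr_ge0 ?(ltW d2) //; lra.
have cPhi : continuous Phi.
  move=> x; apply: cvgB; first exact: cV.
  by apply: cvgM; [exact: cvg_cst|exact: exprn_continuous].
have NN : - N <= N by lra.
have [y yN hmax] := EVT_max NN (continuous_subspaceT cPhi).
move: yN; rewrite in_itv /= => /andP[yN1 yN2].
have inN x : - N <= x <= N -> Phi x <= Phi y by move=> xN; apply: hmax; rewrite in_itv.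
have far x : `|x| <= N \/ Phi x < Phi 0.
  have [xN|Nx] := leP `|x| N; [by left|right].
  have x1 : 1 <= `|x| by lra.
  have h : `|x| <= x ^+ 2 by rewrite -[x ^+ 2]real_normK ?num_real // expr2; clear -x1; nra.
  have h2 : 2 * B + 1 < d ^+ 2 * x ^+ 2.
    rewrite [d ^+ 2 * _]mulrC -ltr_pdivrMr //; apply: lt_le_trans h; move: Nx; rewrite /N; clear; lra.
  rewrite /Phi expr0n /= mulr0 subr0.
  have := hB x; have := hB 0; rewrite !ler_norml => /andP[? ?] /andP[? ?]; lra.
have max x : Phi x <= Phi y.
  case: (far x) => [|h]; first by rewrite ler_norml => xN; exact: inN.
  by apply: le_trans (ltW h) _; apply: inN; apply/andP; split; lra.
have Vy0 : d ^+ 2 * y ^+ 2 <= 2 * B.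
  have := max 0; rewrite /Phi expr0n /= mulr0 subr0.
  have := hB y; have := hB 0; rewrite !ler_norml => /andP[? ?] /andP[? ?]; lra.
have touch s : V s - V y <= (2 * d ^+ 2 * y) * (s - y) + d ^+ 2 * (s - y) ^+ 2.
  have := max s; rewrite /Phi => h.
  have -> : (2 * d ^+ 2 * y) * (s - y) + d ^+ 2 * (s - y) ^+ 2 = d ^+ 2 * s ^+ 2 - d ^+ 2 * y ^+ 2 by ring.
  by clear -h; lra.
have uy : u y = 2 * d ^+ 2 * y.
  apply/eqP; rewrite eq_le; apply/andP; split.
    by apply: (@touch_right_slope _ V u y 1 (d ^+ 2)) => // s _; exact: touch.
  by apply: (@touch_left_slope _ V u y 1 (d ^+ 2)) => // s _; exact: touch.
have if1 := split_flux_locint hf iu1; have if2 := split_flux_locint hf iu2.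
pose K x := (lam * eps)^-1 * (V x - W x) + eps^-1 * (f x (u1 x) - f x (u2 x)).
have cVW : continuous (fun x => V x - W x).
  by move=> x; apply: cvgB; [exact: cV|apply: cvgB; [exact: cW1|exact: cW2]].
have iVW := continuous_locint cVW.
have iK : locint K by apply: locintD; apply: locintZ => //; exact: locintB.
have lK : left_cont K y.
  apply: left_cont_comb; first exact: continuous_left_cont (cVW y).
  have := left_cont_comb 1 (-1) (viscous_left_cont y hf cu1) (viscous_left_cont y hf cu2).
  by rewrite (_ : (fun z => 1 * _ + _) = fun z => f z (u1 z) - f z (u2 z)) //; apply/funext => z; ring.
have hK a b : u b - u a = oint K a b.
  rewrite ointD; [|exact: locintZ|by apply: locintZ; exact: locintB].
  rewrite !ointZ //; last exact: locintB.
  have e1 := hu1 a b; have e2 := hu2 a b.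
  have iw1 : locint (fun x => V1 x - W1 x) by apply: locintB; exact: continuous_locint.
  have iw2 : locint (fun x => V2 x - W2 x) by apply: locintB; exact: continuous_locint.
  rewrite (ointD _ _ iw1 (locintZ lam if1)) (ointZ _ _ _ if1) in e1.
  rewrite (ointD _ _ iw2 (locintZ lam if2)) (ointZ _ _ _ if2) in e2.
  have -> : oint (fun x => V x - W x) a b = oint (fun x => V1 x - W1 x) a b - oint (fun x => V2 x - W2 x) a b.
    by rewrite -(ointB _ _ iw1 iw2); congr (oint _ a b); apply/funext => x; rewrite /V /W; ring.
  rewrite (ointB _ _ if1 if2).
  have lamn : lam != 0 by rewrite gt_eqF.
  have epsn : eps != 0 by rewrite gt_eqF.
  have -> : u b - u a = (lam * eps)^-1 * ((lam * eps * u1 b - lam * eps * u1 a) - (lam * eps * u2 b - lam * eps * u2 a)).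
    by rewrite /u; field; rewrite lamn epsn.
  by rewrite e1 e2; field; rewrite lamn epsn.
have Kle := @touch_left_curvature _ V u K y 1 (d ^+ 2) _ iK cu hV lK ltr01 (fun s _ => hK s y) (fun s _ => touch s) uy.
have fy : `|f y (u1 y) - f y (u2 y)| <= L * (2 * d * (B + 1)).
  apply: le_trans (split_flux_lip y _ _ hf) _; rewrite ler_wpM2l // -/(u y) uy.
  have -> : 2 * d ^+ 2 * y = 2 * d * (d * y) by ring.
  rewrite normrM gtr0_norm ?mulr_gt0 // ler_pM2l ?mulr_gt0 //.
  have : `|d * y| ^+ 2 <= (B + 1) ^+ 2.
    rewrite real_normK ?num_real // exprMn; apply: le_trans Vy0 _; clear -B0; nra.
  by rewrite ler_sqr // nnegrE; lra.
have Vy : V y <= c + lam * (L * (2 * d * (B + 1))) + 2 * lam * eps * d ^+ 2.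
  have e1 : V y - W y + lam * (f y (u1 y) - f y (u2 y)) <= lam * eps * (2 * d ^+ 2).
    have := ler_wpM2l (ltW le0) Kle; rewrite /K mulrDr mulrA divff ?gt_eqF // mul1r.
    have -> : lam * eps * (eps^-1 * (f y (u1 y) - f y (u2 y))) = lam * (f y (u1 y) - f y (u2 y)).
      by field; rewrite gt_eqF.
    by [].
  have e2 : - (lam * (f y (u1 y) - f y (u2 y))) <= lam * (L * (2 * d * (B + 1))).
    by apply: le_trans (ler_norm _) _; rewrite normrN normrM gtr0_norm // ler_pM2l.
  have e3 := hW y; rewrite -/(W y) in e3.
  by clear -e1 e2 e3; lra.
have dd : d ^+ 2 <= d by rewrite expr2 ger_pMl.
have hx := max xh; rewrite /Phi in hx.
have y2 : 0 <= d ^+ 2 * y ^+ 2 by rewrite mulr_ge0 ?sqr_ge0.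
have x2 : d ^+ 2 * xh ^+ 2 <= d * xh ^+ 2 by rewrite ler_wpM2r ?sqr_ge0.
have e4 : 2 * lam * eps * d ^+ 2 <= 2 * lam * eps * d by rewrite ler_wpM2l // -mulrA mulr_ge0 // ltW.
have -> : C * d = d * xh ^+ 2 + lam * (L * (2 * d * (B + 1))) + 2 * lam * eps * d by rewrite /C; ring.
clear -Vy hx y2 x2 e4; lra.
Qed.

Lemma viscous_sup_contraction f fl fr L eps lam W1 W2 V1 V2 u1 u2 c : split_flux f fl fr L -> 0 < eps -> 0 < lam ->
  bounded_continuous W1 -> bounded_continuous W2 -> bounded_continuous V1 -> bounded_continuous V2 ->
  viscous f eps lam W1 V1 u1 -> viscous f eps lam W2 V2 u2 ->
  (forall x, `|W1 x - W2 x| <= c) -> forall x, `|V1 x - V2 x| <= c.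
Proof.
move=> hf eps0 lam0 b1 b2 b3 b4 v1 v2 hW x.
have h1 := viscous_sup_le hf eps0 lam0 b1 b2 b3 b4 v1 v2 (fun x => le_trans (ler_norm _) (hW x)) x.
have h2 : V2 x - V1 x <= c.
  apply: (viscous_sup_le hf eps0 lam0 b2 b1 b4 b3 v2 v1) => y.
  by apply: le_trans (hW y); rewrite distrC ler_norm.
by rewrite ler_norml; apply/andP; split; lra.
Qed.

(* The resolvent identity J_lam W = J_mu (theta W + (1 - theta) J_lam W), theta = mu / lam,
   turns solvability for small mu into solvability for every lam. *)
Lemma viscous_exists f fl fr L eps lam W : split_flux f fl fr L -> 0 < eps -> 0 < lam ->
  bounded_continuous W -> exists V u, viscous f eps lam W V u /\ bounded_continuous V.
Proof.
move=> hf eps0 lam0 bW; have L0 : 0 <= L by case: hf.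
have p0 : 0 < 2 * (L + 1) by lra.
(* The first bound gives kap L <= eps / 2; as kap is at most both eps and lam, it also gives nu =
   kap^2 / eps <= lam, so that theta <= 1. *)
pose kap := Num.min (eps / (2 * (L + 1))) lam.
have k0 : 0 < kap by rewrite lt_min lam0 andbT divr_gt0.
have k1 : kap * (2 * (L + 1)) <= eps by rewrite -ler_pdivlMr // ge_min lexx.
have k2 : kap <= lam by rewrite ge_min lexx orbT.
have kL : kap * L <= eps / 2 by clear -k1 k0; lra.
set nu := kap ^+ 2 / eps.
have nu0 : 0 < nu by rewrite divr_gt0 // exprn_gt0.
have nulam : nu <= lam.
  rewrite ler_pdivrMr // expr2; apply: ler_pM; rewrite ?(ltW k0) //.
  by apply: le_trans k1; rewrite ler_peMr ?(ltW k0) //; lra.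
pose th := nu / lam.
have th0 : 0 < th by rewrite divr_gt0.
have th1 : th <= 1 by rewrite ler_pdivrMr // mul1r.
have lamn : lam != 0 by rewrite gt_eqF.
have nuE : nu = th * lam by rewrite /th; field.
have small Y := @viscous_exists_small f fl fr L eps kap Y hf eps0 k0 kL.
rewrite -/nu in small; clearbody th nu.
(* An unspecified bounded solution for each datum; the sup contraction holds for any choice. *)
pose J (Y : R -> R) : R -> R := xget (fun=> 0) [set V | bounded_continuous V /\ exists u, viscous f eps nu Y V u].
have hJ Y : bounded_continuous Y -> bounded_continuous (J Y) /\ exists u, viscous f eps nu Y (J Y) u.
  move=> bY; have [V [u [vu bV]]] := small _ bY.
  apply: (@xgetPex _ (fun=> 0) [set V | bounded_continuous V /\ exists u, viscous f eps nu Y V u]).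
  by exists V; split => //; exists u.
pose mix V x := th * W x + (1 - th) * V x.
have bmix V : bounded_continuous V -> bounded_continuous (mix V).
  move=> [cV [M hM]]; have [cW [M' hM']] := bW; split.
    by move=> x; apply: cvgD; apply: cvgM; [exact: cvg_cst|exact: cW|exact: cvg_cst|exact: cV].
  exists (th * M' + (1 - th) * M) => x; rewrite /mix; apply: le_trans (ler_normD _ _) _.
  have th1' : 0 <= 1 - th by rewrite subr_ge0.
  rewrite !normrM (gtr0_norm th0) (ger0_norm th1').
  by apply: lerD; rewrite ler_wpM2l // ?(ltW th0) // subr_ge0.
have [||||V bV fV] := @sup_fixed_point _ (fun V => J (mix V)) (1 - th).
- by rewrite subr_ge0.
- by rewrite gtrBl.
- by move=> p /bmix /hJ[].
- move=> p q c bp bq hpq.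
  have [b1 [u1 v1]] := hJ _ (bmix _ bp); have [b2 [u2 v2]] := hJ _ (bmix _ bq).
  apply: (viscous_sup_contraction hf eps0 nu0 (bmix _ bp) (bmix _ bq) b1 b2 v1 v2) => x.
  have -> : mix p x - mix q x = (1 - th) * (p x - q x) by rewrite /mix; ring.
  by rewrite normrM ger0_norm ?subr_ge0 // ler_wpM2l // subr_ge0.
have [_ [u [cu hVu hu]]] := hJ _ (bmix _ bV).
have JV : J (mix V) = V by apply/funext.
rewrite JV in hVu hu.
exists V, u; split => //; split => // a b.
have [cV _] := bV; have [cW _] := bW.
have ik : locint (fun x => V x - mix V x + nu * f x (u x)).
  have [cm _] := bmix _ bV.
  apply: locintD; first by apply: locintB; exact: continuous_locint.
  by apply: locintZ; exact: split_flux_locint hf (continuous_locint cu).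
have thn : th != 0 by rewrite gt_eqF.
(* For the fixed point, V - mix V = theta (V - W); dividing the nu-equation by theta gives the
   lam-equation. *)
have -> : lam * eps * u b - lam * eps * u a = th^-1 * (nu * eps * u b - nu * eps * u a).
  by rewrite nuE; field.
rewrite hu -ointZ //; congr (oint _ a b); apply/funext => x.
by rewrite /mix nuE; field.
Qed.

Lemma integral_abs_le (k : R -> R) M : locint k -> (forall a b, a <= b -> oint (fun x => `|k x|) a b <= M) ->
  (\int[mu]_x `|(k x)%:E| <= M%:E)%E.
Proof.
move=> ik hM; have mk := locint_meas ik.
pose F (n : nat) : set R := `[- n%:R, n%:R]%classic.
have mF n : measurable (F n) by exact: measurable_itv.
have ndF : nondecreasing_seq F.
  move=> n m nm; apply/subsetPset => x; rewrite /F /= !in_itv /= => /andP[x1 x2].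
  have : (n%:R : R) <= m%:R by rewrite ler_nat.
  by move=> h; apply/andP; split; lra.
have UF : \bigcup_n F n = setT.
  apply/seteqP; split => // x _.
  exists (Num.truncn `|x|).+1 => //; rewrite /F /= in_itv /= -ler_norml; apply: ltW; exact: truncnS_gt.
have mab : measurable_fun setT (fun x => `|(EFin \o k) x|%E) by apply: measurableT_comp => //; exact/measurable_EFinP.
have h : (fun n => \int[mu]_(x in F n) `|(EFin \o k) x|)%E @ \oo --> (\int[mu]_(x in \bigcup_n F n) `|(EFin \o k) x|)%E.
  apply: ge0_nondecreasing_set_cvg_integral => //; rewrite ?UF => // n; exact: measurable_funS mab.
rewrite UF in h.
rewrite -(cvg_lim _ h) //; apply: lime_le; first by apply/cvg_ex; eexists; exact: h.
apply: nearW => n /=.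
have nn : - (n%:R : R) <= n%:R by have := ler0n R n; lra.
have := hM _ _ nn; rewrite ointE //; last exact: locint_abs.
rewrite -lee_fin /Rintegral fineK //.
by apply: integrable_fin_num => //; exact: (locint_itv _ _ (locint_abs ik)).
Qed.

Lemma l1_integrable (k : R -> R) : l1 k -> mu.-integrable setT (EFin \o k).
Proof.
move=> [ik [M hM]]; apply/integrableP; split; first by apply/measurable_EFinP; exact: locint_meas ik.
exact: le_lt_trans (integral_abs_le ik hM) (ltry _).
Qed.

Lemma test_function_support (phi : R -> R) : test_function phi ->
  exists2 N, 0 < N & forall x, N < `|x| -> phi x = 0.
Proof.
move=> [_ /compact_bounded[M [_ hM]]].
exists (`|M| + 1); first by have := normr_ge0 M; lra.
move=> x hx; apply/eqP; apply: contraT => px.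
have := hM (`|M| + 1) ltac:(by have := ler_norm M; lra) x (@subset_closure _ [set x | phi x != 0] x px).
by move=> /= h; move: hx; rewrite ltNge h.
Qed.

Lemma derive1_zero_outside (phi : R -> R) N : smooth phi -> (forall x, N < `|x| -> phi x = 0) ->
  forall x, N < `|x| -> derive1 phi x = 0.
Proof.
move=> sp h x Nx; rewrite derive1E.
have d : is_derive x (1 : R) phi 0.
  apply: (@near_eq_is_derive _ _ _ (cst (0 : R))); near=> y; rewrite h //.
  near: y.
  have /cvgrPdist_lt/(_ (`|x| - N)) := @norm_continuous _ _ x.
  rewrite subr_gt0 => /(_ Nx); apply: filterS => y hy.
  by have := ler_norm (`|x| - `|y|); lra.
exact: derive_val.
Unshelve. all: by end_near. Qed.

Lemma viscous_solves f fl fr L eps lam w W V u : split_flux f fl fr L ->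
  locint w -> isprim W w -> viscous f eps lam W V u -> solves_resolvent f eps lam w u.
Proof.
move=> hf iw hW [cu hV hu] phi tphi.
have [sphi _] := tphi; have [N N0 h0] := test_function_support tphi.
have sp1 := smooth_derive1 sphi; have sp2 := smooth_derive1 sp1.
have h1 := derive1_zero_outside sphi h0; have h2 := derive1_zero_outside sp1 h1.
set phi1 := derive1 phi in h1 h2 sp1 sp2 *.
set phi2 := derive1 phi1 in h2 sp2 *.
have d0 := smooth_is_derive sphi; have d1 := smooth_is_derive sp1.
have c0 := smooth_continuous sphi; have c1 := smooth_continuous sp1; have c2 := smooth_continuous sp2.
have iu := continuous_locint cu.
have cV := isprim_continuous iu hV; have cW := isprim_continuous iw hW.
have ifu := split_flux_locint hf iu.
have iV := continuous_locint cV; have iW := continuous_locint cW.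
pose b := N + 1; pose a := - b.
have ab : a <= b by rewrite /a /b; lra.
have oa x : x <= a -> N < `|x| by rewrite /a /b => xa; rewrite -normrN; apply: lt_le_trans (ler_norm _); lra.
have ob x : b <= x -> N < `|x| by rewrite /b => xb; apply: lt_le_trans (ler_norm _); lra.
have supp (k g : R -> R) : locint k -> continuous g -> (forall x, N < `|x| -> g x = 0) ->
    distribution_of k g = oint (fun x => k x * g x) a b.
  move=> ik cg gN; apply: Rintegral_oint => //; first exact: locintM.
    by move=> x /oa/gN ->; rewrite mulr0.
  by move=> x /ob/gN ->; rewrite mulr0.
have ua := oa a (lexx _); have ub := ob b (lexx _).
have I1 : oint (fun x => (u x - w x) * phi x + (V x - W x) * phi1 x) a b = 0.
  have -> := oint_by_parts a b (locintB iu iw) (isprimB iu iw hV hW) c1 (derive_isprim c1 d0).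
  by rewrite !h0 // !mulr0 subrr.
have ik : locint (fun x => V x - W x + lam * f x (u x)).
  by apply: locintD; [exact: locintB|exact: locintZ].
have I2 : oint (fun x => (V x - W x + lam * f x (u x)) * phi1 x + lam * eps * u x * phi2 x) a b = 0.
  have -> := oint_by_parts a b ik hu c2 (derive_isprim c2 d1).
  by rewrite !h1 // !mulr0 subrr.
rewrite /distribution_deriv -/phi1 -/phi2 !supp //.
have ju0 : locint (fun x => u x * phi x) by exact: locintM.
have jw0 : locint (fun x => w x * phi x) by exact: locintM.
have ju2 : locint (fun x => u x * phi2 x) by exact: locintM.
have jf1 : locint (fun x => f x (u x) * phi1 x) by exact: locintM.
have jV1 : locint (fun x => (V x - W x) * phi1 x) by apply: locintM => //; exact: locintB.
move: I1 I2.
rewrite (_ : (fun x => (u x - w x) * phi x + (V x - W x) * phi1 x) =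
  (fun x => (u x * phi x - w x * phi x) + (V x - W x) * phi1 x)); last by apply/funext => x; rewrite mulrBl.
rewrite (ointD _ _ (locintB ju0 jw0) jV1) (ointB _ _ ju0 jw0).
rewrite (_ : (fun x => (V x - W x + lam * f x (u x)) * phi1 x + lam * eps * u x * phi2 x) =
  (fun x => (V x - W x) * phi1 x + lam * (f x (u x) * phi1 x) + lam * eps * (u x * phi2 x))); last first.
  by apply/funext => x; ring.
rewrite (ointD _ _ (locintD jV1 (locintZ lam jf1)) (locintZ (lam * eps) ju2)).
rewrite (ointD _ _ jV1 (locintZ lam jf1)) (ointZ _ _ _ jf1) (ointZ _ _ _ ju2).
set o1 := oint _ a b; set o2 := oint _ a b; set o3 := oint _ a b; set o4 := oint _ a b; set o5 := oint _ a b.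
clear; move=> I1 I2; nra.
Qed.

(** The solution constructed so far only has a bounded primitive. Integrability of u comes from
    [kato_line] against the zero solution, whose boundary terms are controlled by the sup norms of V
    and W. *)
Lemma resolvent_exists f fl fr L eps lam w : split_flux f fl fr L -> 0 < eps -> 0 < lam ->
  mu.-integrable setT (EFin \o w) ->
  exists2 u, mu.-integrable setT (EFin \o u) & solves_resolvent f eps lam w u.
Proof.
move=> hf eps0 lam0 /integrable_l1 lw; have [iw [Mw hMw]] := lw.
have bW : bounded_continuous (prim w).
  split; first exact: prim_continuous.
  exists Mw => x; rewrite -[prim w x]subr0 -(prim0 w) -/(oint w 0 x).
  have [x0|/ltW x0] := leP 0 x; first exact: le_trans (oint_abs iw x0) (hMw _ _ x0).
  by rewrite ointNN normrN; exact: le_trans (oint_abs iw x0) (hMw _ _ x0).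
have hW := isprim_prim w.
have [V [u [vu bV]]] := viscous_exists hf eps0 lam0 bW.
exists u; last exact: viscous_solves hf iw hW vu.
have [cu hV _] := vu; have iu := continuous_locint cu.
have [_ [BV hBV]] := bV; have [_ [BW hBW]] := bW.
apply: l1_integrable; split => //; exists (Mw + 2 * (BV + BW)) => a b ab.
have h1 : Num.min a 0 <= 0 by rewrite ge_min lexx orbT.
have h2 : 0 <= Num.max b 0 by rewrite le_max lexx orbT.
have h3 : Num.min a 0 <= a by rewrite ge_min lexx.
have h4 : b <= Num.max b 0 by rewrite le_max lexx.
apply: le_trans (oint_mono (locint_abs iu) (fun x => normr_ge0 _) h3 ab h4) _.
have hW0 : isprim (fun=> 0 : R) (fun=> 0 : R) by move=> x y; rewrite oint_cst mul0r subrr.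
have := kato_line hf eps0 lam0 iw (locint_cst 0) hW hW0 vu (viscous0 eps lam hf) h1 h2.
rewrite (_ : (fun x => `|u x - 0|) = fun x => `|u x|); last by apply/funext => x; rewrite subr0.
rewrite (_ : (fun x => `|w x - 0|) = fun x => `|w x|); last by apply/funext => x; rewrite subr0.
set c := Num.min a 0 in h1 h3 *; set d := Num.max b 0 in h2 h4 *.
move=> h; apply: le_trans h _; apply: lerD; first by apply: hMw; lra.
have bnd y (z : R) : `|(V y - prim w y - (0 - 0)) * Num.sg z| <= BV + BW.
  rewrite subrr subr0 normrM -[leRHS]mulr1 ler_pM //; last by rewrite normr_sg; case: (z != 0).
  by apply: le_trans (ler_normB _ _) _; exact: lerD.
apply: le_trans (ler_norm _) _; apply: le_trans (ler_normB _ _) _.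
have e1 := bnd d (u d - 0); have e2 := bnd c (u c - 0).
by clear -e1 e2; lra.
Qed.

End ViscousExistence.

(** * Vanishing viscosity *)


Section VanishingViscosity.
Context {R : realType}.
Implicit Types (f : R -> R -> R) (fl fr g u w V W : R -> R) (L eps lam a b c d e m x K : R).
Notation mu := (@lebesgue_measure R).

Lemma half_tail g eps1 eps2 lam W V1 V2 u1 u2 c K :
  half_viscous g eps1 lam W V1 u1 -> half_viscous g eps2 lam W V2 u2 -> c <= K ->
  oint (fun x => `|u1 x - u2 x|) c K <= V1 K + V2 K.
Proof.
move=> [cu1 hV1 u01 lV1 _] [cu2 hV2 u02 lV2 _] cK.
have i1 := continuous_locint cu1; have i2 := continuous_locint cu2.
have nd1 a b : a <= b -> V1 a <= V1 b by move=> /(isprim01_le cu1 hV1 u01)/andP[].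
have nd2 a b : a <= b -> V2 a <= V2 b by move=> /(isprim01_le cu2 hV2 u02)/andP[].
have p1 := lim_l0_ge0 nd1 lV1 c; have p2 := lim_l0_ge0 nd2 lV2 c.
apply: (@le_trans _ _ (oint (fun x => u1 x + u2 x) c K)).
  apply: oint_le => // [||x _].
  - by apply: locint_abs; exact: locintB.
  - exact: locintD.
  - have /andP[v1 _] := u01 x; have /andP[v2 _] := u02 x.
    by apply: le_trans (ler_normB _ _) _; rewrite !ger0_norm.
rewrite (ointD _ _ i1 i2) -hV1 -hV2; clear -p1 p2; lra.
Qed.

(* The right half-line is treated by reflection, hence the abstract family P. *)
Lemma half_cauchy (P : R -> (R -> R) -> (R -> R) -> Prop) g L lam w W e :
  (forall p q, `|g p - g q| <= L * `|p - q|) -> 0 < lam -> datum w W ->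
  (forall eps V u, P eps V u -> half_viscous g eps lam W V u) ->
  (forall d, 0 < d -> exists2 e0, 0 < e0 & forall eps1 eps2 V1 V2 u1 u2,
     0 < eps1 < e0 -> 0 < eps2 < e0 -> P eps1 V1 u1 -> P eps2 V2 u2 -> forall x, `|V1 x - V2 x| <= d) ->
  0 < e -> exists2 e0, 0 < e0 & forall eps1 eps2 V1 V2 u1 u2,
     0 < eps1 < e0 -> 0 < eps2 < e0 -> P eps1 V1 u1 -> P eps2 V2 u2 ->
     forall c, c <= 0 -> oint (fun x => `|u1 x - u2 x|) c 0 <= e.
Proof.
move=> gL lam0 hw hP hc e0.
have e8 : 0 < e / 8 by rewrite divr_gt0.
have e2 : 0 < e / 2 by rewrite divr_gt0.
have [r1 r10 hr1] := hc _ e8.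
(* A single reference profile fixes the point K beyond which the mass is small; uniform closeness of
   the primitives transfers this to all small viscosities. If no profile exists for small eps, the
   claim is vacuous. *)
have [[eps [V [u [epsr pV]]]]|no] := pselect (exists eps V u, 0 < eps < r1 /\ P eps V u); last first.
  by exists r1 => // eps1 ? V1 ? u1 ? h _ p1; case: no; exists eps1, V1, u1.
have [_ _ _ lV _] := hP _ _ _ pV.
have [X hX] := lV _ e8; pose K := Num.min X 0.
have K0 : K <= 0 by rewrite ge_min lexx orbT.
have VK : `|V K - 0| <= e / 8 by apply: hX; rewrite ge_min lexx.
have [rho rho0 hrho] := half_L1_of_sup lam0 hw K0 e2.
have [r2 r20 hr2] := hc _ rho0.
exists (Num.min r1 r2); first by rewrite lt_min r10.
move=> eps1 eps2 V1 V2 u1 u2 /andP[h1]; rewrite lt_min => /andP[h11 h12].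
move=> /andP[h2]; rewrite lt_min => /andP[h21 h22] p1 p2 c c0.
have v1 := hP _ _ _ p1; have v2 := hP _ _ _ p2.
have iabs : locint (fun x => `|u1 x - u2 x|).
  by have [c1 _ _ _ _] := v1; have [c2 _ _ _ _] := v2; apply: locint_abs; apply: locintB; exact: continuous_locint.
pose c' := Num.min c K.
have cc : c' <= c by rewrite ge_min lexx.
have cK : c' <= K by rewrite ge_min lexx orbT.
apply: le_trans (oint_mono iabs (fun x => normr_ge0 _) cc c0 (lexx 0)) _.
rewrite -(oint_chasles _ c' K 0).
have t := half_tail v1 v2 cK.
have s1 := hr1 eps1 eps V1 V u1 u ltac:(by rewrite h1) epsr p1 pV K.
have s2 := hr1 eps2 eps V2 V u2 u ltac:(by rewrite h2) epsr p2 pV K.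
have s3 := hrho g L eps1 eps2 V1 V2 u1 u2 gL h1 h2 v1 v2
  (hr2 eps1 eps2 V1 V2 u1 u2 ltac:(by rewrite h1) ltac:(by rewrite h2) p1 p2).
move: VK s1 s2; rewrite !ler_norml => /andP[_ a1] /andP[_ a2] /andP[_ a3].
clear -t s3 a1 a2 a3; lra.
Qed.

Lemma datum_reflect w W m : datum w W -> datum (fun x => w (- x)) (fun x => m - W (- x)).
Proof.
move=> [iw hW h]; split; first exact: locint_reflect.
  by move=> a b; rewrite oint_reflect // -hW; ring.
move=> a b ab; have := h (- b) (- a) ltac:(by rewrite lerN2).
rewrite (_ : - a - - b = b - a); last by ring.
by rewrite (_ : m - W (- b) - (m - W (- a)) = W (- a) - W (- b)) //; ring.
Qed.

Lemma profile_sup_cauchy f fl fr L lam w W d : split_flux f fl fr L -> 0 < lam -> datum w W -> 0 < d ->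
  exists2 e0, 0 < e0 & forall eps1 eps2 V1 V2 u1 u2, 0 < eps1 < e0 -> 0 < eps2 < e0 ->
    profile f eps1 lam W V1 u1 -> profile f eps2 lam W V2 u2 -> forall x, `|V1 x - V2 x| <= d.
Proof.
move=> hf lam0 hw d0; have eta0 : 0 < d / 8 by rewrite divr_gt0.
(* With eta = d / 8, this threshold gives lam (eps1 + eps2) / eta <= d / 4, and 2 (2 eta + d / 4) =
   d. *)
exists (d ^+ 2 / (64 * lam)); first by rewrite divr_gt0 ?exprn_gt0 ?mulr_gt0.
move=> eps1 eps2 V1 V2 u1 u2 /andP[h1 h1'] /andP[h2 h2'] p1 p2 x.
apply: le_trans (profile_close hf h1 h2 lam0 eta0 hw p1 p2 x) _.
move: h1' h2'; rewrite !ltr_pdivlMr ?mulr_gt0 // => h1' h2'.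
have : lam * (eps1 + eps2) / (d / 8) <= d / 4.
  rewrite ler_pdivrMr //; clear -h1' h2' d0; lra.
by clear; lra.
Qed.

Lemma profile_L1_cauchy f fl fr L lam w W m e : split_flux f fl fr L -> 0 < lam ->
  datum w W -> lim_r W m -> 0 < e ->
  exists2 e0, 0 < e0 & forall eps1 eps2 V1 V2 u1 u2, 0 < eps1 < e0 -> 0 < eps2 < e0 ->
    profile f eps1 lam W V1 u1 -> profile f eps2 lam W V2 u2 ->
    forall a b, a <= b -> oint (fun x => `|u1 x - u2 x|) a b <= e.
Proof.
move=> hf lam0 hw hm e0.
have e2 : 0 < e / 2 by rewrite divr_gt0.
have [_ hl hr _ _] := hf.
have hr' s t : `|- fr s - - fr t| <= L * `|s - t| by rewrite -opprD normrN; exact: hr.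
have supc d (d0 : 0 < d) := profile_sup_cauchy hf lam0 hw d0.
(* Reflected profiles, all with the same m: by decay of V - W every V has the limit of W at +oo, and
   m cancels in differences. *)
pose Q eps (V' u' : R -> R) := exists V u, [/\ profile f eps lam W V u, V' = fun x => m - V (- x) & u' = fun x => u (- x)].
have hQ eps V' u' : Q eps V' u' -> half_viscous (fun t => - fr t) eps lam (fun x => m - W (- x)) V' u'.
  move=> [V [u [pV -> ->]]]; have [m' hV hW'] := profile_lim_r pV.
  by apply: profile_half_right hf hw pV _; rewrite (lim_r_uniq hm hW').
have cQ d : 0 < d -> exists2 e0, 0 < e0 & forall eps1 eps2 V1 V2 u1 u2,
    0 < eps1 < e0 -> 0 < eps2 < e0 -> Q eps1 V1 u1 -> Q eps2 V2 u2 -> forall x, `|V1 x - V2 x| <= d.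
  move=> /supc[r r0 h]; exists r => // eps1 eps2 _ _ _ _ h1 h2 [V1 [u1 [p1 -> _]]] [V2 [u2 [p2 -> _]]] x.
  rewrite (_ : _ - _ = V2 (- x) - V1 (- x)); last by ring.
  by rewrite distrC; exact: h p1 p2 _.
have [r1 r10 hr1] := half_cauchy hl lam0 hw (fun eps V u => profile_half_left hf hw) supc e2.
have [r2 r20 hr2] := half_cauchy hr' lam0 (datum_reflect m hw) hQ cQ e2.
exists (Num.min r1 r2); first by rewrite lt_min r10.
move=> eps1 eps2 V1 V2 u1 u2 /andP[h1]; rewrite lt_min => /andP[h11 h12].
move=> /andP[h2]; rewrite lt_min => /andP[h21 h22] p1 p2 a b ab.
have iabs : locint (fun x => `|u1 x - u2 x|).
  have [[c1 _ _] _ _ _] := p1; have [[c2 _ _] _ _ _] := p2.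
  by apply: locint_abs; apply: locintB; exact: continuous_locint.
have a0 : Num.min a 0 <= 0 by rewrite ge_min lexx orbT.
have b0 : - Num.max b 0 <= 0 by rewrite oppr_le0 le_max lexx orbT.
have aa : Num.min a 0 <= a by rewrite ge_min lexx.
have bb : b <= Num.max b 0 by rewrite le_max lexx.
apply: le_trans (oint_mono iabs (fun x => normr_ge0 _) aa ab bb) _.
rewrite -(oint_chasles _ _ 0).
have s1 := hr1 eps1 eps2 V1 V2 u1 u2 ltac:(by rewrite h1) ltac:(by rewrite h2) p1 p2 _ a0.
have s2 := hr2 eps1 eps2 _ _ _ _ ltac:(by rewrite h1) ltac:(by rewrite h2)
  (ex_intro _ V1 (ex_intro _ u1 (And3 p1 erefl erefl))) (ex_intro _ V2 (ex_intro _ u2 (And3 p2 erefl erefl))) _ b0.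
rewrite (oint_reflect _ _ iabs) oppr0 opprK in s2.
clear -s1 s2; lra.
Qed.

End VanishingViscosity.


(** * Completeness of L1 along rapidly converging sequences *)

Section L1Completeness.
Context {R : realType}.
Implicit Types (u v w k : R -> R) (U : nat -> R -> R) (e x : R) (M : \bar R).
Notation mu := (@lebesgue_measure R).

Lemma L1_normE u : L1_norm u = (\int[mu]_x `|(u x)%:E|)%E.
Proof. by rewrite /L1_norm Lnorm1. Qed.

Lemma L1_distC u v : L1_norm (u \- v) = L1_norm (v \- u).
Proof. by rewrite !L1_normE; apply: eq_integral => x _ /=; rewrite distrC. Qed.

Lemma L1_norm_triangle u v w : measurable_fun setT u -> measurable_fun setT v -> measurable_fun setT w ->
  (L1_norm (u \- w)%R <= L1_norm (u \- v)%R + L1_norm (v \- w)%R)%E.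
Proof.
move=> m1 m2 m3; rewrite {1}(_ : u \- w = (u \- v) \+ (v \- w)); last by apply/funext => x /=; ring.
by apply: eminkowski => //; exact: measurable_funB.
Qed.

Lemma eq_L1_norm_ae u v : measurable_fun setT u -> measurable_fun setT v ->
  {ae mu, forall x, u x = v x} -> L1_norm u = L1_norm v.
Proof.
move=> m1 m2 uv; rewrite !L1_normE; apply: ge0_ae_eq_integral => //.
- by apply: measurableT_comp => //; exact/measurable_EFinP.
- by apply: measurableT_comp => //; exact/measurable_EFinP.
- by move: uv; apply: filterS; [exact: (ae_filter_ringOfSetsType mu)|move=> x -> _].
Qed.

Lemma L1_norm_eq0 u : measurable_fun setT u -> (L1_norm u <= 0)%E -> {ae mu, forall x, u x = 0}.
Proof.
move=> m; rewrite L1_normE => u0.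
have mE : measurable_fun setT (EFin \o u) by exact/measurable_EFinP.
have z : (\int[mu]_x `|(EFin \o u) x|)%E = 0%E by apply/eqP; rewrite eq_le u0 integral_ge0.
have h : {ae mu, forall x, setT x -> (EFin \o u) x = 0%E} := (ae_eq_integral_abs mu measurableT mE).1 z.
move: h; apply: filterS; first exact: (ae_filter_ringOfSetsType mu).
by move=> x /(_ I) /= [].
Qed.

(** The Riesz-Fischer argument: the series of |U (n+1) - U n| is integrable, hence finite almost
    everywhere, and together with |U 0| it dominates the sequence. *)
Lemma L1_fast_cauchy U : (forall n, mu.-integrable setT (EFin \o U n)) ->
  (forall n, (L1_norm (U n.+1 \- U n)%R <= (2^-1 ^+ n)%:E)%E) ->
  exists2 v, mu.-integrable setT (EFin \o v) & L1_norm (U n \- v) @[n --> \oo] --> 0%E.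
Proof.
move=> iU hU.
have mU n : measurable_fun setT (U n) by apply/measurable_EFinP; exact: measurable_int (iU n).
pose d n x := `|(U n.+1 x - U n x)%:E|%E.
have md n : measurable_fun setT (d n).
  by apply: measurableT_comp => //; apply/measurable_EFinP; exact: measurable_funB.
have d0 n x : (0 <= d n x)%E by exact: abse_ge0.
pose S x := (\sum_(n <oo) d n x)%E.
have S0 x : (0 <= S x)%E by apply: nneseries_ge0 => n _ _; exact: d0.
have mS : measurable_fun setT S by apply: ge0_emeasurable_sum.
have iS : mu.-integrable setT S.
  apply/integrableP; split => //.
  rewrite (_ : (\int[mu]_x `|S x|)%E = (\int[mu]_x S x)%E); last by apply: eq_integral => x _; rewrite gee0_abs.
  rewrite integral_nneseries //.
  apply: (@le_lt_trans _ _ 2%:E); last exact: ltry.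
  apply: lime_le; first by apply: is_cvg_nneseries => n _ _; exact: integral_ge0.
  apply: nearW => n.
  have : (\sum_(0 <= i < n) \int[mu]_x d i x <= (2 - 2 * 2^-1 ^+ n)%:E)%E.
    elim: n => [|n IH]; first by rewrite big_geq // expr0 mulr1 subrr.
    rewrite big_nat_recr //= (_ : 2 - 2 * 2^-1 ^+ n.+1 = (2 - 2 * 2^-1 ^+ n) + 2^-1 ^+ n); last first.
      by rewrite exprS; field.
    rewrite EFinD leeD //.
    by have := hU n; rewrite L1_normE.
  move/le_trans; apply; rewrite lee_fin.
  have : (0 : R) <= 2^-1 ^+ n by rewrite exprn_ge0 // invr_ge0.
  by lra.
pose G x := (`|(U 0%N x)%:E| + S x)%E.
have iG : mu.-integrable setT G by apply: integrableD => //; exact: integrable_abse (iU 0%N).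
have bnd n x : (`|(U n x)%:E| <= `|(U 0%N x)%:E| + \sum_(0 <= i < n) d i x)%E.
  elim: n => [|n IH]; first by rewrite big_geq // adde0.
  rewrite big_nat_recr // addeA.
  rewrite (_ : U n.+1 x = U n x + (U n.+1 x - U n x)); last by ring.
  by rewrite EFinD; apply: le_trans (lee_abs_add _ _) _; rewrite leeD2r.
have bndG n x : (`|(U n x)%:E| <= G x)%E.
  apply: le_trans (bnd n x) _; rewrite leeD2l //.
  by apply: nneseries_lim_ge => i _ _; exact: d0.
(* The upper limit is defined and measurable everywhere, and equals the limit wherever the series is
   finite. *)
pose F x := limn_esup (fun n => (U n x)%:E).
have mF : measurable_fun setT F.
  by apply: (measurable_fun_limn_esup (f := fun n x => (U n x)%:E)) => n; exact/measurable_EFinP.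
have cF : {ae mu, forall x, setT x -> (fun n => (U n x)%:E) @ \oo --> F x}.
  have Sf : {ae mu, forall x, setT x -> S x \is a fin_num} := integrable_ae measurableT iS.
  move: Sf; apply: filterS; first exact: (ae_filter_ringOfSetsType mu).
  move=> x /(_ I) Sfin _.
  have c : cvgn (fun n => U n x).
    have cs : cvgn (series (telescope (fun n => U n x))).
      apply: normed_cvg; apply: nondecreasing_is_cvgn.
        by apply: nondecreasing_series => i _ _ /=.
      exists (fine (S x)) => _ [n _ <-].
      rewrite -lee_fin fineK // (_ : _%:E = \sum_(0 <= i < n) d i x)%E; last by rewrite sumEFin.
      by apply: (@nneseries_lim_ge _ (fun i => d i x) xpredT 0 n) => i _ _; exact: d0.
    rewrite telescopeK in cs.
    rewrite (_ : (fun n => U n x) = (fun n => (U n x - U 0%N x) + U 0%N x)); last by apply/funext => n; ring.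
    by apply: is_cvgD => //; exact: is_cvg_cst.
  have ce : cvgn (fun n => (U n x)%:E) by apply/cvg_ex; exists (limn (fun n => U n x))%:E; apply/fine_cvgP; split; [exact: nearW|exact: c].
  by rewrite /F is_cvg_limn_esupE.
have [iF cv _] := @dominated_convergence _ _ R mu setT measurableT (fun n x => (U n x)%:E) F G
  (fun n => (measurable_EFinP _ _).2 (mU n)) mF cF iG (aeW mu (fun x n _ => bndG n x)).
have Ff : {ae mu, forall x, setT x -> F x \is a fin_num} := integrable_ae measurableT iF.
pose v x := fine (F x).
have mv : measurable_fun setT v by apply: measurableT_comp => //; exact: measurable_fine.
have vF : {ae mu, forall x, setT x -> F x = (v x)%:E}.
  by move: Ff; apply: filterS; [exact: (ae_filter_ringOfSetsType mu)|move=> x /(_ I) h _; rewrite fineK].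
have mvE : measurable_fun setT (EFin \o v) by exact/measurable_EFinP.
exists v.
  have [_ Foo] := integrableP _ _ _ iF.
  apply/integrableP; split => //; apply: le_lt_trans Foo; apply: ae_ge0_le_integral => //.
  - exact: measurableT_comp.
  - exact: measurableT_comp.
  - by move: vF; apply: filterS; [exact: (ae_filter_ringOfSetsType mu)|move=> x h xT; rewrite h].
rewrite (_ : (fun n => _) = fun n => (\int[mu]_x `|(U n x)%:E - F x|)%E) //.
apply/funext => n; rewrite L1_normE; apply: ge0_ae_eq_integral => //.
- by apply: measurableT_comp => //; apply/measurable_EFinP; exact: measurable_funB (mU n) mv.
- apply: measurableT_comp => //; apply: emeasurable_funB => //; by apply/measurable_EFinP; exact: mU.
- by move: vF; apply: filterS; [exact: (ae_filter_ringOfSetsType mu)|move=> x h xT; rewrite h].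
Qed.

End L1Completeness.


(** * L1 limits as the viscosity tends to 0 from the right *)

Section LimitAtZero.
Context {R : realType}.
Implicit Types (u : R -> R -> R) (v w : R -> R) (e s t x : R).
Notation mu := (@lebesgue_measure R).

Lemma cvge0_near_le (T : Type) (F : set_system T) {FF : Filter F} (h : T -> \bar R) e :
  h x @[x --> F] --> 0%E -> 0 < e -> \forall x \near F, (h x <= e%:E)%E.
Proof.
move=> /fine_cvgP[hf /cvgrPdist_le hc] e0; have := hc _ e0; apply: filterS2 hf => x hx.
by rewrite sub0r normrN => h1; rewrite -(fineK hx) lee_fin; apply: le_trans h1; exact: ler_norm.
Qed.

Lemma L1_limit0P u v : L1_limit0 u v <-> forall e, 0 < e -> exists2 r, 0 < r &
  forall s, 0 < s < r -> (L1_norm (u s \- v)%R <= e%:E)%E.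
Proof.
split=> [h e e0|h].
  have [r /= r0 hr] := cvge0_near_le h e0.
  exists r => // s /andP[s0 sr]; apply: hr => //=.
  by rewrite sub0r normrN gtr0_norm.
have L0 s : (0 <= L1_norm (u s \- v)%R)%E by exact: Lnorm_ge0.
have bnd e : 0 < e -> \forall s \near 0^'+, (L1_norm (u s \- v)%R <= e%:E)%E.
  move=> /h[r r0 hr]; exists r => // s /=; rewrite sub0r normrN => sr s0; apply: hr.
  by rewrite s0 /=; apply: le_lt_trans sr; exact: ler_norm.
have fin s e : (L1_norm (u s \- v)%R <= e%:E)%E -> L1_norm (u s \- v)%R \is a fin_num.
  by move=> he; rewrite ge0_fin_numE //; apply: le_lt_trans he (ltry _).
apply/fine_cvgP; split.
  by have := bnd 1 ltr01; apply: filterS => s; exact: fin.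
apply/cvgrPdist_le => e e0; have := bnd _ e0; apply: filterS => s he /=.
rewrite sub0r normrN ger0_norm ?fine_ge0 // -lee_fin fineK //; exact: fin he.
Qed.

Lemma Lfun1_meas v : v \in Lfun mu 1 -> measurable_fun setT v.
Proof. by move=> /Lfun1_integrable /(measurable_int _) /measurable_EFinP. Qed.

Lemma L1_complete0 u : (forall s, 0 < s -> u s \in Lfun mu 1) ->
  (forall e, 0 < e -> exists2 r, 0 < r & forall s t, 0 < s < r -> 0 < t < r ->
     (L1_norm (u s \- u t)%R <= e%:E)%E) ->
  exists2 v, v \in Lfun mu 1 & L1_limit0 u v.
Proof.
move=> Lu hc.
have /choice[r hr] : forall n : nat, exists r : R, 0 < r /\ forall s t, 0 < s < r -> 0 < t < r ->
    (L1_norm (u s \- u t)%R <= (2^-1 ^+ n)%:E)%E.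
  move=> n; have [|r r0 h] := hc (2^-1 ^+ n); first by rewrite exprn_gt0 // invr_gt0.
  by exists r.
(* The running minimum of the thresholds, so that p (n + k) / 2 lies strictly below r n for all k
   and consecutive terms at p n / 2 are 2^-n close. *)
pose p := fix p n := if n is n'.+1 then Num.min (p n') (r n) else r 0%N.
have p0 n : 0 < p n by elim: n => [|n IH] /=; [case: (hr 0%N)|rewrite lt_min IH; case: (hr n.+1)].
have pr n : p n <= r n by case: n => [|n] //=; rewrite ge_min lexx orbT.
have pd n k : p (n + k)%N <= p n.
  by elim: k => [|k IH]; rewrite ?addn0 // addnS /= ge_min IH.
have sp n k : 0 < p (n + k)%N / 2 < r n.
  rewrite divr_gt0 //=; have := pr n; have := pd n k; have := p0 (n + k)%N; clear; lra.
have [|n|v iv cv] := @L1_fast_cauchy R (fun n => u (p n / 2)).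
- by move=> n; apply/Lfun1_integrable; apply: Lu; rewrite divr_gt0.
- by apply: (hr n).2; [have := sp n 1%N; rewrite addn1|have := sp n 0%N; rewrite addn0].
have mv : measurable_fun setT v by apply/measurable_EFinP; exact: measurable_int iv.
exists v; first exact/Lfun1_integrable.
apply/L1_limit0P => e e0; have e2 : 0 < e / 2 by rewrite divr_gt0.
have [k hk] : exists k : nat, 2^-1 ^+ k <= e / 2.
  have halfpow : (fun n => (2^-1 ^+ n : R)%:E) @ \oo --> 0%E.
    apply/fine_cvgP; split; first exact: nearW.
    by apply: cvg_expr; rewrite ger0_norm ?invr_ge0 // invf_lt1 // ltr1n.
  have [k _ hk] := cvge0_near_le (F := \oo) (h := fun n => (2^-1 ^+ n)%:E) halfpow e2.
  by exists k; rewrite -lee_fin; apply: hk => /=.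
exists (r k) => [|s sr]; first by case: (hr k).
have [n _ hn] := cvge0_near_le cv e2.
have := hn (k + n)%N (leq_addl _ _) => /= h1.
have s0 : 0 < s by case/andP: sr.
apply: le_trans (L1_norm_triangle (Lfun1_meas (Lu _ s0)) (v := u (p (k + n)%N / 2)) _ mv) _.
  by apply: Lfun1_meas; apply: Lu; rewrite divr_gt0.
rewrite [e]splitr EFinD leeD //.
apply: le_trans ((hr k).2 _ _ sr (sp k n)) _; by rewrite lee_fin.
Qed.

Lemma L1_limit0_uniq u v w : (forall s, 0 < s -> measurable_fun setT (u s)) ->
  measurable_fun setT v -> measurable_fun setT w -> L1_limit0 u v -> L1_limit0 u w ->
  {ae mu, forall x, v x = w x}.
Proof.
move=> mu_ mv mw /L1_limit0P hv /L1_limit0P hw.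
have mvw : measurable_fun setT (v \- w) by exact: measurable_funB.
have := L1_norm_eq0 mvw _ => h.
have : {ae mu, forall x, (v \- w) x = 0}.
  apply: h; apply/lee_addgt0Pr => e e0; rewrite add0e.
  have e2 : 0 < e / 2 by rewrite divr_gt0.
  have [r r0 hr] := hv _ e2; have [q q0 hq] := hw _ e2.
  pose s := Num.min r q / 2.
  have s0 : 0 < Num.min r q by rewrite lt_min r0.
  have m1 : Num.min r q <= r by rewrite ge_min lexx.
  have m2 : Num.min r q <= q by rewrite ge_min lexx orbT.
  have h1 := hr s ltac:(by rewrite /s; apply/andP; split; lra).
  have h2 := hq s ltac:(by rewrite /s; apply/andP; split; lra).
  apply: le_trans (L1_norm_triangle mv (mu_ s _) mw) _; first by rewrite divr_gt0.
  by rewrite [e]splitr EFinD leeD // L1_distC.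
by apply: filterS; [exact: (ae_filter_ringOfSetsType mu)|move=> x /= /eqP; rewrite subr_eq0 => /eqP].
Qed.

(** Truncation to [0, 1] is the nearest-point projection, so v is at least as close to its
    truncation as to any u s; letting s -> 0, v equals its truncation almost everywhere. *)
Lemma L1_limit0_01 u v : (forall s, 0 < s -> measurable_fun setT (u s)) -> measurable_fun setT v ->
  (forall s, 0 < s -> {ae mu, forall x, 0 <= u s x <= 1}) -> L1_limit0 u v ->
  {ae mu, forall x, 0 <= v x <= 1}.
Proof.
move=> mu_ mv u01 /L1_limit0P hv; pose w x := Num.max 0 (Num.min (v x) 1).
have mw : measurable_fun setT w.
  by apply: measurable_maxr; [exact: measurable_cst|apply: measurable_minr => //; exact: measurable_cst].
have mvw : measurable_fun setT (v \- w) by exact: measurable_funB.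
have h := L1_norm_eq0 mvw _.
have : {ae mu, forall x, (v \- w) x = 0}.
  apply: h; apply/lee_addgt0Pr => e e0; rewrite add0e.
  have [r r0 hr] := hv _ e0.
  have s0 : 0 < r / 2 by rewrite divr_gt0.
  have h1 := hr (r / 2) ltac:(by rewrite s0 /=; lra).
  apply: le_trans h1; rewrite !L1_normE; apply: ae_ge0_le_integral => //.
  - by apply: measurableT_comp => //; apply/measurable_EFinP.
  - by apply: measurableT_comp => //; apply/measurable_EFinP; exact: measurable_funB (mu_ _ s0) mv.
  move: (u01 _ s0); apply: filterS; first exact: (ae_filter_ringOfSetsType mu).
  move=> x /andP[a1 a2] _ /=; rewrite lee_fin /w.
  have [v1|v1] := leP (v x) 1.
    have [v0|v0] := leP 0 (v x); first by rewrite subrr normr0.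
    by rewrite subr0 ltr0_norm // ger0_norm; lra.
  rewrite max_r ?ler01 // (gtr0_norm (_ : 0 < v x - 1)) ?subr_gt0 // ltr0_norm; lra.
apply: filterS; first exact: (ae_filter_ringOfSetsType mu).
move=> x /= /eqP; rewrite subr_eq0 => /eqP ->.
by rewrite /w le_max lexx /= ge_max ler01 ge_min lexx orbT.
Qed.

End LimitAtZero.


(** * Transfer of the estimates to the selected solutions *)

Section Resolvent.
Context {R : realType}.
Implicit Types (f : R -> R -> R) (fl fr u w V W : R -> R) (L eps lam a b c d e m x s t : R).
Notation mu := (@lebesgue_measure R).

Lemma hyp_f1_split_flux f : hyp_f1 f -> exists fl fr L, split_flux f fl fr L /\ fl 1 = fr 1.
Proof.
move=> [[_ _ [L L0 hL] _] [fl [fr [hf _ h0 h1]]]]; exists fl, fr, L; split => //; split => // s t.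
  by have := hL 0 s t; rewrite !hf lexx.
by have := hL 1 s t; rewrite !hf ler10.
Qed.

(** Ensures that the profiles for different viscosities share one primitive W of the datum, as their
    comparison requires. *)
Lemma isprim_uniq W W' w : isprim W w -> isprim W' w -> lim_l W 0 -> lim_l W' 0 -> W' = W.
Proof.
move=> h h' l l'; apply/funext => x; apply/eqP; rewrite -subr_eq0 -normr_le0.
apply/ler_addgt0Pl => e e0; rewrite addr0.
have e2 : 0 < e / 2 by rewrite divr_gt0.
have [X hX] := l _ e2; have [Y hY] := l' _ e2.
have h1 := hX (Num.min X Y) ltac:(by rewrite ge_min lexx).
have h2 := hY (Num.min X Y) ltac:(by rewrite ge_min lexx orbT).
have h3 := h (Num.min X Y) x; have h4 := h' (Num.min X Y) x.
rewrite (_ : W' x - W x = (W' (Num.min X Y) - 0) - (W (Num.min X Y) - 0)); last by clear -h3 h4; lra.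
apply: le_trans (ler_normB _ _) _; clear -h1 h2; lra.
Qed.

Lemma D_datum w : D w -> exists W m, [/\ datum w W, lim_l W 0 & lim_r W m].
Proof.
move=> [/Lfun1_integrable/integrable_l1 lw w01]; have [iw _] := lw.
have [c hc] := l1_prim_lim_l lw; have [d hd] := l1_prim_lim_r lw.
exists (fun x => prim w x - c), (d - c); split.
- by apply: ae_datum => // a b; rewrite /oint; ring.
- by move=> e /hc[X hX]; exists X => x /hX; rewrite subr0.
- move=> e /hd[X hX]; exists X => x /hX.
  by rewrite (_ : prim w x - c - (d - c) = prim w x - d) //; ring.
Qed.

(** Existence shows that the choice in [Jeps] is a genuine solution, and regularity, valid for every
    L1 solution, turns the chosen one into a profile. *)
Lemma Jeps_profile f fl fr L eps lam w W : split_flux f fl fr L -> fl 1 = fr 1 -> 0 < eps -> 0 < lam ->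
  D w -> isprim W w -> lim_l W 0 ->
  Jeps f eps lam w \in Lfun mu 1 /\
  exists V u, profile f eps lam W V u /\ {ae mu, forall x, Jeps f eps lam w x = u x}.
Proof.
move=> hf f1 eps0 lam0 [wL w01] hW lW.
have wi : mu.-integrable setT (EFin \o w) by exact/Lfun1_integrable.
have iw := integrable_locint wi.
have [JL Js] : Jeps f eps lam w \in Lfun mu 1 /\ solves_resolvent f eps lam w (Jeps f eps lam w).
  have [u0 u0i u0s] := resolvent_exists hf eps0 lam0 wi.
  apply: (@xgetPex _ (fun=> 0) [set u | u \in Lfun mu 1 /\ solves_resolvent f eps lam w u]).
  by exists u0; split => //; exact/Lfun1_integrable.
split => //; have Ji : mu.-integrable setT (EFin \o Jeps f eps lam w) by exact/Lfun1_integrable.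
have [u [V [W' [vu hW' lu Ju [lV lW' lVW]]]]] := solution_regularity hf eps0 lam0 Ji wi Js.
rewrite (isprim_uniq hW hW' lW lW') in vu lVW.
exists V, u; split => //; split => // x.
apply/andP; split.
  apply: (viscous_ge0 hf eps0 lam0 iw hW _ vu) => //.
  by move: w01; apply: filterS => y /andP[].
apply: (viscous_le1 hf f1 eps0 lam0 iw hW _ lu vu).
by move: w01; apply: filterS => y /andP[].
Qed.

Lemma L1_dist_le u1 u2 v1 v2 e : measurable_fun setT u1 -> measurable_fun setT u2 ->
  locint v1 -> locint v2 -> {ae mu, forall x, u1 x = v1 x} -> {ae mu, forall x, u2 x = v2 x} ->
  (forall a b, a <= b -> oint (fun x => `|v1 x - v2 x|) a b <= e) ->
  (L1_norm (u1 \- u2)%R <= e%:E)%E.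
Proof.
move=> m1 m2 i1 i2 e1 e2 h; have iv := locintB i1 i2.
rewrite (@eq_L1_norm_ae _ _ (fun x => v1 x - v2 x)).
- by rewrite L1_normE; exact: integral_abs_le iv h.
- exact: measurable_funB.
- exact: locint_meas iv.
- by move: e1 e2; apply: filterS2; [exact: (ae_filter_ringOfSetsType mu)|move=> x /= -> ->].
Qed.

Lemma Jeps_01 f fl fr L eps lam w : split_flux f fl fr L -> fl 1 = fr 1 -> 0 < eps -> 0 < lam ->
  D w -> {ae mu, forall x, 0 <= Jeps f eps lam w x <= 1}.
Proof.
move=> hf f1 eps0 lam0 Dw; have [W [_ [[_ hW _] lW _]]] := D_datum Dw.
have [_ [V [u [[_ _ u01 _] eu]]]] := Jeps_profile hf f1 eps0 lam0 Dw hW lW.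
by move: eu; apply: filterS; [exact: (ae_filter_ringOfSetsType mu)|move=> x ->].
Qed.

Lemma Jeps_cauchy f fl fr L lam w e : split_flux f fl fr L -> fl 1 = fr 1 -> 0 < lam -> D w -> 0 < e ->
  exists2 r, 0 < r & forall s t, 0 < s < r -> 0 < t < r ->
    (L1_norm (Jeps f s lam w \- Jeps f t lam w)%R <= e%:E)%E.
Proof.
move=> hf f1 lam0 Dw e0; have [W [m [hw lW rW]]] := D_datum Dw.
have [r r0 hr] := profile_L1_cauchy hf lam0 hw rW e0; have [_ hW _] := hw.
exists r => // s t hs ht; have [/andP[s0 _] /andP[t0 _]] := conj hs ht.
have [Ls [V1 [u1 [p1 e1]]]] := Jeps_profile hf f1 s0 lam0 Dw hW lW.
have [Lt [V2 [u2 [p2 e2]]]] := Jeps_profile hf f1 t0 lam0 Dw hW lW.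
have [[c1 _ _] _ _ _] := p1; have [[c2 _ _] _ _ _] := p2.
apply: L1_dist_le e1 e2 (hr _ _ _ _ _ _ hs ht p1 p2); try exact: Lfun1_meas; exact: continuous_locint.
Qed.

Lemma Jeps_contraction f fl fr L eps lam w1 w2 : split_flux f fl fr L -> fl 1 = fr 1 -> 0 < eps -> 0 < lam ->
  D w1 -> D w2 ->
  (L1_norm (Jeps f eps lam w1 \- Jeps f eps lam w2)%R <= L1_norm (w1 \- w2)%R)%E.
Proof.
move=> hf f1 eps0 lam0 D1 D2.
have [W1 [m1 [[iw1 hW1 _] lW1 _]]] := D_datum D1; have [W2 [m2 [[iw2 hW2 _] lW2 _]]] := D_datum D2.
have [L1 [V1 [u1 [[v1 d1 _ _] e1]]]] := Jeps_profile hf f1 eps0 lam0 D1 hW1 lW1.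
have [L2 [V2 [u2 [[v2 d2 _ _] e2]]]] := Jeps_profile hf f1 eps0 lam0 D2 hW2 lW2.
have [c1 _ _] := v1; have [c2 _ _] := v2.
have iw : mu.-integrable setT (EFin \o (w1 \- w2)).
  have [/Lfun1_integrable i1 _] := D1; have [/Lfun1_integrable i2 _] := D2.
  exact: (integrableB measurableT i1 i2).
have wfin : L1_norm (w1 \- w2) \is a fin_num.
  by rewrite L1_normE; apply: integrable_fin_num => //; exact: integrable_abse.
rewrite -(fineK wfin).
apply: L1_dist_le e1 e2 _; try exact: Lfun1_meas; try exact: continuous_locint.
apply: (viscous_contraction hf eps0 lam0 iw1 iw2 hW1 hW2 v1 v2 d1 d2) => a b ab.
have ii := locint_abs (locintB iw1 iw2).
rewrite -lee_fin fineK // ointE // /Rintegral fineK; last first.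
  by apply: integrable_fin_num => //; exact: locint_itv.
rewrite L1_normE; apply: ge0_subset_integral => //.
by apply/measurable_EFinP; exact: locint_meas ii.
Qed.

End Resolvent.

Theorem theorem4p5 (R : realType) (f : R -> R -> R) (hf : hyp_f1 f)
    (lambda : R) (hlambda : 0 < lambda) :
  exists J : (R -> R) -> (R -> R),
    (forall w, D w ->
      [/\ D (J w),
          L1_limit0 (fun epsilon => Jeps f epsilon lambda w) (J w) &
          forall v, v \in Lfun (@lebesgue_measure R) 1 ->
            L1_limit0 (fun epsilon => Jeps f epsilon lambda w) v ->
            {ae @lebesgue_measure R, forall x, v x = J w x}]) /\
    (forall w1 w2, D w1 -> D w2 ->
      (L1_norm (J w1 \- J w2)%R <= L1_norm (w1 \- w2)%R)%E).
Proof.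
have [fl [fr [L [hs f1]]]] := hyp_f1_split_flux hf.
have LJ w s : D w -> 0 < s -> Jeps f s lambda w \in Lfun (@lebesgue_measure R) 1.
  move=> Dw s0; have [W [_ [[_ hW _] lW _]]] := D_datum Dw.
  by have [] := Jeps_profile hs f1 s0 hlambda Dw hW lW.
have mJ w s : D w -> 0 < s -> measurable_fun setT (Jeps f s lambda w).
  by move=> Dw s0; exact: Lfun1_meas (LJ _ _ Dw s0).
pose lim w : set (R -> R) := [set v | v \in Lfun (@lebesgue_measure R) 1 /\
  L1_limit0 (fun epsilon => Jeps f epsilon lambda w) v].
(* On D a limit exists by completeness, so the default value 0 never matters there. *)
pose J w := xget (fun=> 0) (lim w).
have hJ w : D w -> lim w (J w).
  move=> Dw; apply: xgetPex.
  have [v vL hv] := L1_complete0 (fun s s0 => LJ w s Dw s0) (fun e e0 => Jeps_cauchy hs f1 hlambda Dw e0).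
  by exists v.
have mJ0 w : D w -> measurable_fun setT (J w) by move=> /hJ[/Lfun1_meas].
exists J; split => [w Dw|w1 w2 D1 D2].
  have [JL Jlim] := hJ w Dw; split => // [|v vL hv].
    split => //; apply: (L1_limit0_01 _ _ _ Jlim) => [s s0||s s0]; [exact: mJ|exact: mJ0|].
    exact: Jeps_01 hs f1 s0 hlambda Dw.
  apply: (L1_limit0_uniq _ _ _ hv Jlim) => [s s0||]; [exact: mJ|exact: Lfun1_meas|exact: mJ0].
have [_ /L1_limit0P h1] := hJ w1 D1; have [_ /L1_limit0P h2] := hJ w2 D2.
apply/lee_addgt0Pr => e e0; have e2 : 0 < e / 2 by rewrite divr_gt0.
have [r r0 hr] := h1 _ e2; have [q q0 hq] := h2 _ e2.
(* One viscosity below both thresholds, so that the contraction at this s compares the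
   approximations of [J w1] and [J w2]. *)
pose s := Num.min r q / 2.
have p0 : 0 < Num.min r q by rewrite lt_min r0.
have s0 : 0 < s by rewrite divr_gt0.
have sr : s < r.
  have : Num.min r q <= r by rewrite ge_min lexx.
  by rewrite /s; clear -p0; lra.
have sq : s < q.
  have : Num.min r q <= q by rewrite ge_min lexx orbT.
  by rewrite /s; clear -p0; lra.
have k1 := hr s ltac:(by rewrite s0); have k2 := hq s ltac:(by rewrite s0).
rewrite L1_distC in k1.
apply: le_trans (L1_norm_triangle (mJ0 _ D1) (mJ _ _ D1 s0) (mJ0 _ D2)) _.
rewrite [e]splitr EFinD addeA [leRHS]addeC.
apply: leeD; first exact: k1.
apply: le_trans (L1_norm_triangle (mJ _ _ D1 s0) (mJ _ _ D2 s0) (mJ0 _ D2)) _.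
by apply: leeD => //; exact: Jeps_contraction hs f1 s0 hlambda D1 D2.
Qed.
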